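(* Let $d\in\mathbb{N}$. Then there is a constant $C(d)$ depending only on $d$ such that, whenever $\mu$ is a Radon log-concave probability measure on a locally convex space $E$ and $f\in\mathcal{P}^d(\mu)$, for every function $\varphi\in C_b^\infty(\mathbb{R})$ with $\|\varphi\|_\infty\le 1$ one has $$\sigma_f^{1/d}\int\varphi'(f)\,d\mu\le C(d)\,\|\varphi'\|_\infty^{1-1/d}.$$
   Context: A Borel probability measure on $\mathbb{R}^n$ is log-concave if it has a density of the form $e^{-V}$ with respect to Lebesgue measure on some affine subspace $L$, where $V\colon L\to(-\infty,+\infty]$ is convex. A Radon probability measure $\mu$ on a locally convex space $E$ is log-concave if its images under all continuous linear operators $E\to\mathbb{R}^n$ are log-concave. $\mathcal{P}^d(\mu)$ denotes the closure in $L^2(\mu)$ of the set of functions of the form $p(\ell_1,\dots,\ell_n)$, where $n\in\mathbb{N}$, $\ell_i\in E^*$ (topological dual) and $p$ is a polynomial on $\mathbb{R}^n$ of degree $d$. For $f\in L^2(\mu)$, $\mathbb{E}f=\int f\,d\mu$ and $\sigma_f^2=\int(f-\mathbb{E}f)^2\,d\mu$. $C_b^\infty(\mathbb{R})$ is the space of bounded smooth functions with bounded derivatives of all orders, and $\|\varphi\|_\infty=\sup_t|\varphi(t)|$. *)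

(* Defs.v *)
From HB Require Import structures.
From mathcomp Require Import all_boot all_order all_algebra.
From mathcomp Require Import all_classical all_reals all_analysis.
From mathcomp Require Import measurable_realfun.

Set Implicit Arguments.
Unset Strict Implicit.
Unset Printing Implicit Defensive.

Import Order.TTheory GRing.Theory Num.Def Num.Theory.
Import numFieldNormedType.Exports.

Local Open Scope classical_set_scope.
Local Open Scope ring_scope.

Notation borel T := (g_sigma_algebraType (@open T)).

(* Carrier of a tvs, pointed by 0 (needed for the generated sigma-algebra). *)
Definition ptd (R : realType) (E : tvsType R) : Type := E.
HB.instance Definition _ (R : realType) (E : tvsType R) :=
  Choice.on (ptd E).
HB.instance Definition _ (R : realType) (E : tvsType R) :=
  isPointed.Build (ptd E) (0 : E).
Notation borelE E := (@g_sigma_algebraType (ptd E) (@open E)).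

Section defs.
Variable R : realType.

(* e^{-v} for v in (-oo, +oo]; e^{-(+oo)} = 0.  (-oo never occurs.) *)
Definition expNe (v : \bar R) : \bar R :=
  match v with
  | EFin r => (expR (- r))%:E
  | EPInf => 0%E
  | ENInf => (+oo)%E
  end.

Definition convex_ext (k : nat) (V : 'rV[R]_k -> \bar R) : Prop :=
  (forall x, V x != (-oo)%E) /\
  forall (x y : 'rV[R]_k) (t : R), 0 < t -> t < 1 ->
    (V (t *: x + (1 - t) *: y)%R <= t%:E * V x + (1 - t)%:E * V y)%E.

(* lam is Lebesgue measure on the Borel sets of R^k: it gives every closed
   box its volume (this determines it uniquely). *)
Definition is_lebesgue (k : nat)
    (lam : {measure set (borel 'rV[R]_k) -> \bar R}) : Prop :=
  forall a b : 'rV[R]_k, (forall i, a ord0 i <= b ord0 i) ->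
    lam [set x | forall i, a ord0 i <= x ord0 i <= b ord0 i] =
      (\prod_(i < k) (b ord0 i - a ord0 i))%:E.

(* A Borel measure nu on R^n is log-concave: it has a density e^{-V}, V convex,
   w.r.t. Lebesgue measure on some affine subspace L of R^n.  L is parametrized
   as the image of R^k under the injective affine map x |-> x A + c; Lebesgue
   measure on L is (up to a constant factor, absorbed into V) the image of
   Lebesgue measure on R^k. *)
Definition log_concave_Rn (n : nat) (nu : set 'rV[R]_n -> \bar R) : Prop :=
  exists (k : nat) (A : 'M[R]_(k, n)) (c : 'rV[R]_n)
         (V : 'rV[R]_k -> \bar R) (lam : {measure set (borel 'rV[R]_k) -> \bar R}),
    [/\ row_free A, convex_ext V, is_lebesgue lam,
        measurable_fun [set: borel 'rV[R]_k] (fun x => expNe (V x)) &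
        forall B : set 'rV[R]_n, @measurable _ (borel 'rV[R]_n) B ->
          nu B = (\int[lam]_(x in (fun y : 'rV[R]_k => (y *m A + c)%R) @^-1` B)
                   expNe (V x))%E].

Definition log_concave (E : tvsType R) (mu : probability (borelE E) R) : Prop :=
  forall (n : nat) (F : E -> 'rV[R]_n), linear F -> continuous F ->
    log_concave_Rn (fun B => mu (F @^-1` B)).

Definition radon (E : tvsType R) (mu : probability (borelE E) R) : Prop :=
  forall A : set E, @measurable _ (borelE E) A ->
    mu A = ereal_sup [set mu K | K in
      [set K : set E | [/\ compact K, @measurable _ (borelE E) K & K `<=` A]]].

(* g = p(l_1, ..., l_n) with l_i in E^* and p a polynomial of degree at most d,
   written out as a finite sum of monomials c * l_{i_1} ... l_{i_m}, m <= d. *)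
Definition poly_functional (E : tvsType R) (d : nat) (g : E -> R) : Prop :=
  exists (n : nat) (l : 'I_n -> E -> R) (s : seq (R * seq 'I_n)),
    [/\ forall i, linear (l i : E -> R^o),
        forall i, continuous (l i),
        all (fun m => size m.2 <= d)%N s &
        forall x, g x = \sum_(m <- s) m.1 * \prod_(i <- m.2) l i x].

Definition in_Pd (E : tvsType R) (mu : probability (borelE E) R) (d : nat)
    (f : E -> R) : Prop :=
  [/\ measurable_fun [set: borelE E] f,
      (\int[mu]_x ((f x) ^+ 2)%:E < +oo)%E &
      exists p : nat -> E -> R, (forall m, poly_functional d (p m)) /\
        (fun m => (\int[mu]_x ((f x - p m x) ^+ 2)%:E)%E) @ \oo --> 0%E].

Definition mean (E : tvsType R) (mu : probability (borelE E) R) (f : E -> R) : R :=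
  fine (\int[mu]_x (f x)%:E)%E.

Definition sigma (E : tvsType R) (mu : probability (borelE E) R) (f : E -> R) : R :=
  Num.sqrt (fine (\int[mu]_x ((f x - mean mu f) ^+ 2)%:E)%E).

Definition Cb_infty (phi : R -> R) : Prop :=
  (forall (n : nat) (x : R), derivable (derive1n n phi) x 1) /\
  (forall n : nat, exists M : R, forall x, `|derive1n n phi x| <= M).

Definition supnorm (g : R -> R) : R := sup [set `|g t| | t in [set: R]].

End defs.

(* Main.v *)
(** Proof idea. Let theta satisfy theta^d K sigma = 1, where K bounds |phi'|; the
    claim is E phi'(f) <= C K theta. Approximating f in L^2 and truncating to a
    slab {|l_i| <= M}, one may assume that f is a polynomial on a bounded convex
    set of R^k carrying a measure m with m(A) m(B) <= m((A+B)/2)^2 (Prekopa) and no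
    mass on hyperplanes. Cutting this set by hyperplanes, so as to keep one average
    G of f and the positive average of phi'(f), leads to pieces on which the
    covariance is nearly of rank one: the slices of such a needle have masses p_j
    forming a log-concave sequence, and f is nearly a polynomial q of degree at
    most d in the slice index. There phi'(q) q' is a derivative of a bounded
    function, and van der Corput's method (repeated integration by parts, a large
    derivative of q of some order being available) bounds the sum of p_j times the
    increments of a primitive of phi' o q. One average cannot control both the
    mean and the variance on the needle, so phi is first split by a cutoff at
    distance of order sigma from the mean: near the mean G = (f - E f)^2 is kept,
    away from the mean G = f is kept, and in either case q has spread of order
    sigma as seen from every point where the derivative of the piece of phi is
    nonzero. *)
Require Import Defs.
From HB Require Import structures.
From mathcomp Require Import all_boot all_order all_algebra.
From mathcomp Require Import all_classical all_reals all_analysis.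
From mathcomp Require Import measurable_realfun.
From mathcomp Require Import ring lra zify.

Set Implicit Arguments.
Unset Strict Implicit.
Unset Printing Implicit Defensive.

Import Order.TTheory GRing.Theory Num.Def Num.Theory.
Import numFieldNormedType.Exports.

Local Open Scope classical_set_scope.
Local Open Scope ring_scope.

(** The obstacle is uniformity: the dimension, the size of the slab and the Lipschitz constants of f
    and phi' must not enter the final constant. They occur only in the error made when a piece is
    replaced by a line; the tolerance of the localization and the slice width are chosen after them,
    so that a fixed share of the average of phi'(f) survives. On the needle, lengths are measured in
    units of the inverse peak of the density. A log-concave sequence of total mass 1 with peak eta
    halves within about 2/eta steps, so the line splits into windows of length at most 3 whose
    weights decay geometrically. Looking at a polynomial of degree d from a window at tau costs
    powers (1 + |tau|)^d; theta enters to the power d, so the loss for theta is only (1 + |tau|)^2,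
    which the geometric weights absorb. Roots are avoided until the end: theta is carried along with
    the inequality theta^d K sigma >= 1. *)

Definition box (R : realType) k (a b : 'rV[R]_k) : set 'rV[R]_k :=
  [set x | forall i, a ord0 i <= x ord0 i <= b ord0 i].

(** The empty set is added by hand because in dimension 0 every [box a b] is the whole space; it
    serves as filler in countable unions. *)
Definition boxes (R : realType) k : set (set 'rV[R]_k) :=
  [set B | B = set0 \/ exists a b, B = box a b].

(** * Borel sets of R^k and uniqueness of Lebesgue measure *)

Section borel_rV.
Variable (R : realType).

Lemma measurable_continuous_borel (T : ptopologicalType) (f : T -> R) :
  continuous f -> measurable_fun [set: borel T] f.
Proof.
move=> /continuousP cf; apply: (measurability _ (RGenOpens.measurableE R)).
move=> _ [_ [a [b ->]] <-]; rewrite setTI.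
by apply: sub_sigma_algebra; exact/cf/interval_open.
Qed.

Lemma measurable_coord k (i : 'I_k) :
  measurable_fun [set: borel 'rV[R]_k] (fun x : 'rV[R]_k => x ord0 i).
Proof. by apply: measurable_continuous_borel; exact: coord_continuous. Qed.

Lemma measurable_box_preimage d (T : measurableType d) k (g : T -> 'rV[R]_k)
    (a b : 'rV[R]_k) :
  (forall i, measurable_fun [set: T] (fun t => g t ord0 i)) ->
  measurable (g @^-1` box a b).
Proof.
move=> mg.
have -> : g @^-1` box a b =
    \bigcap_(i in [set: 'I_k]) (fun t => g t ord0 i) @^-1` `[a ord0 i, b ord0 i]%classic.
  apply/seteqP; split => t /= h i; first by move=> _ /=; rewrite in_itv /=; apply: h.
  by have := h i I; rewrite /= in_itv.
apply: fin_bigcap_measurable => [|i _]; first exact: finite_finset.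
by rewrite -[X in measurable X]setTI; apply: mg => //; exact: measurable_itv.
Qed.

Lemma measurable_box k (a b : 'rV[R]_k) : measurable (box a b : set (borel 'rV[R]_k)).
Proof. exact: (@measurable_box_preimage _ (borel 'rV[R]_k) k id a b (@measurable_coord k)). Qed.

(** Boxes with rational corners form a countable family, enumerated through [pickle]; codes that
    decode to nothing, or to a box that leaves [U], contribute the empty set. *)
Lemma open_bigcup_box k (U : set 'rV[R]_k) : open U ->
  exists F : nat -> set 'rV[R]_k, (forall n, boxes (F n)) /\ U = \bigcup_n F n.
Proof.
move=> oU.
pose B (p : 'rV[rat]_k * 'rV[rat]_k) : set 'rV[R]_k := box (map_mx ratr p.1) (map_mx ratr p.2).
pose F n := if unpickle n is Some p then (if `[< B p `<=` U >] then B p else set0) else set0.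
exists F; split.
  move=> n; rewrite /F; case: unpickle => [p|]; last by left.
  by case: ifPn => _; [right; exists (map_mx ratr p.1), (map_mx ratr p.2) | left].
apply/seteqP; split => x; last first.
  move=> [n _]; rewrite /F; case: unpickle => // p.
  by case: ifPn => // /asboolP; apply.
move=> Ux.
have /nbhs_ballP[e /= e0 eU] : nbhs x U by exact: open_nbhs_nbhs.
have ha i : {q : rat | x ord0 i - e < ratr q < x ord0 i}.
  apply: cid; have : x ord0 i - e < x ord0 i by rewrite ltrBlDr ltrDl.
  by move=> /rat_in_itvoo[q]; rewrite in_itv/= => h; exists q.
have hb i : {q : rat | x ord0 i < ratr q < x ord0 i + e}.
  apply: cid; have : x ord0 i < x ord0 i + e by rewrite ltrDl.
  by move=> /rat_in_itvoo[q]; rewrite in_itv/= => h; exists q.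
pose p : 'rV[rat]_k * 'rV[rat]_k := (\row_i sval (ha i), \row_i sval (hb i)).
have BU : B p `<=` U.
  move=> y Bp; apply: eU; split => // i j; rewrite (ord1 i).
  have /= := Bp j; rewrite !mxE /=.
  move: (svalP (ha j)) (svalP (hb j)) => /andP[h1 h2] /andP[h3 h4] /andP[h5 h6].
  rewrite /ball /= ltr_distl; apply/andP; split; last by lra.
  lra.
exists (pickle p) => //; rewrite /F pickleK asboolT// => i.
rewrite !mxE; move: (svalP (ha i)) (svalP (hb i)) => /andP[h1 h2] /andP[h3 h4].
by rewrite !ltW.
Qed.

(** The boxes are a pi-system, so this gives both the uniqueness of Lebesgue measure and the
    coordinatewise criterion for measurability. *)
Lemma boxesE k : @measurable _ (borel 'rV[R]_k) = <<s @boxes R k >>.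
Proof.
apply/seteqP; split.
  apply: smallest_sub; first exact: smallest_sigma_algebra.
  move=> U /open_bigcup_box[F [bF UF]]; rewrite UF.
  by apply: (@bigcupT_measurable _ (g_sigma_algebraType (@boxes R k))) => n; exact: sub_sigma_algebra.
apply: smallest_sub; first exact: sigma_algebra_measurable.
by move=> B [->|[a [b ->]]]; [exact: measurable0 | exact: measurable_box].
Qed.

Lemma measurable_rV d (T : measurableType d) k (g : T -> 'rV[R]_k) :
  (forall i, measurable_fun [set: T] (fun t => g t ord0 i)) ->
  measurable_fun [set: T] (g : T -> borel 'rV[R]_k).
Proof.
move=> mg; apply: (measurability _ (boxesE k)).
move=> _ [B [->|[a [b ->]]] <-]; rewrite setTI; first by rewrite preimage_set0.
exact: measurable_box_preimage.
Qed.

Lemma boxes_setI k : setI_closed (@boxes R k).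
Proof.
move=> A B [->|[a [b ->]]]; first by rewrite set0I; left.
move=> [->|[c [d ->]]]; first by rewrite setI0; left.
right; exists (\row_i Num.max (a ord0 i) (c ord0 i)), (\row_i Num.min (b ord0 i) (d ord0 i)).
apply/seteqP; split => x /=.
  move=> [h1 h2] i; rewrite !mxE ge_max le_min.
  by have /andP[-> ->] := h1 i; have /andP[-> ->] := h2 i.
by move=> h; split => i; have := h i; rewrite !mxE ge_max le_min => /andP[/andP[? ?] /andP[? ?]]; apply/andP.
Qed.

Lemma box_cover k : \bigcup_n box (const_mx (- n%:R)) (const_mx n%:R) = [set: 'rV[R]_k].
Proof.
rewrite -subTset => x _.
pose M := \sum_(i < k) `|x ord0 i|.
exists (Num.bound M) => // i; rewrite !mxE -ler_norml.
apply: le_trans (ltW (archi_boundP _)); last by exact: sumr_ge0.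
by rewrite /M (bigD1 i)//= lerDl; exact: sumr_ge0.
Qed.

Definition box_volume k (a b : 'rV[R]_k) : R := \prod_(i < k) (b ord0 i - a ord0 i).

Lemma is_lebesgue_box k (lam : {measure set (borel 'rV[R]_k) -> \bar R}) n :
  is_lebesgue lam -> (lam (box (const_mx (- n%:R)%R) (const_mx n%:R%R)) < +oo)%E.
Proof.
move=> h; pose a : 'rV[R]_k := const_mx (- n%:R); pose b : 'rV[R]_k := const_mx n%:R.
have ab i : a ord0 i <= b ord0 i by rewrite !mxE; have := ler0n R n; lra.
by rewrite [X in (X < _)%E](h a b ab); exact: ltry.
Qed.

Lemma is_lebesgue_unique k (l1 l2 : {measure set (borel 'rV[R]_k) -> \bar R}) :
  is_lebesgue l1 -> is_lebesgue l2 -> forall A, measurable A -> l1 A = l2 A.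
Proof.
move=> h1 h2 A mA.
apply: (@measure_unique _ R (borel 'rV[R]_k) (@boxes R k) (fun n => box (const_mx (- n%:R)) (const_mx n%:R))) => //.
- exact: boxesE.
- exact: boxes_setI.
- by move=> n; right; eexists; eexists.
- exact: box_cover.
- move=> B [->|[a [b ->]]]; first by rewrite !measure0.
  (* [is_lebesgue] speaks only of ordered corners; a box with a reversed pair of bounds is empty. *)
  have [ab|] := pselect (forall i, a ord0 i <= b ord0 i).
    by transitivity ((box_volume a b)%:E); [exact: h1|apply/esym; exact: h2].
  move=> /existsNP[i /negP]; rewrite -ltNge => ba.
  suff -> : box a b = set0 by rewrite !measure0.
  by rewrite -subset0 => x /(_ i) /andP[/le_trans h] /h; rewrite leNgt ba.
- by move=> n; exact: is_lebesgue_box.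
Qed.

Lemma is_lebesgue_sigma_finite k (lam : {measure set (borel 'rV[R]_k) -> \bar R}) :
  is_lebesgue lam -> sigma_finite setT lam.
Proof.
move=> h; exists (fun n => box (const_mx (- n%:R)) (const_mx n%:R)).
  by rewrite box_cover.
by move=> n; split; [exact: measurable_box | exact: is_lebesgue_box].
Qed.

End borel_rV.

(** * The Prekopa-Leindler inequality at the midpoint *)

Section brunn_minkowski_line.
Variable R : realType.
Local Notation leb := (@lebesgue_measure R).
Local Open Scope ereal_scope.

Let half_map (b z : R) : measurableTypeR R := (2 * z - b)%R.

Let measurable_half_map b : measurable_fun [set: measurableTypeR R] (half_map b).
Proof. by apply: measurable_funB => //; exact: measurable_funM. Qed.

(** Both sides are measures in [A] that agree on half-open intervals. The factor 2 undoes the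
    halving hidden in midpoints. *)
Lemma lebesgue_measure_half (b : R) (A : set R) : measurable A ->
  leb A = 2%:E * leb [set z | A (2 * z - b)%R].
Proof.
move=> mA.
pose p : {measure set (measurableTypeR R) -> \bar R} := pushforward leb (half_map b).
pose m : {measure set (measurableTypeR R) -> \bar R} :=
  mscale (NngNum (ler0n R 2)) (p (measurable_half_map b)).
have -> : 2%:E * leb [set z | A (2 * z - b)%R] = m A by [].
apply: lebesgue_measure_unique mA => _ [[x y] _ <-] /=.
rewrite /mscale /= /pushforward.
have -> : half_map b @^-1` `]x, y]%classic = `] ((x + b) / 2)%R, ((y + b) / 2)%R]%classic.
  apply/seteqP; split => z /=; rewrite !in_itv /half_map /= => /andP[? ?]; apply/andP; split; lra.
rewrite !lebesgue_measure_itv /= !lte_fin.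
have -> : ((x + b) / 2 < (y + b) / 2)%R = (x < y)%R by rewrite ltr_pM2r// ltrD2r.
case: ltP => xy; last by rewrite mule0.
by rewrite -!EFinB -EFinM; congr (_%:E); field.
Qed.

(** [C] contains both (A + b)/2 and (a + B)/2. With [a] close to the supremum of [A] and [b] close
    to the infimum of [B], these two sets overlap within an interval of length at most e/2, so their
    measures almost add up inside [C]. *)
Lemma brunn_minkowski_bounded (A B C : set R) (N : R) :
  measurable A -> measurable B -> measurable C ->
  A !=set0 -> B !=set0 ->
  (forall x, A x -> `|x| <= N)%R -> (forall x, B x -> `|x| <= N)%R ->
  (forall x y, A x -> B y -> C ((x + y) / 2)%R) ->
  leb A + leb B <= 2%:E * leb C.
Proof.
move=> mA mB mC A0 B0 AN BN ABC.
have supA : has_sup A by split => //; exists N => x /AN; rewrite ler_norml => /andP[].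
have infB : has_inf B by split => //; exists (- N)%R => x /BN; rewrite ler_norml => /andP[].
apply/lee_addgt0Pr => e e0.
have e2 : (0 < e / 2)%R by lra.
have [a Aa ha] := sup_adherent e2 supA.
have [b Bb hb] := inf_adherent e2 infB.
pose S1 : set R := [set z | A (2 * z - b)%R].
pose S2 : set R := [set z | B (2 * z - a)%R].
have mS1 : measurable S1.
  by rewrite -[S1]setTI; exact: (measurable_half_map b).
have mS2 : measurable S2.
  by rewrite -[S2]setTI; exact: (measurable_half_map a).
have S1C : S1 `<=` C by move=> z /ABC /(_ Bb); rewrite subrK mulrAC divff// mul1r.
have S2C : S2 `<=` C by move=> z Bz; have := ABC _ _ Aa Bz; rewrite addrC subrK mulrAC divff// mul1r.
have S12 : S2 `&` S1 `<=` `[((a + inf B) / 2)%R, ((sup A + b) / 2)%R]%classic.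
  move=> z [z2 z1] /=; rewrite in_itv /=.
  have := ub_le_sup supA.2 z1; have := ge_inf infB.2 z2; lra.
rewrite (lebesgue_measure_half b mA) (lebesgue_measure_half a mB) -/S1 -/S2.
have -> : 2%:E * leb C + e%:E = 2%:E * (leb C + (e / 2)%:E).
  rewrite ge0_muleDr ?lee_fin ?measure_ge0 ?ltW//; congr (_ + _).
  by rewrite -EFinM; congr (_%:E); field.
rewrite -ge0_muleDr ?measure_ge0// lee_pmul2l ?lte_fin//.
have S2E : leb S2 = leb (S2 `\` S1) + leb (S2 `&` S1) by exact: measureDI.
rewrite [leb S2]S2E addeA; apply: leeD; last first.
  apply: (@le_trans _ _ (leb `[((a + inf B) / 2)%R, ((sup A + b) / 2)%R]%classic)).
    by apply: le_measure; rewrite ?inE//; exact: measurableI.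
  rewrite lebesgue_measure_itv /= lte_fin; case: ltP => _; rewrite ?lee_fin; lra.
rewrite -measureU//.
- apply: le_measure; rewrite ?inE//; first by apply: measurableU => //; exact: measurableD.
  by rewrite subUset; split => // z [/S2C].
- exact: measurableD.
- by rewrite setDE setICA setICr setI0.
Qed.

Lemma brunn_minkowski_line (A B C : set R) :
  measurable A -> measurable B -> measurable C ->
  A !=set0 -> B !=set0 ->
  (forall x y, A x -> B y -> C ((x + y) / 2)%R) ->
  leb A + leb B <= 2%:E * leb C.
Proof.
move=> mA mB mC [a Aa] [b Bb] ABC.
pose I n : set R := `[(- n%:R)%R, n%:R]%classic.
have mI n : measurable (I n) by exact: measurable_itv.
have ndI : nondecreasing_seq I.
  move=> m n mn; apply/subsetPset => x; rewrite /I /= !in_itv /= -!ler_norml => /le_trans; apply.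
  by rewrite ler_nat.
have cupI : \bigcup_n I n = setT.
  rewrite -subTset => x _; exists (Num.bound `|x|) => //=.
  by rewrite /I /= in_itv /= -ler_norml ltW// archi_boundP.
have cvgI (D : set R) : measurable D -> (leb \o (fun n => D `&` I n)) @ \oo --> leb D.
  move=> mD; have DE : \bigcup_n (D `&` I n) = D by rewrite -setI_bigcupr cupI setIT.
  rewrite -[in X in _ --> X]DE; apply: nondecreasing_cvg_mu.
  - by move=> n; exact: (measurableI _ _ mD (mI n)).
  - by rewrite DE.
  - by move=> m n mn; apply/subsetPset; apply: setIS; apply/subsetPset; exact: ndI.
have -> : leb A + leb B = limn (fun n => leb (A `&` I n) + leb (B `&` I n)).
  apply/esym/cvg_lim => //; apply: cvgeD; [|exact: cvgI|exact: cvgI].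
  by rewrite ge0_adde_def// inE measure_ge0.
apply: lime_le.
  apply/cvg_ex; exists (leb A + leb B); apply: cvgeD; [|exact: cvgI|exact: cvgI].
  by rewrite ge0_adde_def// inE measure_ge0.
exists (maxn (Num.bound `|a|) (Num.bound `|b|)) => // n /=; rewrite geq_max => /andP[an bn].
apply: (@brunn_minkowski_bounded _ _ _ n%:R) => //; try by apply: (measurableI _ _ _ (mI n)).
- exists a; split => //; rewrite /I /= in_itv /= -ler_norml; apply: (le_trans (ltW (archi_boundP _))) => //.
  by rewrite ler_nat.
- exists b; split => //; rewrite /I /= in_itv /= -ler_norml; apply: (le_trans (ltW (archi_boundP _))) => //.
  by rewrite ler_nat.
- by move=> x [_]; rewrite /I /= in_itv /= -ler_norml.
- by move=> x [_]; rewrite /I /= in_itv /= -ler_norml.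
- by move=> x y [Ax _] [By _]; exact: ABC.
Qed.

End brunn_minkowski_line.

Section layer_cake.
Variable R : realType.
Local Notation leb := (@lebesgue_measure R).
Local Open Scope ereal_scope.
Variables (f : R -> \bar R) (c : R).
Hypotheses (mf : measurable_fun [set: measurableTypeR R] f) (f0 : forall x, 0 <= f x) (c0 : (0 < c)%R).

Let hypo : set (measurableTypeR R * measurableTypeR R) :=
  [set z | (0 < z.2 < 1)%R /\ (c * z.2)%:E < f z.1].

Let measurable_hypo : measurable hypo.
Proof.
have -> : hypo = (snd @^-1` `]0%R, 1%R[%classic) `&` [set z | (c * z.2)%:E < f z.1].
  by apply/seteqP; split => z [] /=; rewrite in_itv.
have m1 : measurable_fun [set: measurableTypeR R * measurableTypeR R] (f \o fst).
  exact: measurableT_comp.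
have m2 : measurable_fun [set: measurableTypeR R * measurableTypeR R]
    (fun z : measurableTypeR R * measurableTypeR R => (c * z.2)%:E).
  by apply/measurable_EFinP; apply: measurable_funM => //; exact: measurable_snd.
apply: measurableI.
  rewrite -[X in measurable X]setTI; apply: measurable_snd => //; exact: measurable_itv.
by rewrite -[X in measurable X]setTI; exact: measurable_lte.
Qed.

(** Heights are measured in units of [c], so that functions with different suprema can be compared
    at the same relative height. *)
Definition superlevel (s : R) : set R := [set x | (c * s)%:E < f x].

Let ysection_hypo (s : R) : (0 < s < 1)%R -> ysection hypo s = superlevel s.
Proof.
move=> s01; apply/seteqP; split => x; rewrite /ysection /=; first by move=> /set_mem[].
by move=> h; apply/mem_set.
Qed.

Lemma measurable_superlevel s : measurable (superlevel s).
Proof. by rewrite -[superlevel s]setTI; exact: emeasurable_fun_o_infty. Qed.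

Lemma measurable_fun_superlevel : measurable_fun (`]0%R, 1%R[%classic : set (measurableTypeR R)) (fun s => leb (superlevel s)).
Proof.
apply: (@eq_measurable_fun _ _ _ _ _ (leb \o ysection hypo)).
  by move=> s; rewrite inE /= in_itv /= => s01; rewrite /= ysection_hypo.
by apply: measurable_funTS; exact: measurable_fun_ysection.
Qed.

Let leb_xsection_hypo x : leb (xsection hypo x) = mine (f x * c^-1%:E) 1.
Proof.
have [t tE t0] : exists2 t, t%:E = mine (f x * c^-1%:E) 1 & (0 <= t)%R.
  have : 0 <= mine (f x * c^-1%:E) 1.
    by rewrite le_min lee01 andbT mule_ge0// lee_fin invr_ge0 ltW.
  have : mine (f x * c^-1%:E) 1 <= 1 by rewrite ge_min lexx orbT.
  by case: mine => // r _; rewrite lee_fin => r0; exists r.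
rewrite -tE.
have -> : xsection hypo x = `]0%R, t[%classic.
  apply/seteqP; split => s; rewrite /xsection /= in_itv /=.
    move=> /set_mem[/= /andP[s0 s1] h]; rewrite s0 /= -lte_fin tE lt_min lte_fin s1 andbT.
    by rewrite lte_pdivlMr// -EFinM mulrC.
  move=> /andP[s0]; rewrite -lte_fin tE lt_min lte_fin => /andP[h s1].
  by apply/mem_set; split; rewrite /= ?s0 ?s1//; rewrite mulrC EFinM -lte_pdivlMr.
rewrite lebesgue_measure_itv /= lte_fin; case: ltP => [_|h]; first by rewrite sube0.
by congr (_%:E); lra.
Qed.

(** Tonelli on the region under the graph cut at height [c]: the section above [x] is an interval of
    length min(f x / c, 1). *)
Lemma layer_cakeE :
  \int[leb]_(s in `]0%R, 1%R[) leb (superlevel s) = \int[leb]_x mine (f x * c^-1%:E) 1.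
Proof.
transitivity (\int[leb]_s (leb \o ysection hypo) s).
  rewrite [LHS]integral_mkcond; apply: eq_integral => s _.
  rewrite patchE; case: ifPn => /=.
    by rewrite inE /= in_itv /= => s01; rewrite ysection_hypo.
  rewrite notin_setE /= in_itv /= => s01.
  by rewrite (_ : ysection _ _ = set0) ?measure0// -subset0 => x; rewrite /ysection /= => /set_mem[].
have := @indic_fubini_tonelli _ _ _ _ R leb leb hypo measurable_hypo.
rewrite indic_fubini_tonelli_FE// indic_fubini_tonelli_GE// => <-.
by apply: eq_integral => x _ /=.
Qed.

Lemma layer_cake_le :
  \int[leb]_(s in `]0%R, 1%R[) leb (superlevel s) * c%:E <= \int[leb]_x f x.
Proof.
have mm : measurable_fun [set: measurableTypeR R] (fun x => mine (f x * c^-1%:E) 1).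
  by apply: measurable_mine => //; exact: emeasurable_funM.
have mm0 x : 0 <= mine (f x * c^-1%:E) 1.
  by rewrite le_min lee01 andbT mule_ge0// lee_fin invr_ge0 ltW.
rewrite layer_cakeE -ge0_integralZr//; last by rewrite lee_fin ltW.
apply: ge0_le_integral => //.
- by move=> x _; rewrite mule_ge0// lee_fin ltW.
- exact: emeasurable_funM.
- move=> x _; apply: (@le_trans _ _ (f x * c^-1%:E * c%:E)).
    by rewrite lee_pmul2r// ge_min lexx.
  by rewrite -muleA -EFinM mulVf ?gt_eqF// mule1.
Qed.

Lemma layer_cake_ge : (forall x, f x <= c%:E) ->
  \int[leb]_x f x <= \int[leb]_(s in `]0%R, 1%R[) leb (superlevel s) * c%:E.
Proof.
move=> fc.
have mm : measurable_fun [set: measurableTypeR R] (fun x => mine (f x * c^-1%:E) 1).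
  by apply: measurable_mine => //; exact: emeasurable_funM.
have mm0 x : 0 <= mine (f x * c^-1%:E) 1.
  by rewrite le_min lee01 andbT mule_ge0// lee_fin invr_ge0 ltW.
rewrite layer_cakeE -ge0_integralZr//; last by rewrite lee_fin ltW.
apply: ge0_le_integral => //.
- exact: emeasurable_funM.
- move=> x _; rewrite /mine; case: ltP => _.
    by rewrite -muleA -EFinM mulVf ?gt_eqF// mule1.
  by rewrite mul1e.
Qed.

End layer_cake.

Section prekopa_line.
Variable R : realType.
Local Notation leb := (@lebesgue_measure R).
Local Open Scope ereal_scope.

(** Measuring [f] and [g] in units of their suprema and [h] in units of sqrt(a b) makes the
    superlevel sets of [f] and [g] nonempty at the same relative heights, so Brunn-Minkowski applies
    at each of them. Integrating gives an inequality with an arithmetic mean, and the product form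
    follows from 4 i j <= (i + j)^2. *)
Lemma prekopa_line_normalized (f g h : R -> \bar R) (a b : R) :
  measurable_fun [set: measurableTypeR R] f ->
  measurable_fun [set: measurableTypeR R] g ->
  measurable_fun [set: measurableTypeR R] h ->
  (forall x, 0 <= f x) -> (forall x, 0 <= g x) -> (forall x, 0 <= h x) ->
  (0 < a)%R -> (0 < b)%R ->
  (forall x, f x <= a%:E) -> (forall x, g x <= b%:E) ->
  (forall s, (0 < s < 1)%R -> superlevel f a s !=set0) ->
  (forall s, (0 < s < 1)%R -> superlevel g b s !=set0) ->
  (forall x y, f x * g y <= h ((x + y) / 2)%R * h ((x + y) / 2)%R) ->
  \int[leb]_x f x * \int[leb]_x g x <= \int[leb]_x h x * \int[leb]_x h x.
Proof.
move=> mf mg mh f0 g0 h0 a0 b0 fa gb fne gne fgh.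
pose c := Num.sqrt (a * b).
have c0 : (0 < c)%R by rewrite sqrtr_gt0 mulr_gt0.
have cc : (c * c = a * b)%R by rewrite -expr2 sqr_sqrtr// mulr_ge0// ltW.
set H := \int[leb]_x h x.
have H0 : 0 <= H by apply: integral_ge0 => x _; exact: h0.
have I0 F d : 0 <= \int[leb]_(s in `]0%R, 1%R[) leb (superlevel F d s).
  by apply: integral_ge0.
have BM : \int[leb]_(s in `]0%R, 1%R[) leb (superlevel f a s) +
    \int[leb]_(s in `]0%R, 1%R[) leb (superlevel g b s) <=
    2%:E * \int[leb]_(s in `]0%R, 1%R[) leb (superlevel h c s).
  have mI : measurable (`]0%R, 1%R[%classic : set (measurableTypeR R)) by exact: measurable_itv.
  rewrite -ge0_integralD//; [|exact: measurable_fun_superlevel..].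
  rewrite -ge0_integralZl//; [|exact: measurable_fun_superlevel].
  apply: ge0_le_integral => //.
  - by move=> s _; rewrite adde_ge0.
  - by apply: emeasurable_funD; exact: measurable_fun_superlevel.
  - by apply: emeasurable_funM => //; exact: measurable_fun_superlevel.
  move=> s /=; rewrite in_itv /= => s01.
  apply: brunn_minkowski_line; try exact: measurable_superlevel; [exact: fne|exact: gne|].
  move=> x y; rewrite /superlevel /= => fx gy; rewrite ltNge; apply/negP => hc.
  have [u fu] : exists u, f x = u%:E.
    by move: (f0 x) (fa x); case: (f x) => // r; exists r.
  have [v gv] : exists v, g y = v%:E.
    by move: (g0 y) (gb y); case: (g y) => // r; exists r.
  move: fx gy; rewrite fu gv !lte_fin => fx gy.
  have := fgh x y; rewrite fu gv => /le_trans /(_ (lee_pmul (h0 _) (h0 _) hc hc)).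
  rewrite -!EFinM lee_fin leNgt => /negP; apply.
  have -> : (c * s * (c * s) = (a * s) * (b * s))%R.
    by rewrite mulrACA cc; ring.
  case/andP: s01 => s0 s1.
  by apply: ltr_pM => //; apply: mulr_ge0; exact: ltW.
have Fle := layer_cake_ge mf f0 a0 fa.
have Gle := layer_cake_ge mg g0 b0 gb.
have Hle := layer_cake_le mh h0 c0.
apply: (@le_trans _ _ _ _ _ (lee_pmul _ _ Fle Gle)); [exact: integral_ge0|exact: integral_ge0|].
move: BM Hle (I0 f a) (I0 g b) (I0 h c).
rewrite -/H; move: H H0.
case: (\int[leb]_(s in `]0%R, 1%R[) leb (superlevel h c s)) => [k||//]; last first.
  move=> H H0 _; rewrite mulyr gtr0_sg// mul1e leye_eq => /eqP -> _ _ _.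
  by rewrite mulyy leey.
case: (\int[leb]_(s in `]0%R, 1%R[) leb (superlevel f a s)) => [i||//]; last first.
  by move=> H H0; case: (\int[leb]_(s in `]0%R, 1%R[) leb (superlevel g b s)).
case: (\int[leb]_(s in `]0%R, 1%R[) leb (superlevel g b s)) => [j||//]; last first.
  by move=> H H0.
move=> H H0; rewrite -!EFinM -EFinD !lee_fin => ij kH i0 j0 k0.
apply: (@le_trans _ _ ((k * c) * (k * c))%:E); last first.
  by rewrite EFinM; apply: lee_pmul => //; rewrite lee_fin mulr_ge0// ltW.
rewrite lee_fin mulrACA [leRHS]mulrACA cc ler_pM2r ?mulr_gt0//.
have ijk : ((i + j) * (i + j) <= (2 * k) * (2 * k))%R by apply: ler_pM => //; exact: addr_ge0.
have := sqr_ge0 (i - j)%R; move: ijk; rewrite expr2.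
set t := (i + j)%R; have -> : ((i - j) * (i - j) = t * t - 4 * (i * j))%R by rewrite /t; ring.
lra.
Qed.

(** Truncating [f] and [g] at height n provides the finite suprema of the normalized case; monotone
    convergence removes the truncation. *)
Lemma prekopa_line (f g h : R -> \bar R) :
  measurable_fun [set: measurableTypeR R] f ->
  measurable_fun [set: measurableTypeR R] g ->
  measurable_fun [set: measurableTypeR R] h ->
  (forall x, 0 <= f x) -> (forall x, 0 <= g x) -> (forall x, 0 <= h x) ->
  (forall x y, f x * g y <= h ((x + y) / 2)%R * h ((x + y) / 2)%R) ->
  \int[leb]_x f x * \int[leb]_x g x <= \int[leb]_x h x * \int[leb]_x h x.
Proof.
move=> mf mg mh f0 g0 h0 fgh.
have HH : 0 <= \int[leb]_x h x * \int[leb]_x h x.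
  by apply: mule_ge0; apply: integral_ge0 => x _; exact: h0.
pose tr (F : R -> \bar R) (n : nat) x := mine (F x) n%:R%:E.
have trE (F : R -> \bar R) n x : 0 <= F x -> (fine (tr F n x))%:E = tr F n x.
  move=> Fx; rewrite fineK// ge0_fin_numE; last by rewrite le_min Fx lee_fin ler0n.
  by apply: (@le_lt_trans _ _ n%:R%:E); rewrite ?ltry// ge_min lexx orbT.
have tr0 (F : R -> \bar R) n x : 0 <= F x -> 0 <= tr F n x.
  by move=> Fx; rewrite le_min Fx lee_fin ler0n.
have mtr (F : R -> \bar R) n : measurable_fun [set: measurableTypeR R] F ->
    measurable_fun [set: measurableTypeR R] (tr F n).
  by move=> mF; exact: measurable_mine.
have supP (F : R -> \bar R) n : (forall x, 0 <= F x) ->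
    (exists x, 0 < tr F n x) -> exists c : R, [/\ (0 < c)%R,
      forall x, tr F n x <= c%:E & forall s, (0 < s < 1)%R -> superlevel (tr F n) c s !=set0].
  move=> F0 [x Fx]; pose S := range (fine \o tr F n).
  have hS : has_sup S.
    split; first by exists (fine (tr F n x)), x.
    exists n%:R => _ [y _ <-] /=; rewrite -lee_fin trE//.
    by rewrite ge_min lexx orbT.
  have supge y : tr F n y <= (sup S)%:E.
    by rewrite -trE// lee_fin; apply: ub_le_sup; [exact: hS.2|exists y].
  have c0 : (0 < sup S)%R by rewrite -lte_fin; exact: lt_le_trans (supge x).
  exists (sup S); split => // s /andP[s0 s1].
  have e0 : (0 < sup S - sup S * s)%R by rewrite subr_gt0 -{2}[sup S]mulr1 ltr_pM2l.
  have [_ [y _ <-] hy] := sup_adherent e0 hS.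
  exists y; rewrite /superlevel /= -trE// lte_fin.
  by move: hy; rewrite /=; lra.
have step n : \int[leb]_x tr f n x * \int[leb]_x tr g n x <= \int[leb]_x h x * \int[leb]_x h x.
  have [fp|/forallNP fn] := pselect (exists x, 0 < tr f n x); last first.
    rewrite (_ : \int[leb]_x tr f n x = 0) ?mul0e//.
    apply: integral0_eq => x _; apply/eqP; rewrite eq_le tr0// andbT leNgt.
    by apply/negP; exact: fn.
  have [gp|/forallNP gn] := pselect (exists x, 0 < tr g n x); last first.
    rewrite (_ : \int[leb]_x tr g n x = 0) ?mule0//.
    apply: integral0_eq => x _; apply/eqP; rewrite eq_le tr0// andbT leNgt.
    by apply/negP; exact: gn.
  have [a [a0 fa fne]] := supP _ _ f0 fp.
  have [b [b0 gb gne]] := supP _ _ g0 gp.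
  apply: (@prekopa_line_normalized _ _ _ a b) => //; try exact: mtr; try by move=> x; exact: tr0.
  move=> x y; apply: le_trans (fgh x y).
  by apply: lee_pmul; rewrite ?tr0// ge_min lexx.
have lim_tr (F : R -> \bar R) : measurable_fun [set: measurableTypeR R] F -> (forall x, 0 <= F x) ->
    (fun n => \int[leb]_x tr F n x) @ \oo --> \int[leb]_x F x.
  move=> mF F0.
  rewrite (_ : \int[leb]_x F x = \int[leb]_x limn (tr F ^~ x)).
    apply: cvg_monotone_convergence => //.
    - by move=> n; exact: mtr.
    - by move=> n x _; exact: tr0.
    - move=> x _ m n mn; rewrite le_min ge_min lexx /= ge_min lee_fin ler_nat mn orbT//.
  apply: eq_integral => x _; apply/esym/cvg_lim => //.
  rewrite /tr; have := F0 x; case: (F x) => [r| |//] _; last first.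
    rewrite (_ : (fun n => _) = fun n => n%:R%:E); last first.
      by apply/funext => n; rewrite /mine; case: ltP => //; rewrite leye_eq => /eqP.
    apply/cvgeyPge => A; exists (Num.bound `|A|) => // n /= hn; rewrite lee_fin.
    apply: le_trans (ler_norm _) _; apply: le_trans (ltW (archi_boundP _)) _ => //.
    by rewrite ler_nat.
  apply: cvg_near_cst; exists (Num.bound `|r|) => // n /= hn.
  rewrite /mine lte_fin; case: ltP => // nr.
  congr (_%:E); apply/eqP; rewrite eq_le nr /=; apply: le_trans (ler_norm _) _.
  by apply: le_trans (ltW (archi_boundP _)) _; rewrite ?ler_nat.
have If0 : 0 <= \int[leb]_x f x by exact: integral_ge0.
have Ig0 : 0 <= \int[leb]_x g x by exact: integral_ge0.
(* Zero integrals are split off because the product of extended reals is not continuous at 0 times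
   infinity. *)
have [->|fn0] := eqVneq (\int[leb]_x f x) 0; first by rewrite mul0e.
have [->|gn0] := eqVneq (\int[leb]_x g x) 0; first by rewrite mule0.
have cv : (fun n => \int[leb]_x tr f n x * \int[leb]_x tr g n x) @ \oo -->
    \int[leb]_x f x * \int[leb]_x g x.
  apply: cvgeM; [|exact: lim_tr|exact: lim_tr].
  by rewrite mule_defE (negbTE fn0) (negbTE gn0).
rewrite -(cvg_lim _ cv)//; apply: lime_le; first by apply/cvg_ex; eexists; exact: cv.
by apply: nearW.
Qed.

End prekopa_line.

Section sigma_finite_pack.
Context d (T : measurableType d) (R : realType).

(** The proof of sigma-finiteness is a parameter of the constant, so that a structure can be
    declared on it. Densities and probabilities are packaged by the same device below. *)
Definition sigma_finite_copy (m : {measure set T -> \bar R})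
  of sigma_finite setT m : set T -> \bar R := m.

HB.instance Definition _ (m : {measure set T -> \bar R}) (h : sigma_finite setT m) :=
  Measure.copy (sigma_finite_copy h) m.

HB.instance Definition _ (m : {measure set T -> \bar R}) (h : sigma_finite setT m) :=
  Measure_isSigmaFinite.Build d T R (sigma_finite_copy h) h.

Lemma sigma_finite_measureP (m : {measure set T -> \bar R}) : sigma_finite setT m ->
  exists m' : {sigma_finite_measure set T -> \bar R}, forall A, m' A = m A.
Proof. by move=> h; exists (sigma_finite_copy h). Qed.

End sigma_finite_pack.

Lemma pushforward_measureP d1 d2 (T1 : measurableType d1) (T2 : measurableType d2)
    (R : realType) (m : {measure set T1 -> \bar R}) (f : T1 -> T2) :
  measurable_fun setT f ->
  exists m' : {measure set T2 -> \bar R}, (forall A, m' A = m (f @^-1` A)) /\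
    forall g : T2 -> \bar R, measurable_fun setT g -> (forall y, 0 <= g y)%E ->
      (\int[m']_y g y = \int[m]_x g (f x))%E.
Proof.
move=> mf; pose p : {measure set T2 -> \bar R} := pushforward m f.
exists (p mf); split => // g mg g0.
by rewrite (ge0_integral_pushforward mf)// preimage_setT.
Qed.

(** * Lebesgue measure on R^k, built one coordinate at a time *)

Section cons_row.
Variables (R : realType) (k : nat).

Definition cons_row (z : R * 'rV[R]_k) : 'rV[R]_k.+1 :=
  \row_j (if unlift ord0 j is Some i then z.2 ord0 i else z.1).

Lemma cons_row0 z : cons_row z ord0 ord0 = z.1.
Proof. by rewrite mxE unlift_none. Qed.

Lemma cons_rowS z i : cons_row z ord0 (lift ord0 i) = z.2 ord0 i.
Proof. by rewrite mxE liftK. Qed.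

Lemma measurable_cons_row :
  measurable_fun [set: measurableTypeR R * borel 'rV[R]_k] (cons_row : _ -> borel 'rV[R]_k.+1).
Proof.
apply: measurable_rV => j; have [i ->|->] := unliftP ord0 j.
  apply: (@eq_measurable_fun _ _ (measurableTypeR R * borel 'rV[R]_k)%type _ _ (fun z => (z.2 : 'rV[R]_k) ord0 i)); first by move=> z _; rewrite cons_rowS.
  have m2 : measurable_fun [set: measurableTypeR R * borel 'rV[R]_k] snd by exact: measurable_snd.
  exact: (measurableT_comp (@measurable_coord R k i) m2).
apply: (@eq_measurable_fun _ _ (measurableTypeR R * borel 'rV[R]_k)%type _ _ fst); first by move=> z _; rewrite cons_row0.
exact: measurable_fst.
Qed.

Lemma cons_row_mid s t x y :
  cons_row ((s + t) / 2, 2^-1 *: (x + y)) = 2^-1 *: (cons_row (s, x) + cons_row (t, y)).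
Proof.
apply/rowP => j; have [i ->|->] := unliftP ord0 j.
  by rewrite cons_rowS !mxE liftK.
by rewrite cons_row0 !mxE !unlift_none /= mulrC.
Qed.

End cons_row.

Section lebesgue_rV.
Variable R : realType.
Local Open Scope ereal_scope.

Definition prekopa k (L : {measure set (borel 'rV[R]_k) -> \bar R}) :=
  forall f g h : 'rV[R]_k -> \bar R,
  measurable_fun [set: borel 'rV[R]_k] f ->
  measurable_fun [set: borel 'rV[R]_k] g ->
  measurable_fun [set: borel 'rV[R]_k] h ->
  (forall x, 0 <= f x) -> (forall x, 0 <= g x) -> (forall x, 0 <= h x) ->
  (forall x y, f x * g y <= h (2^-1 *: (x + y))%R * h (2^-1 *: (x + y))%R) ->
  \int[L]_x f x * \int[L]_x g x <= \int[L]_x h x * \int[L]_x h x.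

Definition hyperplane k (a : 'rV[R]_k) (c : R) : set 'rV[R]_k :=
  [set x | \sum_i a ord0 i * x ord0 i = c]%R.

Definition null_hyperplanes k (m : set (borel 'rV[R]_k) -> \bar R) :=
  forall a c, a != 0%R -> m (hyperplane a c) = 0.

Lemma measurable_linear_form k (a : 'rV[R]_k) :
  measurable_fun [set: borel 'rV[R]_k] (fun x : 'rV[R]_k => \sum_i a ord0 i * x ord0 i)%R.
Proof.
apply: measurable_sum => i; apply: measurable_funM => //.
exact: measurable_coord.
Qed.

Lemma measurable_hyperplane k (a : 'rV[R]_k) c :
  measurable (hyperplane a c : set (borel 'rV[R]_k)).
Proof.
have -> : hyperplane a c = (fun x : 'rV[R]_k => \sum_i a ord0 i * x ord0 i)%R @^-1` [set c] by [].
by rewrite -[X in measurable X]setTI; exact: measurable_linear_form.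
Qed.

(** In dimension 0 the space is a point and an empty product of side lengths is 1, so a Dirac mass
    is the right measure. *)
Lemma lebesgue0 : exists L : {sigma_finite_measure set (borel 'rV[R]_0) -> \bar R},
  [/\ is_lebesgue L, prekopa L & null_hyperplanes L].
Proof.
exists (\d_(0%R : borel 'rV[R]_0)); split.
- by move=> a b _; rewrite big_ord0 /= /dirac indicE mem_set// => -[].
- move=> f g h mf mg mh f0 g0 h0 fgh; rewrite !integral_dirac// !diracT !mul1e.
  by have := fgh 0%R 0%R; rewrite addr0 scaler0.
- by move=> a c; rewrite (_ : a = 0%R) ?eqxx//; apply/rowP => -[].
Qed.

Section step.
Variables (k : nat) (L : {sigma_finite_measure set (borel 'rV[R]_k) -> \bar R}).
Local Notation leb := (@lebesgue_measure R).
Let prod : {measure set (measurableTypeR R * borel 'rV[R]_k) -> \bar R} := leb \x L.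
Variable L' : {measure set (borel 'rV[R]_k.+1) -> \bar R}.
Hypothesis L'E : forall A, L' A = prod (@cons_row R k @^-1` A).
Hypothesis L'int : forall g : 'rV[R]_k.+1 -> \bar R,
  measurable_fun [set: borel 'rV[R]_k.+1] g -> (forall y, 0 <= g y) ->
  \int[L']_y g y = \int[prod]_z g (cons_row z).

Lemma lebesgueS_integral (f : 'rV[R]_k.+1 -> \bar R) :
  measurable_fun [set: borel 'rV[R]_k.+1] f -> (forall x, 0 <= f x) ->
  [/\ \int[L']_x f x = \int[leb]_t \int[L]_y f (cons_row (t, y)),
    measurable_fun [set: measurableTypeR R] (fun t => \int[L]_y f (cons_row (t, y))) &
    forall t, measurable_fun [set: borel 'rV[R]_k] (fun y => f (cons_row (t, y)))].
Proof.
move=> mf f0.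
have mF : measurable_fun [set: measurableTypeR R * borel 'rV[R]_k] (f \o @cons_row R k).
  apply: (measurableT_comp mf); exact: measurable_cons_row.
split.
- by rewrite L'int//; apply: (fubini_tonelli1 (m1 := leb) (m2 := L) _ mF) => z; exact: f0.
- by apply: (measurable_fun_fubini_tonelli_F (m2 := L) _ mF) => z; exact: f0.
- by move=> t; apply: (measurableT_comp mF); exact: measurable_pair1.
Qed.

Lemma lebesgueS_is_lebesgue : is_lebesgue L -> is_lebesgue L'.
Proof.
move=> hL a b ab.
pose a' := (\row_i a ord0 (lift ord0 i))%R; pose b' := (\row_i b ord0 (lift ord0 i))%R.
rewrite L'E.
have -> : (@cons_row R k) @^-1` [set x | forall i, (a ord0 i <= x ord0 i <= b ord0 i)%R] =
    `[a ord0 ord0, b ord0 ord0]%classic `*` box a' b'.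
  apply/seteqP; split => -[t y] /=.
    move=> h; split; first by rewrite in_itv /=; have := h ord0; rewrite cons_row0.
    by move=> i; have := h (lift ord0 i); rewrite cons_rowS !mxE.
  move=> [h1 h2] j; have [i ->|->] := unliftP ord0 j.
    by have := h2 i; rewrite cons_rowS !mxE.
  by rewrite cons_row0; move: h1; rewrite in_itv.
rewrite [LHS](product_measure1E leb L (measurable_itv _) (measurable_box a' b')).
rewrite big_ord_recl EFinM; congr (_ * _).
  rewrite [LHS](lebesgue_measure_itv `[a ord0 ord0, b ord0 ord0]) /= lte_fin; case: ltP => // h.
  by congr (_%:E); apply/eqP; rewrite eq_sym subr_eq0 eq_le h ab.
rewrite [LHS](hL a' b'); last by move=> i; rewrite !mxE.
by congr (_%:E); apply: eq_bigr => i _; rewrite !mxE.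
Qed.

(** The inequality tensorizes: in dimension [k], on the fibres over s, t and (s + t)/2, it gives the
    hypothesis of the one-dimensional inequality for the fibre integrals. *)
Lemma lebesgueS_prekopa : prekopa L -> prekopa L'.
Proof.
move=> hL f g h mf mg mh f0 g0 h0 fgh.
have [-> mF mf'] := lebesgueS_integral mf f0.
have [-> mG mg'] := lebesgueS_integral mg g0.
have [-> mH mh'] := lebesgueS_integral mh h0.
apply: prekopa_line => //; try by move=> t; apply: integral_ge0.
by move=> s t; apply: hL => // x y; rewrite cons_row_mid.
Qed.

(** If the first coefficient vanishes, the fibres over the first coordinate are hyperplanes of R^k;
    otherwise the fibres in the other direction are single points. *)
Lemma lebesgueS_null_hyperplanes : null_hyperplanes L -> null_hyperplanes L'.
Proof.
move=> hL a c a0.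
pose a' := (\row_i a ord0 (lift ord0 i))%R.
rewrite L'E.
have mH := @measurable_hyperplane k.+1 a c.
have mS : measurable ((@cons_row R k) @^-1` hyperplane a c : set (measurableTypeR R * borel 'rV[R]_k)).
  by rewrite -[X in measurable X]setTI; exact: measurable_cons_row.
have HE t y : ((@cons_row R k) @^-1` hyperplane a c) (t, y) <->
   (a ord0 ord0 * t + \sum_i a' ord0 i * y ord0 i = c)%R.
  rewrite /hyperplane /= big_ord_recl cons_row0.
  suff -> : (\sum_(i < k) a ord0 (lift ord0 i) * cons_row (t, y) ord0 (lift ord0 i) =
    \sum_(i < k) a' ord0 i * y ord0 i)%R by [].
  by apply: eq_bigr => i _; rewrite cons_rowS mxE.
have [a00|a00] := eqVneq (a ord0 ord0) 0%R.
  rewrite /product_measure1; apply: integral0_eq => t _ /=.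
  have -> : xsection (@cons_row R k @^-1` hyperplane a c) t = hyperplane a' c.
    apply/seteqP; split => y; rewrite /xsection /=.
      by move=> /set_mem /HE; rewrite a00 mul0r add0r.
    by move=> h; apply/mem_set/HE; rewrite a00 mul0r add0r.
  apply: hL; apply: contra a0 => /eqP a'0; apply/eqP/rowP => j.
  have [i ->|->] := unliftP ord0 j; last by rewrite a00 mxE.
  by move/rowP: a'0 => /(_ i); rewrite !mxE.
(* The order of integration is exchanged, so that the section is taken in the first coordinate. *)
transitivity ((leb \x^ L) ((@cons_row R k) @^-1` hyperplane a c)).
  by apply: product_measure_unique => // A B mA mB; exact: product_measure2E.
rewrite /product_measure2; apply: integral0_eq => y _ /=.
have -> : ysection (@cons_row R k @^-1` hyperplane a c) y =
    [set ((c - \sum_i a' ord0 i * y ord0 i) / a ord0 ord0)%R].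
  apply/seteqP; split => t; rewrite /ysection /=.
    by move=> /set_mem /HE <-; field.
  by move=> ->; apply/mem_set/HE; field.
exact: lebesgue_measure_set1.
Qed.

End step.

(** The measure in [log_concave_Rn] is known only through the volumes of boxes. One such measure is
    built here with the desired properties; uniqueness transfers them to any other. *)
Lemma lebesgue_rV k : exists L : {sigma_finite_measure set (borel 'rV[R]_k) -> \bar R},
  [/\ is_lebesgue L, prekopa L & null_hyperplanes L].
Proof.
elim: k => [|k [L [hL pL nL]]]; first exact: lebesgue0.
have [M [ME Mint]] := pushforward_measureP (lebesgue_measure \x L) (@measurable_cons_row R k).
have h1 := lebesgueS_is_lebesgue ME hL.
have [L' L'E] := sigma_finite_measureP (is_lebesgue_sigma_finite h1).
exists L'; split.
- by move=> a b ab; rewrite -(h1 a b ab); exact: L'E.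
- have e (f : 'rV[R]_k.+1 -> \bar R) : \int[L']_x f x = \int[M]_x f x.
    by apply: eq_measure_integral => A _ _; exact: L'E.
  by move=> f g h mf mg mh f0 g0 h0 fgh; rewrite !e; exact: (lebesgueS_prekopa Mint pL).
- move=> a c a0; rewrite -(lebesgueS_null_hyperplanes ME nL c a0); exact: L'E.
Qed.

Lemma is_lebesgue_prekopa k (lam : {measure set (borel 'rV[R]_k) -> \bar R}) :
  is_lebesgue lam -> prekopa lam.
Proof.
have [L [hL pL _]] := lebesgue_rV k; move=> hl f g h mf mg mh f0 g0 h0 fgh.
have e (u : 'rV[R]_k -> \bar R) : \int[lam]_x u x = \int[L]_x u x.
  by apply: eq_measure_integral => A mA _; exact: is_lebesgue_unique.
by rewrite !e; exact: pL.
Qed.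

Lemma is_lebesgue_null k (lam : {measure set (borel 'rV[R]_k) -> \bar R}) :
  is_lebesgue lam -> null_hyperplanes lam.
Proof.
have [L [hL _ nL]] := lebesgue_rV k; move=> hl a c a0.
rewrite (is_lebesgue_unique hl hL); first exact: nL.
exact: measurable_hyperplane.
Qed.

End lebesgue_rV.

(** * Midpoint inequality for log-concave laws *)

Section density_measure.
Context d (T : measurableType d) (R : realType) (m : {measure set T -> \bar R}) (g : T -> \bar R).
Local Open Scope ereal_scope.

Definition density_measure of measurable_fun [set: T] g & (forall x, 0 <= g x) : set T -> \bar R :=
  fun A => \int[m]_(x in A) g x.

Variables (mg : measurable_fun [set: T] g) (g0 : forall x, 0 <= g x).
Local Notation dm := (density_measure mg g0).

Let dm0 : dm set0 = 0. Proof. by rewrite /density_measure integral_set0. Qed.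

Let dm_ge0 A : 0 <= dm A. Proof. exact: integral_ge0. Qed.

Let dm_sigma_additive : semi_sigma_additive dm.
Proof.
move=> A mA tA mUA; rewrite /density_measure ge0_integral_bigcup//.
  by apply: is_cvg_ereal_nneg_natsum_cond => n _ _; exact: integral_ge0.
exact: measurable_funTS.
Qed.

HB.instance Definition _ := isMeasure.Build _ _ _ dm dm0 dm_ge0 dm_sigma_additive.

End density_measure.

Section probability_pack.
Context d (T : measurableType d) (R : realType).
Local Open Scope ereal_scope.

Definition probability_copy (m : {measure set T -> \bar R}) of m setT = 1 : set T -> \bar R := m.

HB.instance Definition _ (m : {measure set T -> \bar R}) (h : m setT = 1) :=
  Measure.copy (probability_copy h) m.

HB.instance Definition _ (m : {measure set T -> \bar R}) (h : m setT = 1) :=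
  Measure_isProbability.Build _ _ _ (probability_copy h) h.
End probability_pack.

Section log_concave_density.
Variable R : realType.
Local Open Scope ereal_scope.

(* The midpoint case of Borell's characterisation of log-concave measures; it
   passes to restrictions to convex sets without any computation. *)
Definition borell k (m : set (borel 'rV[R]_k) -> \bar R) :=
  forall A B C : set 'rV[R]_k,
    @measurable _ (borel 'rV[R]_k) A -> @measurable _ (borel 'rV[R]_k) B ->
    @measurable _ (borel 'rV[R]_k) C ->
    (forall x y, A x -> B y -> C (2^-1 *: (x + y))%R) ->
    m A * m B <= m C * m C.

Lemma expNe_ge0 (v : \bar R) : 0 <= expNe v.
Proof. by case: v => [r| |] //=; rewrite lee_fin expR_ge0. Qed.

Lemma expNe_midpoint k (V : 'rV[R]_k -> \bar R) x y : convex_ext V ->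
  expNe (V x) * expNe (V y) <= expNe (V (2^-1 *: (x + y))%R) * expNe (V (2^-1 *: (x + y))%R).
Proof.
move=> [VN cV].
have h2 : (0 < 2^-1 :> R)%R by rewrite invr_gt0.
have h21 : (2^-1 < 1 :> R)%R by lra.
have := cV x y 2^-1%R h2 h21.
have -> : (1 - 2^-1 = 2^-1 :> R)%R by lra.
rewrite -scalerDr.
have z0 : 0 <= expNe (V (2^-1 *: (x + y))%R) * expNe (V (2^-1 *: (x + y))%R).
  by rewrite mule_ge0 ?expNe_ge0.
move: (VN x) (VN y) (VN (2^-1 *: (x + y))%R) z0.
case: (V x) => [r _| _ _ _ z0 _|//]; last by rewrite mul0e.
case: (V y) => [s _| _ _ z0 _|//]; last by rewrite mule0.
case: (V (2^-1 *: (x + y))%R) => [u _ _|_ _|//]; last by rewrite -!EFinM -EFinD leye_eq.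
rewrite -!EFinM -EFinD !lee_fin /= -!expRD ler_expR => h.
lra.
Qed.

(** The law [nu] may be carried by a proper affine subspace and then charges hyperplanes of R^n; in
    the parameters of that subspace it has a density. The geometry below takes place in these
    parameters, and log-concavity is kept only in the form [borell]. *)
Lemma log_concave_Rn_param n (nu : set 'rV[R]_n -> \bar R) :
  log_concave_Rn nu -> nu setT = 1 ->
  exists (k : nat) (A : 'M[R]_(k, n)) (c : 'rV[R]_n) (m : probability (borel 'rV[R]_k) R),
    [/\ forall B, @measurable _ (borel 'rV[R]_n) B -> nu B = m ((fun y => y *m A + c)%R @^-1` B),
        row_free A, borell m & null_hyperplanes m].
Proof.
move=> [k [A [c [V [lam [Af cV hl mV nuE]]]]]] nu1.
have V0 x : 0 <= expNe (V x) := expNe_ge0 (V x).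
pose dm : {measure set (borel 'rV[R]_k) -> \bar R} := @density_measure _ _ _ lam _ mV V0.
have dm1 : dm setT = 1 by rewrite -nu1 nuE// preimage_setT.
exists k, A, c, (probability_copy dm1); split => //.
- move=> X Y Z mX mY mZ XYZ; rewrite /= /probability_copy /= /density_measure.
  (* The density cut off to the three sets gives three functions on the whole space, to which
     Prekopa's inequality applies. *)
  rewrite [in leLHS]integral_mkcond [X in _ * X <= _]integral_mkcond [in leRHS]integral_mkcond.
  apply: (is_lebesgue_prekopa hl).
  + by apply/(measurable_restrictT _ mX); exact: measurable_funTS.
  + by apply/(measurable_restrictT _ mY); exact: measurable_funTS.
  + by apply/(measurable_restrictT _ mZ); exact: measurable_funTS.
  + by move=> x; apply: erestrict_ge0.
  + by move=> x; apply: erestrict_ge0.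
  + by move=> x; apply: erestrict_ge0.
  move=> x y; rewrite !patchE.
  case: ifPn => [/set_mem Xx|_]; last by rewrite mul0e; case: ifPn => _; rewrite ?mule0// mule_ge0.
  case: ifPn => [/set_mem Yy|_]; last by rewrite mule0; case: ifPn => _; rewrite ?mule0// mule_ge0.
  by rewrite mem_set; [exact: expNe_midpoint | exact: XYZ].
- move=> a b a0; rewrite /= /probability_copy /= /density_measure.
  by apply: null_set_integral => //; [exact: measurable_hyperplane|exact: measurable_funTS|
    exact: is_lebesgue_null].
Qed.

End log_concave_density.

(** * Integrals of bounded functions on pieces *)

Section bounded_integrals.
Context d (T : measurableType d) (R : realType) (m : probability T R) (Q0 : set T).

(** Measurable everywhere but bounded only on [Q0]: polynomials are bounded just on the truncated
    set, and every piece of [Q0] inherits the bound. *)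
Definition bounded_measurable (g : T -> R) :=
  measurable_fun [set: T] g /\ exists B : R, forall x, Q0 x -> `|g x| <= B.

Definition mass (Q : set T) : R := fine (m Q).

Local Notation J Q g := (\int[m]_(x in Q) g x)%R.

Lemma massE Q : measurable Q -> m Q = (mass Q)%:E.
Proof. by move=> mQ; rewrite /mass fineK// fin_num_measure. Qed.

Lemma mass_ge0 Q : 0 <= mass Q. Proof. by rewrite fine_ge0. Qed.

Lemma bounded_measurable_cst c : bounded_measurable (cst c).
Proof. by split => //; exists `|c|. Qed.

Lemma bounded_measurableD f g : bounded_measurable f -> bounded_measurable g ->
  bounded_measurable (fun x => f x + g x).
Proof.
move=> [mf [A fA]] [mg [B gB]]; split; first exact: measurable_funD.
by exists (A + B) => x Qx; apply: le_trans (ler_normD _ _) _; apply: lerD; [exact: fA|exact: gB].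
Qed.

Lemma bounded_measurableM f g : bounded_measurable f -> bounded_measurable g ->
  bounded_measurable (fun x => f x * g x).
Proof.
move=> [mf [A fA]] [mg [B gB]]; split; first exact: measurable_funM.
by exists (A * B) => x Qx; rewrite normrM; apply: ler_pM => //; [exact: fA|exact: gB].
Qed.

Lemma bounded_measurableN f : bounded_measurable f -> bounded_measurable (fun x => - f x).
Proof.
by move=> [mf [A fA]]; split; [exact: measurableT_comp | exists A => x /fA; rewrite normrN].
Qed.

Lemma bounded_measurableB f g : bounded_measurable f -> bounded_measurable g ->
  bounded_measurable (fun x => f x - g x).
Proof. by move=> bf bg; apply: bounded_measurableD => //; exact: bounded_measurableN. Qed.

Lemma bounded_measurable_norm f : bounded_measurable f -> bounded_measurable (fun x => `|f x|).
Proof.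
move=> [mf [A fA]]; split; first exact: measurableT_comp.
by exists A => x /fA; rewrite normr_id.
Qed.

Lemma bounded_measurableX f n : bounded_measurable f -> bounded_measurable (fun x => f x ^+ n).
Proof.
move=> [mf [A fA]]; split; first exact: measurable_funX.
by exists (A ^+ n) => x /fA h; rewrite normrX; apply: lerXn2r; rewrite ?nnegrE// (le_trans _ h).
Qed.

Lemma bounded_measurable_indic S : measurable S -> bounded_measurable \1_S.
Proof.
move=> mS; split; first exact: measurable_indic.
by exists 1 => x _; rewrite indicE; case: (_ \in _); rewrite ?normr1 ?normr0.
Qed.

Lemma bounded_measurable_sum I (s : seq I) (f : I -> T -> R) : (forall i, bounded_measurable (f i)) ->
  bounded_measurable (fun x => \sum_(i <- s) f i x).
Proof.
move=> bf; elim: s => [|i s IHs].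
  by under eq_fun do rewrite big_nil; exact: bounded_measurable_cst.
by under eq_fun do rewrite big_cons; exact: bounded_measurableD.
Qed.

Section on_subset.
Variable Q : set T.
Hypotheses (mQ : measurable Q) (QQ0 : Q `<=` Q0).

Lemma bounded_integrable f : bounded_measurable f -> m.-integrable Q (EFin \o f).
Proof.
move=> [mf [B fB]]; apply: measurable_bounded_integrable => //.
- by rewrite -ge0_fin_numE// fin_num_measure.
- exact: measurable_funTS.
- exists `|B|; split => [|r Br x Qx]; first exact: num_real.
  by apply: le_trans (fB x (QQ0 Qx)) _; apply: le_trans (ler_norm _) (ltW Br).
Qed.

Lemma Jcst c : J Q (cst c) = c * mass Q.
Proof. by rewrite Rintegral_cst. Qed.

Lemma JD f g : bounded_measurable f -> bounded_measurable g ->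
  J Q (fun x => f x + g x) = J Q f + J Q g.
Proof. by move=> bf bg; rewrite RintegralD//; exact: bounded_integrable. Qed.

Lemma JB f g : bounded_measurable f -> bounded_measurable g ->
  J Q (fun x => f x - g x) = J Q f - J Q g.
Proof. by move=> bf bg; rewrite RintegralB//; exact: bounded_integrable. Qed.

Lemma JZ c f : bounded_measurable f -> J Q (fun x => c * f x) = c * J Q f.
Proof. by move=> bf; rewrite RintegralZl//; exact: bounded_integrable. Qed.

Lemma J_sum I (s : seq I) (f : I -> T -> R) : (forall i, bounded_measurable (f i)) ->
  J Q (fun x => \sum_(i <- s) f i x) = \sum_(i <- s) J Q (f i).
Proof.
move=> bf; elim: s => [|i s IHs].
  rewrite big_nil; under eq_Rintegral do rewrite big_nil.
  by rewrite (Jcst 0) mul0r.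
rewrite big_cons -IHs -JD//; last exact: bounded_measurable_sum.
by apply: eq_Rintegral => x _; rewrite big_cons.
Qed.

Lemma J_le f g : bounded_measurable f -> bounded_measurable g ->
  (forall x, Q x -> f x <= g x) -> J Q f <= J Q g.
Proof. by move=> bf bg fg; apply: le_Rintegral => //; exact: bounded_integrable. Qed.

Lemma J_norm f : bounded_measurable f -> `|J Q f| <= J Q (fun x => `|f x|).
Proof. by move=> bf; apply: le_normr_Rintegral => //; exact: bounded_integrable. Qed.

Lemma J_bound f c : bounded_measurable f -> (forall x, Q x -> `|f x| <= c) ->
  `|J Q f| <= c * mass Q.
Proof.
move=> bf fc; apply: le_trans (J_norm bf) _; rewrite -Jcst.
by apply: J_le => //; [exact: bounded_measurable_norm|exact: bounded_measurable_cst].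
Qed.

Lemma J_indic S : measurable S -> J Q \1_S = mass (Q `&` S).
Proof.
move=> mS; rewrite /mass /Rintegral integral_indic// setIC//.
Qed.

Lemma J_restrict S f : J Q (fun x => f x * \1_S x) = J (Q `&` S) f.
Proof.
rewrite [RHS]Rintegral_mkcondr; apply: eq_Rintegral => x _.
by rewrite patchE indicE; case: (_ \in _); rewrite ?mulr1 ?mulr0.
Qed.

Lemma J_cut S f : measurable S -> bounded_measurable f ->
  J Q f = J (Q `&` S) f + J (Q `&` ~` S) f.
Proof.
move=> mS bf; rewrite -!J_restrict -JD.
- apply: eq_Rintegral => x _; rewrite -mulrDr !indicE in_setC.
  by case: (_ \in _); rewrite /= ?addr0 ?add0r mulr1.
- by apply: bounded_measurableM => //; exact: bounded_measurable_indic.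
- by apply: bounded_measurableM => //; apply: bounded_measurable_indic; exact: measurableC.
Qed.

Lemma mass_cut S : measurable S -> mass Q = mass (Q `&` S) + mass (Q `&` ~` S).
Proof.
move=> mS; rewrite /mass -fineD ?fin_num_measure//; try exact: measurableI.
- by rewrite -setDE addeC -measureDI.
- by apply: measurableI => //; exact: measurableC.
Qed.

End on_subset.

Lemma mass_le Q Q' : measurable Q -> measurable Q' -> Q `<=` Q' -> mass Q <= mass Q'.
Proof.
move=> mQ mQ' QQ'; rewrite /mass fine_le ?fin_num_measure//.
by apply: le_measure; rewrite ?inE.
Qed.

Lemma cauchy_schwarz Q f g : measurable Q -> Q `<=` Q0 ->
  bounded_measurable f -> bounded_measurable g ->
  (J Q (fun x => f x * g x)) ^+ 2 <= J Q (fun x => f x ^+ 2) * J Q (fun x => g x ^+ 2).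
Proof.
move=> mQ QQ0 bf bg.
have bf2 := bounded_measurableX 2 bf; have bg2 := bounded_measurableX 2 bg.
have bfg := bounded_measurableM bf bg.
set a := J Q (fun x => f x ^+ 2); set b := J Q (fun x => f x * g x).
set c := J Q (fun x => g x ^+ 2).
have q t : 0 <= t ^+ 2 * a + 2 * t * b + c.
  have -> : t ^+ 2 * a + 2 * t * b + c = J Q (fun x => (t * f x + g x) ^+ 2).
    rewrite /a /b /c -!JZ// -JD//; last 2 first.
    - by apply: bounded_measurableM => //; exact: bounded_measurable_cst.
    - by apply: bounded_measurableM => //; exact: bounded_measurable_cst.
    rewrite -JD//; last first.
      by apply: bounded_measurableD; apply: bounded_measurableM => //; exact: bounded_measurable_cst.
    by apply: eq_Rintegral => x _; ring.
  by apply: Rintegral_ge0 => x _; exact: sqr_ge0.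
have a0 : 0 <= a by apply: Rintegral_ge0 => x _; exact: sqr_ge0.
have c0 : 0 <= c by apply: Rintegral_ge0 => x _; exact: sqr_ge0.
have [a00|a00] := eqVneq a 0.
  have [->|b0] := eqVneq b 0; first by rewrite expr0n a00 mul0r.
  (* Without its quadratic term the polynomial is affine with slope [2 * b]; at this point its value
     is -1. *)
  have := q (- (c + 1) / (2 * b)); rewrite a00 mulr0 add0r.
  have -> : 2 * (- (c + 1) / (2 * b)) * b = - (c + 1) by field.
  by move=> h; exfalso; lra.
have := q (- b / a).
have -> : (- b / a) ^+ 2 * a + 2 * (- b / a) * b + c = (a * c - b ^+ 2) / a by field.
by rewrite pmulr_lge0 ?invr_gt0 ?lt_def ?a00// subr_ge0.
Qed.

End bounded_integrals.
Arguments bounded_measurable {d T R} Q0 g.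
Arguments mass {d T R} m Q.
Arguments JB {d T R m Q0 Q} mQ QQ0 {f g}.
Arguments JD {d T R m Q0 Q} mQ QQ0 {f g}.
Arguments JZ {d T R m Q0 Q} mQ QQ0 c {f}.
Arguments J_le {d T R m Q0 Q} mQ QQ0 {f g}.
Arguments J_norm {d T R m Q0 Q} mQ QQ0 {f}.
Arguments J_bound {d T R m Q0 Q} mQ QQ0 {f c}.
Arguments J_sum {d T R m Q0 Q} mQ QQ0 {I} s {f}.
Arguments J_cut {d T R m Q0 Q} mQ QQ0 {S f}.
Arguments J_indic {d T R m Q} mQ {S}.
Arguments J_restrict {d T R m}.
Arguments Jcst {d T R m Q} mQ c.
Arguments mass_cut {d T R m Q} mQ {S}.
Arguments massE {d T R m Q}.
Arguments mass_le {d T R m Q Q'}.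
Arguments mass_ge0 {d T R m}.
Arguments cauchy_schwarz {d T R m Q0 Q f g}.
Arguments bounded_integrable {d T R m Q0 Q} mQ QQ0 {f}.

(** * Localization to needles *)

Section bisection.
Context d (T : measurableType d) (R : realType) (m : probability T R) (Q0 Q : set T).
Hypotheses (mQ : measurable Q) (QQ0 : Q `<=` Q0).
Local Notation J Q g := (\int[m]_(x in Q) g x)%R.
Variables X Y : T -> R.
Hypotheses (bX : bounded_measurable Q0 X) (bY : bounded_measurable Q0 Y).

(* For s running from -1 to 1 the coefficient vector (s, 1 - |s|) moves from
   (-1, 0) to (1, 0), without meeting the origin. *)
Definition pencil (s : R) (x : T) := s * X x + (1 - `|s|) * Y x.

Definition half_space s : set T := [set x | 0 < pencil s x].

Lemma bounded_pencil s : bounded_measurable Q0 (pencil s).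
Proof.
by apply: bounded_measurableD; apply: bounded_measurableM => //; exact: bounded_measurable_cst.
Qed.

Lemma measurable_half_space s : measurable (half_space s).
Proof.
have [mp _] := bounded_pencil s.
rewrite -[half_space s]setTI (_ : half_space s = pencil s @^-1` `]0, +oo[%classic); last first.
  by apply/seteqP; split => x /=; rewrite in_itv /= andbT.
by apply: mp => //; exact: measurable_itv.
Qed.

Hypothesis null : forall s, m (Q `&` [set x | pencil s x = 0]) = 0%E.

Lemma measurable_strip s (c : R) : measurable (Q `&` [set x | `|pencil s x| <= c]).
Proof.
have [mp _] := bounded_pencil s.
apply: measurableI => //.
rewrite -[X in measurable X]setTI.
rewrite (_ : [set x | _] = pencil s @^-1` `[-c, c]%classic); last first.
  by apply/seteqP; split => x /=; rewrite in_itv /= ler_norml.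
by apply: mp => //; exact: measurable_itv.
Qed.

(** The strips decrease to the zero set of the form, which is null; continuity from above
    concludes. *)
Lemma small_slab s (e : R) : 0 < e ->
  exists2 c : R, 0 < c & mass m (Q `&` [set x | `|pencil s x| <= c]) < e.
Proof.
move=> e0; pose D n := Q `&` [set x | `|pencil s x| <= n.+1%:R^-1].
have mD n : measurable (D n) by exact: measurable_strip.
have DI : \bigcap_n D n = Q `&` [set x | pencil s x = 0].
  apply/seteqP; split => x.
    move=> h; split; first by have [] := h 0%N I.
    apply/eqP; rewrite -normr_eq0 eq_le normr_ge0 andbT leNgt; apply/negP => p0.
    have [] := h (Num.bound (`|pencil s x|^-1)) I => _ /=; apply/negP; rewrite -ltNge.
    rewrite -[ltRHS]invrK ltf_pV2 ?posrE ?invr_gt0//.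
    apply: lt_le_trans (archi_boundP _) _; first by rewrite invr_ge0 ltW.
    by rewrite ler_nat.
  by move=> [Qx /= px] n _; split => //=; rewrite px normr0.
have cvD : (m \o D) @ \oo --> 0%E.
  rewrite -(null s) -DI; apply: nonincreasing_cvg_mu => //.
  - by rewrite -ge0_fin_numE// fin_num_measure.
  - by apply: bigcapT_measurable.
  - move=> i j ij; apply/subsetPset => x [Qx /= h]; split => //=; apply: le_trans h _.
    by rewrite lef_pV2 ?posrE// ler_nat.
have /fine_cvgP[_ /cvgrPdist_lt /(_ e e0) [n _ /(_ n (leqnn n)) /=]] := cvD.
rewrite sub0r normrN => h; exists n.+1%:R^-1 => //.
by apply: le_lt_trans (ler_norm _) h.
Qed.

Variable g : T -> R.
Hypothesis bg : bounded_measurable Q0 g.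

Let F s := J (Q `&` half_space s) g.

Let FE s : F s = J Q (fun x => g x * \1_(half_space s) x).
Proof. by rewrite /F J_restrict//. Qed.

(** Moving [s] slightly changes the form by less than [c], so its sign can change only in the strip
    where it is at most [c] in absolute value, and this strip has small mass. *)
Lemma bisection_continuous : continuous F.
Proof.
have [mX [A XA]] := bX; have [mY [B YB]] := bY; have [mg [G gG]] := bg.
have [A' A'0 XA'] : exists2 A' : R, 0 < A' & forall x, Q x -> `|X x| + `|Y x| <= A'.
  exists (`|A| + `|B| + 1); first by rewrite ltr_pwDr// addr_ge0.
  move=> x /QQ0 Qx; have := XA _ Qx; have := YB _ Qx.
  have := ler_norm A; have := ler_norm B; lra.
have [G' G'0 gG'] : exists2 G' : R, 0 < G' & forall x, Q x -> `|g x| <= G'.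
  exists (`|G| + 1); first by rewrite ltr_pwDr.
  by move=> x /QQ0 Qx; have := gG _ Qx; have := ler_norm G; lra.
move=> s; apply/cvgrPdist_lt => e e0.
have [c c0 hc] := small_slab s (divr_gt0 e0 G'0).
near=> t.
have st : `|s - t| < c / A'.
  near: t; apply: (@cvgr_dist_lt _ R _ _ _ id); [exact: cvg_id|exact: divr_gt0].
have bi u : bounded_measurable Q0 (fun x => g x * \1_(half_space u) x).
  by apply: bounded_measurableM => //; apply: bounded_measurable_indic; exact: measurable_half_space.
rewrite !FE -(JB mQ QQ0)//.
set D := [set x | `|pencil s x| <= c] in hc.
have mQD : measurable (Q `&` D) by exact: measurable_strip.
have bD : bounded_measurable Q0 (fun x => G' * \1_(Q `&` D) x).
  by apply: bounded_measurableM; [exact: bounded_measurable_cst|exact: bounded_measurable_indic].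
apply: (@le_lt_trans _ _ (J Q (fun x => G' * \1_(Q `&` D) x))).
  apply: le_trans (J_norm mQ QQ0 (bounded_measurableB (bi s) (bi t))) _.
  apply: (J_le mQ QQ0) => //; first exact/bounded_measurable_norm/bounded_measurableB.
  move=> x Qx; rewrite -mulrBr normrM; apply: ler_pM => //; first exact: gG'.
  rewrite !indicE; case: (boolP (x \in Q `&` D)) => [_|].
    by case: (_ \in _); case: (_ \in _); rewrite ?subrr ?subr0 ?sub0r ?normrN ?normr1 ?normr0.
  rewrite notin_setE => /not_andP [//|/negP]; rewrite -ltNge => cx.
  have close : `|pencil s x - pencil t x| < c.
    have -> : pencil s x - pencil t x = (s - t) * X x + (`|t| - `|s|) * Y x.
      by rewrite /pencil; ring.
    apply: le_lt_trans (ler_normD _ _) _; rewrite !normrM.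
    have h1 : `| `|t| - `|s| | <= `|s - t| by rewrite distrC ler_dist_dist.
    apply: (@le_lt_trans _ _ (`|s - t| * (`|X x| + `|Y x|))).
      by rewrite mulrDr lerD2l ler_wpM2r.
    apply: (@le_lt_trans _ _ (`|s - t| * A')); first by rewrite ler_wpM2l// XA'.
    by rewrite -ltr_pdivlMr.
  suff -> : (x \in half_space s) = (x \in half_space t) by rewrite subrr normr0.
  apply/idP/idP => /set_mem; rewrite /half_space /= => h; apply/mem_set => /=.
    by move: cx close; rewrite gtr0_norm// ltr_norml => ? /andP[? ?]; lra.
  move: cx close; rewrite ltr_norml => cx /andP[h1 h2].
  have [//|ps] := ltP 0 (pencil s x).
  by move: cx; rewrite ler0_norm//; lra.
rewrite (JZ mQ QQ0); last exact: bounded_measurable_indic.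
by rewrite (J_indic mQ)// setIA setIid mulrC -ltr_pdivlMr.
Unshelve. all: by end_near. Qed.

(** The half-spaces at 1 and -1 are complementary up to a null set, so the integral of [g] takes
    opposite values at the two ends and vanishes in between. *)
Lemma bisection : J Q g = 0 ->
  exists2 s, -1 <= s <= 1 & J (Q `&` half_space s) g = 0.
Proof.
move=> Jg0.
have bi u : bounded_measurable Q0 (fun x => g x * \1_(half_space u) x).
  by apply: bounded_measurableM => //; apply: bounded_measurable_indic; exact: measurable_half_space.
pose N := [set x | pencil 1 x = 0].
have mN : measurable N.
  have [mp _] := bounded_pencil 1.
  by rewrite -[N]setTI; exact: (mp measurableT _ (measurable_set1 0)).
have JN : J (Q `&` N) g = 0.
  rewrite /Rintegral null_set_integral//; first exact: measurableI.
    by apply/measurable_EFinP; exact: measurable_funTS bg.1.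
  exact: null.
have F1 : F 1 + F (-1) = 0.
  rewrite !FE -(JD mQ QQ0)// -[LHS]addr0 -[X in _ + X = _]JN -[X in _ + X = _]J_restrict -(JD mQ QQ0)//; last 2 first.
  - exact: bounded_measurableD.
  - by apply: bounded_measurableM => //; exact: bounded_measurable_indic.
  rewrite -[RHS]Jg0; apply: eq_Rintegral => x _.
  have p1 : pencil 1 x = X x by rewrite /pencil normr1 subrr mul0r addr0 mul1r.
  have pN1 : pencil (-1) x = - X x by rewrite /pencil normrN normr1 subrr mul0r addr0 mulN1r.
  have hE s : (x \in half_space s) = (0 < pencil s x).
    by apply/idP/idP => [/set_mem//|h]; exact/mem_set.
  have NE : (x \in N) = (pencil 1 x == 0).
    by apply/idP/eqP => [/set_mem//|h]; exact/mem_set.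
  rewrite !indicE !hE NE p1 pN1 oppr_gt0.
  by case: ltgtP => _; rewrite /= ?mulr0 ?mulr1 ?addr0 ?add0r.
  
have F1m : F (-1) = - F 1 by apply/eqP; rewrite -addr_eq0 addrC F1.
have cF : {within `[(-1), 1], continuous F}.
  by apply: continuous_subspaceT => x; exact: bisection_continuous.
have N11 : -1 <= 1 :> R by lra.
have v0 : minr (F (-1)) (F 1) <= 0 <= maxr (F (-1)) (F 1).
  rewrite F1m ge_min le_max; move: (F 1) => u.
  by have [h|h] := leP 0 u; apply/andP; split; apply/orP; (left; lra) || (right; lra).
have [s s1 Fs] := IVT N11 cF v0.
by exists s => //; move: s1; rewrite in_itv.
Qed.

End bisection.

Section localization.
Context d (T : measurableType d) (R : realType) (m : probability T R) (Q0 : set T).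
Local Notation J Q g := (\int[m]_(x in Q) g x)%R.
Variables (k : nat) (X : 'I_k -> T -> R) (A : R) (C : set (set T)).

Definition centered Q i x := X i x - J Q (X i) / mass m Q.

Hypotheses (mQ0 : measurable Q0) (CQ0 : C Q0) (A0 : 0 < A).
Hypothesis mX : forall i, measurable_fun setT (X i).
Hypothesis XA : forall i x, Q0 x -> `|X i x| <= A.
Hypothesis C_cut : forall Q i j a b s, i != j -> C Q ->
  let H := half_space (fun x => X i x - a) (fun x => X j x - b) s in
  C (Q `&` H) /\ C (Q `&` ~` H).
Hypothesis null : forall i j a b s, i != j ->
  m [set x | pencil (fun x => X i x - a) (fun x => X j x - b) s x = 0] = 0%E.

Let bX i : bounded_measurable Q0 (X i). Proof. by split => //; exists A; exact: XA. Qed.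

Let bcX Q i : bounded_measurable Q0 (centered Q i).
Proof. by apply: bounded_measurableB => //; exact: bounded_measurable_cst. Qed.

(** Mass times the trace of the covariance matrix. Unnormalized, it does not increase in total when
    a piece is cut in two. *)
Let W Q := \sum_i (J Q (fun x => X i x ^+ 2) - (J Q (X i)) ^+ 2 / mass m Q).

Let W_ge0 Q : measurable Q -> Q `<=` Q0 -> 0 < mass m Q -> 0 <= W Q.
Proof.
move=> mQ QQ0 Qp; apply: sumr_ge0 => i _.
rewrite subr_ge0 ler_pdivrMr//.
have := cauchy_schwarz (m := m) mQ QQ0 (bX i) (bounded_measurable_cst Q0 1).
rewrite (_ : J Q (fun x => X i x * cst 1 x) = J Q (X i)); last first.
  by apply: eq_Rintegral => x _; rewrite mulr1.
rewrite (_ : J Q (fun x => cst 1 x ^+ 2) = J Q (cst 1)); last first.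
  by apply: eq_Rintegral => x _; rewrite expr1n.
by rewrite Jcst// mul1r.
Qed.

(** Law of total variance: a cut removes exactly the variance between the two means. Of this loss
    only coordinates [i] and [j] are kept, and by Cauchy-Schwarz with s^2 + (1 - |s|)^2 <= 1 it
    dominates the loss along the direction of the pencil. *)
Let W_split Q S i j s : measurable Q -> Q `<=` Q0 -> measurable S -> i != j -> -1 <= s <= 1 ->
  let Q1 := Q `&` S in let Q2 := Q `&` ~` S in
  0 < mass m Q1 -> 0 < mass m Q2 ->
  W Q1 + W Q2 + (J Q1 (pencil (centered Q i) (centered Q j) s)) ^+ 2
     * (mass m Q1 + mass m Q2) / (mass m Q1 * mass m Q2) <= W Q.
Proof.
move=> mQ QQ0 mS ij s1 Q1 Q2 p0 q0.
have mQ1 : measurable Q1 by exact: measurableI.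
have mQ2 : measurable Q2 by apply: measurableI => //; exact: measurableC.
have Q1Q0 : Q1 `<=` Q0 by move=> x [/QQ0].
have Q2Q0 : Q2 `<=` Q0 by move=> x [/QQ0].
have massQ : mass m Q = mass m Q1 + mass m Q2 by exact: mass_cut.
set p := mass m Q1 in p0 massQ *; set q := mass m Q2 in q0 massQ *.
pose a l := J Q1 (X l); pose b l := J Q2 (X l).
have JX l : J Q (X l) = a l + b l by exact: (J_cut mQ QQ0).
pose e l := q * a l - p * b l.
have JE l : J Q1 (centered Q l) = e l / (p + q).
  have -> : J Q1 (centered Q l) = a l - (a l + b l) / (p + q) * p.
    rewrite -JX -massQ /p -(Jcst mQ1).
    exact/(JB mQ1 Q1Q0 (bX l))/bounded_measurable_cst.
  by rewrite /e; field; rewrite gt_eqF// addr_gt0.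
have -> : J Q1 (pencil (centered Q i) (centered Q j) s) = (s * e i + (1 - `|s|) * e j) / (p + q).
  rewrite (JD mQ1 Q1Q0); [|exact/bounded_measurableM/bcX/bounded_measurable_cst..].
  by rewrite !(JZ mQ1 Q1Q0)// !JE; ring.
have WE : W Q - W Q1 - W Q2 = \sum_l (e l ^+ 2 / (p * q * (p + q))).
  rewrite /W -!sumrB; apply: eq_bigr => l _.
  rewrite JX (J_cut mQ QQ0 mS (bounded_measurableX 2 (bX l))) massQ -/Q1 -/Q2 -/p -/q.
  rewrite -/(a l) -/(b l) /e; field.
  by rewrite !gt_eqF// addr_gt0.
rewrite -subr_ge0 opprD addrA opprD addrA WE subr_ge0.
rewrite (bigD1 i)//= (bigD1 j)//=; last by rewrite eq_sym.
apply: (@le_trans _ _ ((e i ^+ 2 + e j ^+ 2) / (p * q * (p + q)))); last first.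
  rewrite mulrDl addrA lerDl; apply: sumr_ge0 => l _.
  by rewrite divr_ge0 ?sqr_ge0// mulr_ge0 ?addr_ge0 ?mulr_ge0 ?ltW.
have -> : ((s * e i + (1 - `|s|) * e j) / (p + q)) ^+ 2 * (p + q) / (p * q) =
    (s * e i + (1 - `|s|) * e j) ^+ 2 / (p * q * (p + q)).
  by field; rewrite !gt_eqF// addr_gt0.
rewrite ler_pM2r; last by rewrite invr_gt0 !mulr_gt0// addr_gt0.
set r := 1 - `|s|.
have sr : s ^+ 2 + r ^+ 2 <= 1.
  rewrite /r -[s ^+ 2]real_normK ?num_real//.
  have : 0 <= `|s| by []. have : `|s| <= 1 by rewrite ler_norml.
  by move: `|s| => u u1 u0; rewrite !expr2; nra.
have := sqr_ge0 (s * e j - r * e i).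
have : 0 <= (1 - (s ^+ 2 + r ^+ 2)) * (e i ^+ 2 + e j ^+ 2).
  by apply: mulr_ge0; [lra | apply: addr_ge0; exact: sqr_ge0].
rewrite !expr2; nra.
Qed.

(* Minimising (total variance - tau * integral of Psi) / mass over the pieces
   that keep the average of G replaces any compactness argument: cutting an
   almost optimal piece cannot lower the variance much. *)
Lemma localization (G Psi : T -> R) (eps : R) :
  bounded_measurable Q0 G -> bounded_measurable Q0 Psi ->
  0 < mass m Q0 -> 0 < J Q0 Psi -> 0 < eps ->
  exists Q, [/\ measurable Q, Q `<=` Q0, C Q, 0 < mass m Q &
   [/\ J Q G = J Q0 G / mass m Q0 * mass m Q,
     J Q0 Psi / mass m Q0 / 2 * mass m Q <= J Q Psi &
     forall i j, i != j -> exists2 s, -1 <= s <= 1 &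
       J Q (fun x => pencil (centered Q i) (centered Q j) s x ^+ 2) <= eps * mass m Q]].
Proof.
move=> bG bP M0 P0 e0.
set g0 := J Q0 G / mass m Q0.
pose good Q := [/\ measurable Q, Q `<=` Q0, C Q, 0 < mass m Q & J Q G = g0 * mass m Q].
have goodQ0 : good Q0 by split => //; rewrite /g0 divfK// gt_eqF.
set I0 := J Q0 Psi / mass m Q0.
have I0p : 0 < I0 by rewrite divr_gt0.
set w0 := W Q0 / mass m Q0.
have w00 : 0 <= w0 by rewrite divr_ge0 ?mass_ge0// W_ge0.
(* Large enough that w0 <= tau * I0 / 2: a piece no worse than [Q0] then keeps at least half of the
   average of [Psi]. *)
pose tau := 2 * w0 / I0 + 1.
have tau0 : 0 < tau.
  by apply: ltr_wpDl => //; apply: divr_ge0; [exact: mulr_ge0|exact: ltW].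
pose Rf Q := (W Q - tau * J Q Psi) / mass m Q.
pose S := [set Rf Q | Q in good].
have [_ [B PB]] := bP.
have hS : has_inf S.
  split; first by exists (Rf Q0), Q0.
  exists (- (tau * B)) => _ [Q [mQ QQ0 _ Qp _] <-].
  rewrite /Rf ler_pdivlMr// mulNr lerBrDr -mulrA addrC.
  apply: (@le_trans _ _ 0); last exact: W_ge0.
  rewrite subr_le0 ler_pM2l//; apply: le_trans (ler_norm _) _.
  by apply: (J_bound mQ QQ0) => // x /QQ0/PB.
(* The second moment of the form will be at most 4 A t with t^2 <= ep * mass^2, which this value
   turns into eps * mass. *)
pose ep := (eps / (4 * A)) ^+ 2.
have ep0 : 0 < ep by rewrite exprn_gt0// divr_gt0// mulr_gt0.
(* If [Q0] is itself almost optimal it is taken; otherwise any almost optimal piece beats it. *)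
have [Q [[mQ QQ0 CQ Qp QG] R1 R2]] : exists Q, [/\ good Q, Rf Q <= Rf Q0 & Rf Q < inf S + ep].
  have [h|h] := ltP (Rf Q0) (inf S + ep); first by exists Q0.
  have [_ [Q gQ <-] hQ] := inf_adherent ep0 hS.
  by exists Q; split => //; apply: ltW; exact: lt_le_trans h.
exists Q; split => //; split => //.
  have WQ := W_ge0 mQ QQ0 Qp.
  have : Rf Q0 = w0 - tau * I0 by rewrite /Rf mulrBl /w0 /I0 mulrA.
  move=> R0; move: R1; rewrite R0 /Rf ler_pdivrMr// => R1.
  have h : tau * (I0 * mass m Q) <= tau * J Q Psi + w0 * mass m Q.
    have E : (w0 - tau * I0) * mass m Q = w0 * mass m Q - tau * (I0 * mass m Q) by ring.
    rewrite E in R1; move: R1 WQ.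
    by move: (tau * (I0 * mass m Q)) (w0 * mass m Q) (tau * J Q Psi) (W Q) => a b c e; lra.
  have h2 : w0 <= tau * (I0 / 2).
    rewrite /tau (_ : _ * _ = w0 + I0 / 2); first by rewrite lerDl divr_ge0// ltW.
    by field; rewrite gt_eqF.
  have h3 := ler_wpM2r (mass_ge0 (m := m) Q) h2.
  rewrite -(ler_pM2l tau0); lra.
move=> i j ij.
(* Bisecting [G] minus its average leaves the same average of [G] on both halves, so each half of
   positive mass competes in the infimum. *)
have bg : bounded_measurable Q0 (fun x => G x - cst g0 x).
  by apply: bounded_measurableB => //; exact: bounded_measurable_cst.
have Jg : J Q (fun x => G x - cst g0 x) = 0.
  by rewrite (JB mQ QQ0)// ?(Jcst mQ) ?QG ?subrr//; exact: bounded_measurable_cst.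
have nullQ s : m (Q `&` [set x | pencil (centered Q i) (centered Q j) s x = 0]) = 0%E.
  have mN : measurable [set x | pencil (centered Q i) (centered Q j) s x = 0].
    have [mp _] := bounded_pencil (bcX Q i) (bcX Q j) s.
    by rewrite -[X in measurable X]setTI; exact: (mp measurableT _ (measurable_set1 0)).
  apply/eqP; rewrite -measure_le0.
  rewrite -(null (J Q (X i) / mass m Q) (J Q (X j) / mass m Q) s ij).
  by apply: le_measure; rewrite ?inE//; exact: measurableI.
have [s s1 Fs] := bisection mQ QQ0 (bcX Q i) (bcX Q j) nullQ bg Jg.
exists s => //.
set L := pencil (centered Q i) (centered Q j) s.
have bL : bounded_measurable Q0 L by exact: bounded_pencil.
set H := half_space _ _ _ in Fs.
have mH : measurable H by exact: (measurable_half_space (bcX Q i) (bcX Q j)).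
set Q1 := Q `&` H in Fs; pose Q2 := Q `&` ~` H.
have mQ1 : measurable Q1 by exact: measurableI.
have mQ2 : measurable Q2 by apply: measurableI => //; exact: measurableC.
have Q1Q0 : Q1 `<=` Q0 by move=> x [/QQ0].
have Q2Q0 : Q2 `<=` Q0 by move=> x [/QQ0].
have massQ : mass m Q = mass m Q1 + mass m Q2 by exact: mass_cut.
have Jc l : J Q (centered Q l) = 0.
  rewrite (JB mQ QQ0)//; last exact: bounded_measurable_cst.
  by rewrite (Jcst mQ) divfK ?subrr// gt_eqF.
have JL0 : J Q L = 0.
  rewrite (JD mQ QQ0); [|exact/bounded_measurableM/bcX/bounded_measurable_cst..].
  by rewrite !(JZ mQ QQ0)// !Jc !mulr0 addr0.
have meanA l : `|J Q (X l) / mass m Q| <= A.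
  rewrite normrM normfV (ger0_norm (mass_ge0 _)) ler_pdivrMr//.
  by apply: (J_bound mQ QQ0) => // x /QQ0; exact: XA.
have LA x : Q x -> `|L x| <= 2 * A.
  move=> /QQ0 Qx; apply: le_trans (ler_normD _ _) _; rewrite !normrM.
  have c2 l : `|centered Q l x| <= 2 * A.
    by apply: le_trans (ler_normB _ _) _; have := XA l Qx; have := meanA l; lra.
  have s1' : `|s| <= 1 by rewrite ler_norml.
  rewrite (ger0_norm (_ : 0 <= 1 - `|s|)) ?subr_ge0//.
  have := c2 i; have := c2 j.
  move: `|centered Q i x| `|centered Q j x| (normr_ge0 s) s1' => u v; move: `|s| => w; nra.
set t := J Q1 L.
have J2 : J Q2 L = - t.
  by apply/eqP; rewrite -addr_eq0 addrC -(J_cut mQ QQ0 mH bL) JL0.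
(* On each half [L] has constant sign and |L| <= 2 A, so L^2 <= 2 A |L|; as [L] has mean zero, the
   integral of |L| is 2 t. *)
have LL : J Q (fun x => L x ^+ 2) <= 4 * A * t.
  rewrite (J_cut mQ QQ0 mH (bounded_measurableX 2 bL)).
  have h1 : J Q1 (fun x => L x ^+ 2) <= 2 * A * t.
    rewrite -(JZ mQ1 Q1Q0)//; apply: (J_le mQ1 Q1Q0).
    - exact: bounded_measurableX.
    - by apply: bounded_measurableM => //; exact: bounded_measurable_cst.
    move=> x [Qx Lx]; rewrite expr2 ler_pM2r//; apply: le_trans (ler_norm _) _; exact: LA.
  have h2 : J Q2 (fun x => L x ^+ 2) <= - (2 * A) * J Q2 L.
    rewrite -(JZ mQ2 Q2Q0)//; apply: (J_le mQ2 Q2Q0).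
    - exact: bounded_measurableX.
    - by apply: bounded_measurableM => //; exact: bounded_measurable_cst.
    move=> x [Qx /negP]; rewrite -leNgt => Lx; rewrite expr2.
    by apply: ler_wnM2r => //; have := LA x Qx; rewrite ler_norml => /andP[].
  by move: h1 h2; rewrite J2 -/Q1 -/Q2; lra.
apply: le_trans LL _.
have J00 Q' : measurable Q' -> Q' `<=` Q0 -> mass m Q' = 0 -> J Q' L = 0.
  move=> mQ' Q'Q0 z; apply/eqP; rewrite -normr_le0.
  have [_ [B' LB']] := bL.
  by rewrite -[leRHS](mulr0 B') -z; apply: (J_bound mQ' Q'Q0) => // x /Q'Q0; exact: LB'.
have t0 : 0 <= t by apply: Rintegral_ge0 => x [_ Lx]; exact: ltW.
have [p0|pn0] := eqVneq (mass m Q1) 0.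
  by rewrite /t J00// mulr0 mulr_ge0 ?mass_ge0// ltW.
have [q0|qn0] := eqVneq (mass m Q2) 0.
  have -> : t = 0 by apply/eqP; rewrite -oppr_eq0 -J2 J00.
  by rewrite mulr0 mulr_ge0 ?mass_ge0// ltW.
have p0 : 0 < mass m Q1 by rewrite lt_def pn0 mass_ge0.
have q0 : 0 < mass m Q2 by rewrite lt_def qn0 mass_ge0.
have [C1 C2] := @C_cut Q i j (J Q (X i) / mass m Q) (J Q (X j) / mass m Q) s ij CQ.
have G1 : J Q1 G = g0 * mass m Q1.
  apply/eqP; rewrite -subr_eq0 -(Jcst mQ1) -(JB mQ1 Q1Q0)//; last exact: bounded_measurable_cst.
  exact/eqP.
have G2 : J Q2 G = g0 * mass m Q2.
  by move: QG; rewrite (J_cut mQ QQ0 mH bG) -/Q1 -/Q2 massQ mulrDr G1 => /addrI.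
have inf1 : inf S * mass m Q1 <= W Q1 - tau * J Q1 Psi.
  by rewrite -ler_pdivlMr//; apply: (ge_inf hS.2); exists Q1.
have inf2 : inf S * mass m Q2 <= W Q2 - tau * J Q2 Psi.
  by rewrite -ler_pdivlMr//; apply: (ge_inf hS.2); exists Q2.
(* Each half has value at least [inf S] and [Q] less than [inf S + ep], so the variance lost by the
   cut is at most [ep] times the mass. *)
have := W_split mQ QQ0 mH ij s1 p0 q0; rewrite -/Q1 -/Q2 -/L -/t.
move: R2; rewrite /Rf ltr_pdivrMr// (J_cut mQ QQ0 mH bP) -/Q1 -/Q2 massQ => R2 R3.
set p := mass m Q1 in p0 inf1 R2 R3 *; set q := mass m Q2 in q0 inf2 R2 R3 *.
have : t ^+ 2 * (p + q) / (p * q) <= ep * (p + q) by move: R2 R3 inf1 inf2; lra.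
rewrite ler_pdivrMr ?mulr_gt0// -mulrA [_ * (p * q)]mulrC mulrA [X in X <= _]mulrC.
rewrite mulrC [ep * _]mulrC mulrA.
rewrite [X in _ <= X * _]mulrC.
move=> h.
have h' : t ^+ 2 <= ep * (p + q) ^+ 2.
  have pq : 0 < p + q by rewrite addr_gt0.
  rewrite -(ler_pM2r pq); apply: le_trans (_ : ep * (p * q) * (p + q) <= _).
    by move: h; lra.
  rewrite ler_pM2r// ler_pM2l// -subr_ge0 (_ : _ - _ = p ^+ 2 + p * q + q ^+ 2); last by ring.
  by rewrite !addr_ge0 ?sqr_ge0 ?mulr_ge0 ?(ltW p0) ?(ltW q0).
have h2 : t <= eps / (4 * A) * (p + q).
  rewrite -ler_sqr ?nnegrE//; first by rewrite exprMn.
  by rewrite mulr_ge0 ?addr_ge0 ?divr_ge0 ?mulr_ge0 ?ltW.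
rewrite mulrC -ler_pdivlMr ?mulr_gt0//.
by rewrite mulrAC.
Qed.

End localization.

(** * Van der Corput estimates *)

Section monotone.
Variable R : realType.
Implicit Types (F f : R -> R) (a b : R).

Lemma is_derive_continuous F f a b :
  (forall x, a <= x <= b -> is_derive x 1 F (f x)) -> {within `[a, b], continuous F}.
Proof.
move=> dF; apply: derivable_within_continuous => x; rewrite in_itv /= => /dF Fx.
by case: Fx.
Qed.

Lemma mean_value F f a b : a <= b ->
  (forall x, a <= x <= b -> is_derive x 1 F (f x)) ->
  exists2 c, a <= c <= b & F b - F a = f c * (b - a).
Proof.
move=> ab dF.
have dF' x : x \in `]a, b[ -> is_derive x 1 F (f x).
  by rewrite in_itv /= => /andP[/ltW ax /ltW xb]; apply: dF; rewrite ax.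
have [c] := MVT_segment ab dF' (is_derive_continuous dF).
by rewrite in_itv /= => cab E; exists c.
Qed.

Lemma is_derive_homo F f a b : a <= b ->
  (forall x, a <= x <= b -> is_derive x 1 F (f x)) ->
  (forall x, a <= x <= b -> 0 <= f x) -> F a <= F b.
Proof.
move=> ab dF f0; have [c cab E] := mean_value ab dF.
by rewrite -subr_ge0 E mulr_ge0 ?f0// subr_ge0.
Qed.

Lemma is_derive_bound F f a b L : a <= b ->
  (forall x, a <= x <= b -> is_derive x 1 F (f x)) ->
  (forall x, a <= x <= b -> `|f x| <= L) -> `|F b - F a| <= L * (b - a).
Proof.
move=> ab dF fL; have [c cab ->] := mean_value ab dF.
by rewrite normrM (ger0_norm (_ : 0 <= b - a)) ?subr_ge0// ler_wpM2r ?subr_ge0 ?fL.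
Qed.

Lemma is_derive_domination F W f w a b : a <= b ->
  (forall x, a <= x <= b -> is_derive x 1 F (f x)) ->
  (forall x, a <= x <= b -> is_derive x 1 W (w x)) ->
  (forall x, a <= x <= b -> `|f x| <= w x) -> `|F b - F a| <= W b - W a.
Proof.
move=> ab dF dW fw; rewrite ler_norml; apply/andP; split.
  rewrite -subr_ge0 opprK.
  have : W a + F a <= W b + F b.
    apply: (@is_derive_homo (W + F) (fun x => w x + f x)) => // x xab.
      by have := dF x xab; have := dW x xab => ? ?; exact: is_deriveD.
    by have := fw x xab; rewrite ler_norml => /andP[]; lra.
  lra.
have : W a - F a <= W b - F b.
  apply: (@is_derive_homo (W - F) (fun x => w x - f x)) => // x xab.
    by have := dF x xab; have := dW x xab => ? ?; exact: is_deriveB.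
  by have := fw x xab; rewrite ler_norml => /andP[]; lra.
lra.
Qed.

End monotone.

Section van_der_corput.
Variable R : realType.

(** The capital letter is the derivative: [Phi] is phi', large of order [K], while its primitive
    [phi] stays within [-1, 1]. *)
Record antiderivative_pair (phi Phi : R -> R) (K : R) : Prop := {
  phi_derive : forall x : R, is_derive x 1 phi (Phi x);
  phi_bound : forall x : R, `|phi x| <= 1;
  Phi_bound : forall x : R, `|Phi x| <= K }.

Variables (phi Phi : R -> R) (K : R).
Hypothesis hphi : antiderivative_pair phi Phi K.

Let K0 : 0 <= K. Proof. exact: le_trans (normr_ge0 _) (Phi_bound hphi 0). Qed.

Definition composite_primitive (q : {poly R}) (H : R -> R) (a b : R) :=
  forall x, a <= x <= b -> is_derive x 1 H (Phi q.[x]).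

(* Integration by parts without integrals: H - phi(q) / q' has derivative
   phi(q) q'' / q'^2. *)
Lemma vdc_first (q : {poly R}) H a b (lam : R) (W w : R -> R) : a <= b -> 0 < lam ->
  composite_primitive q H a b ->
  (forall x, a <= x <= b -> lam <= `|q^`().[x]|) ->
  (forall x, a <= x <= b -> is_derive x 1 W (w x)) ->
  (forall x, a <= x <= b -> `|q^`()^`().[x]| / q^`().[x] ^+ 2 <= w x) ->
  `|H b - H a| <= 2 / lam + (W b - W a).
Proof.
move=> ab lam0 dH q1 dW qw.
have q10 x : a <= x <= b -> q^`().[x] != 0.
  by move=> xab; rewrite -normr_gt0; exact: lt_le_trans (q1 x xab).
pose F := H - (phi \o horner q) * (fun x => (q^`().[x])^-1).
have dF x : a <= x <= b -> is_derive x 1 F (phi q.[x] * q^`()^`().[x] / q^`().[x] ^+ 2).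
  move=> xab; have d1 := dH x xab.
  have d2 : is_derive x 1 (phi \o horner q) (Phi q.[x] * q^`().[x]).
    exact: (is_derive1_comp (phi_derive hphi q.[x]) (is_derive_poly q x)).
  have d3 : is_derive x 1 (fun x => (q^`().[x])^-1) (- (q^`().[x]) ^- 2 *: q^`()^`().[x]).
    by apply: is_deriveV; exact: q10.
  apply: is_derive_eq; rewrite /GRing.scale /=; field.
  exact: q10.
have FW : `|F b - F a| <= W b - W a.
  apply: (is_derive_domination ab dF dW) => x xab; apply: le_trans (qw x xab).
  have v0 : 0 <= (q^`().[x] ^+ 2)^-1 by rewrite invr_ge0 sqr_ge0.
  rewrite !normrM (ger0_norm v0) -mulrA; apply: ler_piMl; first exact: mulr_ge0.
  exact: phi_bound hphi _.
have bd x : a <= x <= b -> `|phi q.[x] * (q^`().[x])^-1| <= lam^-1.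
  move=> xab; rewrite normrM -[leRHS]mul1r; apply: ler_pM => //; first exact: (phi_bound hphi).
  by rewrite normfV lef_pV2 ?posrE ?normr_gt0 ?q10// q1.
have ba : `|_| <= _ := bd a (introT andP (conj (lexx a) ab)).
have bb : `|_| <= _ := bd b (introT andP (conj ab (lexx b))).
have -> : H b - H a = (F b - F a) + (phi q.[b] * (q^`().[b])^-1 - phi q.[a] * (q^`().[a])^-1).
  rewrite /F /= !fctE /=; ring.
apply: le_trans (ler_normD _ _) _; have := ler_normB (phi q.[b] * (q^`().[b])^-1) (phi q.[a] * (q^`().[a])^-1).
by move: FW ba bb; lra.
Qed.

(** The error term |q''| / q'^2 is at most 1/lam, so a linear [W] dominates it. This serves order
    one, where q' need not be monotone. *)
Lemma vdc_first_bounded (q : {poly R}) H a b (lam : R) : a <= b -> 0 < lam ->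
  composite_primitive q H a b ->
  (forall x, a <= x <= b -> lam <= `|q^`().[x]|) ->
  (forall x, a <= x <= b -> `|q^`()^`().[x]| <= lam) ->
  `|H b - H a| <= (2 + (b - a)) / lam.
Proof.
move=> ab lam0 dH q1 q2.
have := @vdc_first q H a b lam (lam^-1 *: id) (fun _ => lam^-1) ab lam0 dH q1.
rewrite /= /GRing.scale /=.
have -> : 2 / lam + (lam^-1 * b - lam^-1 * a) = (2 + (b - a)) / lam by ring.
apply => x xab; first by apply: is_derive_eq; rewrite /GRing.scale /= mulr1.
have q10 : 0 < `|q^`().[x]| by exact: lt_le_trans (q1 x xab).
rewrite ler_pdivrMr; last by rewrite -real_normK ?num_real// exprn_gt0.
apply: le_trans (q2 x xab) _.
rewrite -real_normK ?num_real// mulrC ler_pdivlMr// -expr2.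
by apply: lerXn2r; rewrite ?nnegrE; [exact: ltW|exact: normr_ge0|exact: q1].
Qed.

(** With q'' of constant sign the error term is, up to sign, the derivative of 1/q', whose total
    variation is at most 2/lam whatever the length of the interval. *)
Lemma vdc_first_monotone (q : {poly R}) H a b (lam : R) : a <= b -> 0 < lam ->
  composite_primitive q H a b ->
  (forall x, a <= x <= b -> lam <= `|q^`().[x]|) ->
  (forall x, a <= x <= b -> 0 <= q^`()^`().[x]) \/
  (forall x, a <= x <= b -> q^`()^`().[x] <= 0) ->
  `|H b - H a| <= 4 / lam.
Proof.
move=> ab lam0 dH q1 q2.
have q10 x : a <= x <= b -> q^`().[x] != 0.
  by move=> xab; rewrite -normr_gt0; exact: lt_le_trans (q1 x xab).
have bd x : a <= x <= b -> `|(q^`().[x])^-1| <= lam^-1.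
  by move=> xab; rewrite normfV lef_pV2 ?posrE ?normr_gt0 ?q10// q1.
have ba : `|_| <= _ := bd a (introT andP (conj (lexx a) ab)).
have bb : `|_| <= _ := bd b (introT andP (conj ab (lexx b))).
have d3 x : a <= x <= b ->
    is_derive x 1 (fun x => (q^`().[x])^-1) (- (q^`().[x]) ^- 2 *: q^`()^`().[x]).
  by move=> xab; apply: is_deriveV; exact: q10.
case: q2 => q2.
  have := @vdc_first q H a b lam (- (fun x => (q^`().[x])^-1))
    (fun x => - (- (q^`().[x]) ^- 2 *: q^`()^`().[x])) ab lam0 dH q1.
  rewrite /= !fctE /= => h; apply: le_trans (h _ _) _.
  - by move=> x xab; have := d3 x xab => ?; exact: is_deriveN.
  - move=> x xab; rewrite /GRing.scale /= mulNr opprK (ger0_norm (q2 x xab)).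
    by rewrite mulrC.
  by move: ba bb; rewrite !ler_norml => /andP[? ?] /andP[? ?]; lra.
have := @vdc_first q H a b lam ((fun x => (q^`().[x])^-1))
  (fun x => ((- (q^`().[x]) ^- 2 *: q^`()^`().[x]))) ab lam0 dH q1.
move=> h; apply: le_trans (h _ _) _ => //.
- move=> x xab; rewrite /GRing.scale /= mulNr (ler0_norm (q2 x xab)).
  by rewrite mulNr mulrC.
by move: ba bb; rewrite !ler_norml => /andP[? ?] /andP[? ?]; lra.
Qed.

(** [g] increases with slope at least [lam], so it is at least lam * th in absolute value outside
    the [th]-neighbourhood of its zero, or of an endpoint if it has none. The provisos [c1 != a] and
    [c2 != b] exclude outer pieces reduced to one point, where the bound may fail. *)
Lemma derivn_bound_split (g : {poly R}) a b (lam th : R) : a <= b -> 0 < lam -> 0 <= th ->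
  (forall x, a <= x <= b -> lam <= g^`().[x]) ->
  exists c1 c2, [/\ a <= c1 <= c2 /\ c2 <= b, c2 - c1 <= 2 * th,
    (forall x, a <= x <= c1 -> c1 != a -> g.[x] <= - (lam * th)) &
    (forall x, c2 <= x <= b -> c2 != b -> lam * th <= g.[x])].
Proof.
move=> ab lam0 th0 g1.
have incr x y : a <= x -> x <= y -> y <= b -> lam * (y - x) <= g.[y] - g.[x].
  move=> ax xy yb.
  have dg z : x <= z <= y -> is_derive z 1 (horner g) (g^`().[z]) by move=> _; exact: is_derive_poly.
  have [z /andP[xz zy] ->] := mean_value xy dg.
  by apply: ler_wpM2r; rewrite ?subr_ge0// g1// (le_trans ax xz) (le_trans zy yb).
have [c /andP[ac cb] [cl cr]] : exists2 c, a <= c <= b &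
    (forall x, a <= x -> x < c -> g.[c] <= 0) /\ (forall x, c < x -> x <= b -> 0 <= g.[c]).
  have [ga|ga] := leP 0 g.[a].
    by exists a; rewrite ?lexx//; split => // x ax xa; move: (le_lt_trans ax xa); rewrite ltxx.
  have [gb|gb] := leP g.[b] 0.
    by exists b; rewrite ?lexx ?ab//; split => // x ax xa; move: (lt_le_trans ax xa); rewrite ltxx.
  have gab : g.[a] <= 0 <= g.[b] by rewrite !ltW.
  have [c] := poly_ivt ab gab.
  by move=> cab /rootP c0; exists c => //; rewrite c0; split.
exists (Num.max a (c - th)), (Num.min b (c + th)).
have mx : (c - th <= a /\ Num.max a (c - th) = a) \/ (a <= c - th /\ Num.max a (c - th) = c - th).
  by case: (leP a (c - th)) => h; [right|left]; split => //; exact: ltW.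
have mn : (b <= c + th /\ Num.min b (c + th) = b) \/ (c + th <= b /\ Num.min b (c + th) = c + th).
  by case: (leP b (c + th)) => h; [left|right]; split => //; exact: ltW.
split.
- by case: mx => [[? ->]|[? ->]]; case: mn => [[? ->]|[? ->]]; split; try apply/andP; try split; lra.
- by case: mx => [[? ->]|[? ->]]; case: mn => [[? ->]|[? ->]]; lra.
- move=> x; case: mx => [[_ ->]|[h ->]]; first by rewrite eqxx.
  move=> /andP[ax xc] na.
  have := incr x c ax _ cb.
  have xc' : x <= c by lra.
  move=> /(_ xc') h1.
  have [xc''|xc''] := ltP x c.
    have := cl x ax xc''; have : lam * th <= lam * (c - x) by rewrite ler_pM2l//; lra.
    lra.
  have th00 : th = 0 by lra.
  have ca : a < c by rewrite lt_neqAle ac andbT eq_sym; move: na; rewrite th00 subr0.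
  have := cl a (lexx _) ca; have -> : x = c by lra.
  by rewrite th00 mulr0 oppr0.
- move=> x; case: mn => [[_ ->]|[h ->]]; first by rewrite eqxx.
  move=> /andP[cx xb] nb.
  have xc' : c <= x by lra.
  have h1 := incr c x ac xc' xb.
  have [xc''|xc''] := ltP c x.
    have := cr x xc'' xb; have : lam * th <= lam * (x - c) by rewrite ler_pM2l//; lra.
    lra.
  have th00 : th = 0 by lra.
  have cb' : c < b by rewrite lt_neqAle cb andbT; move: nb; rewrite th00 addr0.
  have := cr b cb' (lexx _); have -> : x = c by lra.
  by rewrite th00 mulr0.
Qed.

End van_der_corput.

Section van_der_corput_higher.
Variable R : realType.

(** The two outer pieces cost [D] each; the middle one has length at most 2 th and is estimated by
    the trivial bound [K] on the derivative of [H]. *)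
Lemma vdc_step (phi Phi : R -> R) K (q g : {poly R}) H (a b lam th D : R) :
  antiderivative_pair phi Phi K -> a <= b -> 0 < lam -> 0 <= th -> 0 <= D ->
  composite_primitive Phi q H a b ->
  (forall x, a <= x <= b -> lam <= g^`().[x]) \/
    (forall x, a <= x <= b -> g^`().[x] <= - lam) ->
  (forall c d, a <= c -> c <= d -> d <= b ->
    (forall x, c <= x <= d -> lam * th <= g.[x]) \/
    (forall x, c <= x <= d -> g.[x] <= - (lam * th)) -> `|H d - H c| <= D) ->
  `|H b - H a| <= 2 * D + 2 * (K * th).
Proof.
move=> hphi ab lam0 th0 D0 dH g1 hD.
wlog g1' : g g1 hD / forall x, a <= x <= b -> lam <= g^`().[x].
  move=> wl; case: (g1) => {}g1; first by apply: (wl g) => //; left.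
  apply: (wl (- g)).
  - by left => x xab; rewrite derivN hornerN lerNr g1.
  - move=> c d ac cd db [h|h]; apply: hD => //; [right|left] => x /h; rewrite hornerN; lra.
  - by move=> x xab; rewrite derivN hornerN lerNr g1.
have [c1 [c2 [[/andP[ac1 c12] c2b] c21 h1 h2]]] := derivn_bound_split ab lam0 th0 g1'.
have e1 : `|H c1 - H a| <= D.
  have [->|n] := eqVneq c1 a; first by rewrite subrr normr0.
  by apply: hD => //; [exact: le_trans c2b|right => x xab; exact: h1].
have e2 : `|H b - H c2| <= D.
  have [<-|n] := eqVneq c2 b; first by rewrite subrr normr0.
  by apply: hD => //; [exact: le_trans c12|left => x xab; exact: h2].
have e3 : `|H c2 - H c1| <= K * (c2 - c1).
  apply: (@is_derive_bound _ _ (fun x => Phi q.[x])) => // x /andP[? ?].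
    by apply: dH; rewrite (le_trans ac1)//= (le_trans _ c2b).
  exact: Phi_bound hphi _.
have K0 : 0 <= K := le_trans (normr_ge0 _) (Phi_bound hphi 0).
have e4 : K * (c2 - c1) <= K * (2 * th) by exact: ler_wpM2l.
rewrite (_ : H b - H a = (H b - H c2) + (H c2 - H c1) + (H c1 - H a)); last by ring.
apply: le_trans (ler_normD _ _) _.
have := ler_normD (H b - H c2) (H c2 - H c1).
lra.
Qed.

(** The classical bound of order k + 2, with th playing the role of (K lam)^(-1/(k+2)); an
    inequality on powers replaces the root. *)
Definition vdc_bound (C : R) (k : nat) :=
  forall (phi Phi : R -> R) K (q : {poly R}) H (a b lam th : R),
  antiderivative_pair phi Phi K -> a <= b -> 0 < lam -> 0 < th ->
  1 <= th ^+ k.+2 * K * lam ->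
  composite_primitive Phi q H a b ->
  (forall x, a <= x <= b -> lam <= q^`(k.+2).[x]) \/
    (forall x, a <= x <= b -> q^`(k.+2).[x] <= - lam) ->
  `|H b - H a| <= C * (K * th).

(** Induction on the order through [vdc_step]: away from a short interval a lower bound [lam] on one
    derivative becomes lam * th on the previous one, which preserves the product th^(k+2) K lam. At
    order two, q' is monotone and 10 = 2 * 4 + 2. *)
Lemma van_der_corput k : exists2 C : R, 0 <= C & vdc_bound C k.
Proof.
elim: k => [|k [C C0 IH]].
  exists 10 => // phi Phi K q H a b lam th hphi ab lam0 th0 thK dH q2.
  have lt0 : 0 < lam * th by rewrite mulr_gt0.
  have inv : (lam * th)^-1 <= K * th.
    rewrite -div1r ler_pdivrMr//; apply: le_trans thK _; rewrite expr2; lra.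
  have D0 : 0 <= 4 / (lam * th) by apply: divr_ge0 => //; exact: ltW.
  have h := @vdc_step phi Phi K q q^`() H a b lam th _ hphi ab lam0 (ltW th0) D0 dH q2.
  suff pieces : forall c d : R, a <= c -> c <= d -> d <= b ->
      (forall x, c <= x <= d -> lam * th <= q^`().[x]) \/
      (forall x, c <= x <= d -> q^`().[x] <= - (lam * th)) -> `|H d - H c| <= 4 / (lam * th).
    by apply: le_trans (h pieces) _; clear -inv; lra.
  move=> c d ac cd db g1.
  apply: (vdc_first_monotone hphi cd lt0).
  - by move=> x /andP[? ?]; apply: dH; rewrite (le_trans ac)//= (le_trans _ db).
  - move=> x xcd; case: g1 => /(_ x xcd) h1; first exact: le_trans (ler_norm _).
    by rewrite -normrN; apply: le_trans (ler_norm _); rewrite lerNr.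
  - case: q2 => q2; [left|right] => x /andP[? ?].
      by apply: le_trans (ltW lam0) (q2 x _); rewrite (le_trans ac)//= (le_trans _ db).
    by apply: le_trans (q2 x _) _; rewrite ?oppr_le0 ?(ltW lam0)// (le_trans ac)//= (le_trans _ db).
exists (2 * C + 2); first lra.
move=> phi Phi K q H a b lam th hphi ab lam0 th0 thK dH qk.
have K0 : 0 <= K := le_trans (normr_ge0 _) (Phi_bound hphi 0).
have := @vdc_step phi Phi K q q^`(k.+2) H a b lam th (C * (K * th)) hphi ab lam0 (ltW th0).
have CKth : 0 <= C * (K * th) by rewrite !mulr_ge0// ltW.
move=> /(_ CKth dH); rewrite -derivnS => /(_ qk) h.
suff pieces : forall c d : R, a <= c -> c <= d -> d <= b ->
    (forall x, c <= x <= d -> lam * th <= q^`(k.+2).[x]) \/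
    (forall x, c <= x <= d -> q^`(k.+2).[x] <= - (lam * th)) -> `|H d - H c| <= C * (K * th).
  by apply: le_trans (h pieces) _; rewrite le_eqVlt; apply/orP; left; apply/eqP; ring.
move=> c d ac cd db g1.
apply: (IH phi Phi K q H c d (lam * th) th) => //.
- by rewrite mulr_gt0.
- by apply: le_trans thK _; rewrite exprS; lra.
- by move=> x /andP[? ?]; apply: dH; rewrite (le_trans ac)//= (le_trans _ db).
Qed.

End van_der_corput_higher.

(** * Polynomials on a window of bounded length *)

Section window.
Variables (R : realType) (d : nat).
Hypothesis d0 : (0 < d)%N.

(** The constant coefficient is left out, since it contributes nothing to the spread of [q]. *)
Definition poly_size (q : {poly R}) : R := \sum_(1 <= j < d.+1) `|q`_j|.

(** [D] bounds the growth of a coefficient under differentiation and evaluation on [-3, 3]. With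
    [rho] below, d * rho * D = 1/2: coefficients smaller than [rho] times the dominant one
    contribute at most half of it. *)
Let D : R := (3 ^ d * d`!)%:R.
Let rho : R := (2 * d%:R * D)^-1.

Let D1 : 1 <= D. Proof. by rewrite ler1n muln_gt0 expn_gt0 fact_gt0. Qed.

Let dDgt0 : 0 < 2 * d%:R * D.
Proof. by apply: mulr_gt0; [rewrite mulr_gt0// ltr0n | exact: lt_le_trans ltr01 D1]. Qed.

Let rho0 : 0 < rho. Proof. by rewrite invr_gt0. Qed.

Let rho1 : rho <= 1.
Proof.
rewrite invf_le1//.
have : 1 <= d%:R :> R by rewrite ler1n.
move: D1; set x := D; set y := d%:R : R; nra.
Qed.

Let hornerE_derivn (q : {poly R}) k x : (size q <= d.+1)%N ->
  q^`(k).[x] = \sum_(k <= j < d.+1) q`_j *+ j ^_ k * x ^+ (j - k).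
Proof.
move=> sq; rewrite (@horner_coef_wide _ (d.+1 - k)); last first.
  by apply/leq_sizeP => j jd; rewrite coef_derivn nth_default ?mul0rn//; apply: leq_trans sq _; lia.
rewrite -[X in \sum_(X <= _ < _) _]add0n big_addn big_mkord; apply: eq_bigr => i _.
by rewrite coef_derivn addnK addnC.
Qed.

Let term_bound (a x : R) k j : `|x| <= 3 -> (k <= j <= d)%N ->
  `|a *+ j ^_ k * x ^+ (j - k)| <= D * `|a|.
Proof.
move=> x3 /andP[kj jd].
rewrite normrM normrMn normrX -mulr_natr -mulrA mulrC.
apply: ler_wpM2r => //.
rewrite /D mulnC natrM natrX; apply: ler_pM => //.
  rewrite ler_nat; apply: (@leq_trans j`!); last exact: leq_fact.
  by rewrite -(ffact_fact kj) leq_pmulr// fact_gt0.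
apply: (@le_trans _ _ (3 ^+ (j - k))); first by apply: lerXn2r; rewrite ?nnegrE.
by apply: ler_weXn2l; [lra|lia].
Qed.

Lemma derivn_le (q : {poly R}) k x : (size q <= d.+1)%N -> `|x| <= 3 ->
  `|q^`(k).[x]| <= D * \sum_(k <= j < d.+1) `|q`_j|.
Proof.
move=> sq x3; rewrite hornerE_derivn//; apply: le_trans (ler_norm_sum _ _ _) _.
rewrite mulr_sumr !big_nat; apply: ler_sum => j /andP[kj jd].
by apply: term_bound => //; lia.
Qed.

Lemma derivn_near (q : {poly R}) k x : (size q <= d.+1)%N -> (k <= d)%N -> `|x| <= 3 ->
  `|q^`(k).[x] - q`_k *+ k`!| <= D * \sum_(k.+1 <= j < d.+1) `|q`_j|.
Proof.
move=> sq kd x3.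
rewrite hornerE_derivn// big_ltn ?ltnS// subnn expr0 mulr1 ffactnn addrC addKr.
apply: le_trans (ler_norm_sum _ _ _) _.
rewrite mulr_sumr !big_nat; apply: ler_sum => j /andP[kj jd].
by apply: term_bound => //; lia.
Qed.

(** Take [k] maximizing |q_j| / rho^j: the coefficients above [k] are smaller by a factor [rho],
    those below are larger by at most rho^(-d). *)
Let dominant (q : {poly R}) : exists k, [/\ (0 < k <= d)%N,
  forall j, (0 < j <= d)%N -> `|q`_j| <= `|q`_k| / rho ^+ d &
  forall j, (k < j <= d)%N -> `|q`_j| <= rho * `|q`_k|].
Proof.
pose u j := `|q`_j| / rho ^+ j.
have [k kd ku] : exists2 k, (0 < k <= d)%N & forall j, (0 < j <= d)%N -> u j <= u k.
  have [k _ hk] := @Order.TotalTheory.arg_maxP _ R 'I_d (Ordinal d0) predT (fun i => u i.+1) isT.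
  exists k.+1; first by rewrite /= ltn_ord.
  by case=> // j /= jd; exact: (hk (Ordinal jd)).
have ukE j : (0 < j <= d)%N -> `|q`_j| <= `|q`_k| / rho ^+ k * rho ^+ j.
  by move=> jd; rewrite -ler_pdivrMr ?exprn_gt0//; exact: ku.
exists k; split => // j jd.
  apply: le_trans (ukE j jd) _; rewrite -mulrA; apply: ler_wpM2l => //.
  have ik : (rho ^+ k)^-1 <= (rho ^+ d)^-1.
    rewrite lef_pV2 ?posrE ?exprn_gt0//; apply: ler_wiXn2l => //; [exact: ltW|lia].
  have r1 : rho ^+ j <= 1 by apply: exprn_ile1 => //; exact: ltW.
  by apply: le_trans ik; apply: ler_piMr => //; rewrite invr_ge0 exprn_ge0// ltW.
have jd' : (0 < j <= d)%N by lia.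
apply: le_trans (ukE j jd') _; rewrite -mulrA mulrC; apply: ler_wpM2r => //.
rewrite mulrC -expfB; last by lia.
rewrite -[leRHS]expr1; apply: ler_wiXn2l => //; [exact: ltW|lia].
Qed.

(** The dominant coefficient, of index [k], fixes the sign and the size of the k-th derivative on
    the whole window, so van der Corput of order [k] applies; which order occurs depends on [q],
    hence the sum of the constants. *)
Lemma window_estimate : exists2 C : R, 0 <= C &
  forall (phi Phi : R -> R) K (q : {poly R}) H (a b th : R),
  antiderivative_pair phi Phi K -> (size q <= d.+1)%N ->
  -3 <= a -> a <= b -> b <= 3 -> 0 < th ->
  1 <= th ^+ d * K * poly_size q ->
  composite_primitive Phi q H a b -> `|H b - H a| <= C * (K * th).
Proof.
have /choice[Cf hCf] k : exists C : R, 0 <= C /\ vdc_bound C k.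
  by have [C C0 h] := van_der_corput R k; exists C.
have dR : 1 <= d%:R :> R by rewrite ler1n.
(* The loss in passing from the size of [q] to half its dominant coefficient; it is moved into [th],
   so that th' = c * th. *)
pose c : R := 2 * d%:R / rho ^+ d.
have rd0 : 0 < rho ^+ d by rewrite exprn_gt0.
have c1 : 1 <= c.
  rewrite /c ler_pdivlMr// mul1r; apply: (@le_trans _ _ 1); last lra.
  by apply: exprn_ile1 => //; exact: ltW.
pose S := \sum_(k < d) Cf k.
have S0 : 0 <= S by apply: sumr_ge0 => k _; have [] := hCf k.
have c0 : 0 <= c := le_trans ler01 c1.
have Sc0 : 0 <= (8 + S) * c by apply: mulr_ge0 => //; exact: addr_ge0.
exists (6 + (8 + S) * c); first exact: addr_ge0.
move=> phi Phi K q H a b th hphi sq a3 ab b3 th0 thN dH.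
have K0 : 0 <= K := le_trans (normr_ge0 _) (Phi_bound hphi 0).
have dHb : `|H b - H a| <= K * (b - a).
  by apply: (@is_derive_bound _ _ (fun x => Phi q.[x])) => // x _; exact: Phi_bound hphi _.
have x3 x : a <= x <= b -> `|x| <= 3.
  by move=> /andP[? ?]; rewrite ler_norml; apply/andP; split; lra.
(* For th >= 1 the trivial bound by 6 K suffices; for th < 1 one has th^d <= th^k, so the order may
   drop from [d] to [k]. *)
have [th1|th1] := leP 1 th.
  apply: le_trans dHb _; apply: (@le_trans _ _ (6 * (K * th))).
    have : K <= K * th by rewrite ler_peMr.
    have : K * (b - a) <= K * 6 by apply: ler_wpM2l => //; lra.
    lra.
  by apply: ler_wpM2r; [rewrite mulr_ge0// ltW|rewrite lerDl].
have [k [/andP[k0 kd] qj qk]] := dominant q.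
have qN : poly_size q <= c / 2 * `|q`_k|.
  rewrite /poly_size.
  apply: (@le_trans _ _ (\sum_(1 <= j < d.+1) `|q`_k| / rho ^+ d)).
    by rewrite !big_nat; apply: ler_sum => j jd; exact: qj.
  rewrite sumr_const_nat subn1 /= -mulr_natr /c.
  by rewrite le_eqVlt; apply/orP; left; apply/eqP; field; rewrite gt_eqF.
have q0 : 0 < `|q`_k|.
  rewrite normr_gt0; apply: contraTN isT => /eqP z; move: thN qN; rewrite z normr0 mulr0 => h1 h2.
  have : th ^+ d * K * poly_size q <= 0 by rewrite mulr_ge0_le0// mulr_ge0// exprn_ge0 ?ltW.
  by move=> h3; exfalso; lra.
pose lam := `|q`_k| / 2.
have lam0 : 0 < lam by rewrite divr_gt0.
have tail : D * \sum_(k.+1 <= j < d.+1) `|q`_j| <= lam.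
  apply: (@le_trans _ _ (D * (d%:R * (rho * `|q`_k|)))).
    apply: ler_wpM2l; first exact: le_trans ler01 D1.
    apply: (@le_trans _ _ (\sum_(k.+1 <= j < d.+1) (rho * `|q`_k|))).
      by rewrite !big_nat; apply: ler_sum => j jd; exact: qk.
    rewrite sumr_const_nat -[X in X <= _]mulr_natl; apply: ler_wpM2r; first by rewrite mulr_ge0// ltW.
    by rewrite ler_nat subSS leq_subr.
  rewrite /lam /rho le_eqVlt; apply/orP; left; apply/eqP; field.
  by rewrite !gt_eqF//; exact: lt_le_trans ltr01 _.
have fk : 1 <= (k`!)%:R :> R by rewrite ler1n fact_gt0.
have sign : (forall x, a <= x <= b -> lam <= q^`(k).[x]) \/
    (forall x, a <= x <= b -> q^`(k).[x] <= - lam).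
  have near x : a <= x <= b -> `|q^`(k).[x] - q`_k *+ k`!| <= lam.
    by move=> /x3 h; apply: le_trans (derivn_near sq kd h) tail.
  have [qp|qp] := leP 0 q`_k; [left|right] => x /near; rewrite ler_norml -mulr_natr.
    move: fk; rewrite /lam (ger0_norm qp); set y := q`_k in qp *; set f := _%:R => f1 /andP[h1 h2].
    have : y <= y * f by rewrite ler_peMr.
    lra.
  move: fk; rewrite /lam (ltr0_norm qp); set y := q`_k in qp *; set f := _%:R => f1 /andP[h1 h2].
  have : y * f <= y by rewrite ler_neMr// ltW.
  lra.
pose th' := c * th.
have th'0 : 0 < th' by rewrite mulr_gt0// (lt_le_trans ltr01 c1).
have thlam : 1 <= th' ^+ k * K * lam.
  apply: le_trans thN _.
  apply: (@le_trans _ _ (th ^+ d * K * (c * lam))).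
    apply: ler_wpM2l; first by rewrite mulr_ge0// exprn_ge0// ltW.
    by rewrite /lam; move: qN; lra.
  rewrite mulrA; apply: ler_wpM2r; first exact: ltW.
  rewrite mulrAC; apply: ler_wpM2r => //.
  rewrite /th' exprMn mulrC; apply: ler_pM.
  - exact: c0.
  - by apply: exprn_ge0; exact: ltW.
  - by rewrite -[X in X <= _]expr1; apply: ler_weXn2l.
  - by apply: ler_wiXn2l => //; exact: ltW.
have fin C : 0 <= C -> C <= 8 + S -> `|H b - H a| <= C * (K * th') ->
    `|H b - H a| <= (6 + (8 + S) * c) * (K * th).
  move=> C0 CS h; apply: le_trans h _.
  rewrite (_ : C * (K * th') = C * c * (K * th)); last by rewrite /th'; ring.
  have Kth : 0 <= K * th by rewrite mulr_ge0// ltW.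
  apply: ler_wpM2r => //.
  apply: (@le_trans _ _ ((8 + S) * c)); first exact: ler_wpM2r.
  by rewrite lerDr.
(* At order one, |q''| is bounded by the tail of the coefficients, hence by [lam]; 8 is 2 plus the
   length 6 of the window. *)
move: k0 kd thlam sign tail; case: (k) => // -[|k'] _ kd thlam sign tail.
  apply: (fin 8) => //; first lra.
  apply: le_trans (vdc_first_bounded hphi ab lam0 dH _ _) _.
  - move=> x xab; case: sign => /(_ x xab); rewrite derivn1 => h; first exact: le_trans (ler_norm _).
    by rewrite -normrN; apply: le_trans (ler_norm _); rewrite lerNr.
  - move=> x xab; apply: le_trans tail; rewrite -[X in `|X.[_]|]/(q^`(2)).
    by apply: derivn_le => //; exact: x3.
  rewrite ler_pdivrMr//; move: thlam; rewrite expr1.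
  rewrite (_ : 8 * (K * th') * lam = 8 * (th' * K * lam)); last by ring.
  by move: (th' * K * lam) => y y1; lra.
have [Ck0 Ck] := hCf k'.
have k'd : (k' < d)%N := ltnW kd.
apply: (fin (Cf k')) => //.
  apply: (@le_trans _ _ S); last lra.
  rewrite /S (bigD1 (Ordinal k'd))//= lerDl; apply: sumr_ge0 => i _.
  by have [] := hCf i.
exact: (Ck phi Phi K q H a b lam th').
Qed.

End window.

(** * Log-concave sequences *)

Section log_concave_sequences.
Variable R : realType.
Implicit Types v p h D : nat -> R.

(* Discretised midpoint log-concavity; the second condition, at half-integers,
   excludes internal zeros. *)
Record log_concave_seq v : Prop := {
  lcs_ge0 : forall j, 0 <= v j;
  lcs_even : forall a b c, (a + b = c + c)%N -> v a * v b <= v c ^+ 2;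
  lcs_odd : forall a b c, (a + b = c + c.+1)%N -> v a * v b <= (v c + v c.+1) ^+ 2 }.

(** Some index strictly between [a] and [b], at or next to their midpoint, has positive value;
    induct on the distance. *)
Lemma log_concave_seq_no_gap v : log_concave_seq v ->
  forall n a b c, (b - a <= n)%N -> (a < c < b)%N -> 0 < v a -> 0 < v b -> 0 < v c.
Proof.
move=> lc; elim=> [|n IH] a b c ban /andP[ac cb] va vb.
  by move: ban; rewrite leqn0 subn_eq0 leqNgt (ltn_trans ac cb).
have [e [/andP[ae eb] ve]] : exists e, (a < e < b)%N /\ 0 < v e.
  pose m := ((a + b)./2)%N.
  have vab : 0 < v a * v b by rewrite mulr_gt0.
  have abE : (a + b = odd (a + b) + (m + m))%N by rewrite addnn odd_double_half.
  case: (odd (a + b)) abE => abE; last first.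
    exists m; split; first by lia.
    have := lt_le_trans vab (lcs_even lc abE).
    by rewrite exprn_even_gt0//= lt_def (lcs_ge0 lc) andbT.
  have abE' : (a + b = m + m.+1)%N by rewrite abE /=; lia.
  have := lt_le_trans vab (lcs_odd lc abE').
  have [vm|vm] := eqVneq (v m) 0.
    rewrite vm add0r exprn_even_gt0//= => vm1.
    exists m.+1; split; last by rewrite lt_def vm1 (lcs_ge0 lc).
    have m1b : (m.+1 != b) by apply/eqP => e; move: va; rewrite (_ : a = m) ?vm ?ltxx//; lia.
    by move/eqP: m1b; lia.
  move=> _; have [am|am] := eqVneq a m.
    have m1b : (m.+1 < b)%N by lia.
    by exfalso; lia.
  exists m; split; last by rewrite lt_def vm (lcs_ge0 lc).
  by move/eqP: am; lia.
have [ce|ce|->//] := ltngtP c e.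
- by apply: (IH a e c) => //; [lia|rewrite ac].
- by apply: (IH e b c) => //; [lia|rewrite ce].
Qed.

Variable v : nat -> R.
Hypotheses (lc : log_concave_seq v) (v_max : forall j, v j <= v 0%N) (v0 : 0 < v 0%N).

Lemma log_concave_seq_nonincreasing j : v j.+1 <= v j.
Proof.
elim: j => [|j IH]; first exact: v_max.
have [vj|vj] := eqVneq (v j) 0.
  have v1 : v j.+1 = 0 by apply/eqP; rewrite eq_le (lcs_ge0 lc) andbT -vj.
  rewrite v1 leNgt; apply/negP => v2.
  suff : 0 < v j.+1 by rewrite v1 ltxx.
  by apply: (log_concave_seq_no_gap lc (leqnn _) _ v0 v2); rewrite /= ltnSn.
have vj0 : 0 < v j by rewrite lt_def vj (lcs_ge0 lc).
rewrite -(ler_pM2l vj0).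
apply: le_trans (lcs_even lc (_ : (j + j.+2 = j.+1 + j.+1)%N)) _; first lia.
by rewrite expr2; apply: ler_wpM2r => //; exact: lcs_ge0.
Qed.

Lemma log_concave_seq_homo i j : (i <= j)%N -> v j <= v i.
Proof.
move=> /subnK <-; elim: (j - i)%N => [|k IH]; first by rewrite add0n.
by rewrite addSn; exact: le_trans (log_concave_seq_nonincreasing _) IH.
Qed.

Hypothesis v_sum : forall n, \sum_(j < n) v j <= 1.
Variable r : nat.
Hypothesis hr : 2 <= r%:R * v 0%N.

(** Monotonicity and total mass give r v_r <= 1 <= r v_0 / 2, a halving over the first block;
    log-concavity along multiples of [r] propagates that ratio. *)
Lemma log_concave_seq_decay i : v (i * r)%N <= v 0%N / 2 ^+ i.
Proof.
have r0 : (0 < r)%N by case: r hr => //; rewrite mul0r => h; exfalso; lra.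
pose u i := v (i * r)%N.
have u1 : u 1%N <= u 0%N / 2.
  rewrite /u mul1n mul0n.
  have h1 : r%:R * v r <= 1.
    apply: le_trans (v_sum r).
    rewrite -[X in X%:R * _]card_ord mulr_natl -sumr_const; apply: ler_sum => j _.
    by apply: log_concave_seq_homo; exact: ltnW.
  have rp : 0 < r%:R :> R by rewrite ltr0n.
  rewrite -(ler_pM2l rp); move: h1 hr; move: (v r) (v 0%N) (r%:R) => x y z; rewrite mulrA; lra.
suff H n : u n.+1 <= u n / 2.
  elim: i => [|i IH]; first by rewrite mul0n expr0 divr1.
  by apply: le_trans (H i) _; rewrite exprSr invfM mulrA; apply: ler_wpM2r.
elim: n => [//|n IH].
have hom : u n.+2 <= u n.+1 by apply: log_concave_seq_homo; lia.
have [un1|un1] := eqVneq (u n.+1) 0; first by rewrite un1 mul0r -un1.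
have un10 : 0 < u n.+1 by rewrite lt_def un1 (lcs_ge0 lc).
have un0 : 0 < u n by lra.
have h := lcs_even lc (_ : (n * r + n.+2 * r = n.+1 * r + n.+1 * r)%N).
have {}h : u n * u n.+2 <= u n.+1 ^+ 2 by apply: h; lia.
rewrite -(ler_pM2l un0); apply: le_trans h _.
by rewrite expr2 mulrA mulrAC; apply: ler_wpM2r; lra.
Qed.

End log_concave_sequences.

Section abel_summation.
Variable R : realType.
Implicit Types p h D : nat -> R.

(** Summation by parts: with nonincreasing weights only the oscillation of [h] counts, not its
    variation. *)
Lemma abel_bound p h (B : R) u n : (forall j, 0 <= p j) -> (forall j, p j.+1 <= p j) ->
  (forall b, (u <= b <= u + n)%N -> `|h b - h u| <= B) ->
  `|\sum_(u <= j < u + n) p j * (h j.+1 - h j)| <= p u * B.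
Proof.
move=> p0 pd hB.
have B0 : 0 <= B by apply: le_trans (normr_ge0 _) (hB u _); rewrite leqnn leq_addr.
suff H : `|\sum_(u <= j < u + n) p j * (h j.+1 - h j) - p (u + n)%N * (h (u + n)%N - h u)|
    <= (p u - p (u + n)%N) * B.
  have hn : `|h (u + n)%N - h u| <= B by apply: hB; rewrite leq_addr leqnn.
  have : `|p (u + n)%N * (h (u + n)%N - h u)| <= p (u + n)%N * B.
    by rewrite normrM (ger0_norm (p0 _)) ler_wpM2l.
  set S := \sum_(_ <= j < _) _ in H *; set E := _ * (h _ - h u) in H *.
  have := ler_normD (S - E) E; rewrite subrK mulrBl in H *; lra.
elim: n hB => [|n IH] hB; first by rewrite addn0 big_geq// subrr mulr0 subrr normr0 subrr mul0r.
have {}IH := IH (fun b hb => hB b ltac:(lia)).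
rewrite addnS big_nat_recr /=; last exact: leq_addr.
have hn : `|h (u + n).+1 - h u| <= B by apply: hB; lia.
set S := \sum_(_ <= j < _) _ in IH *.
rewrite (_ : S + _ - _ = (S - p (u + n)%N * (h (u + n)%N - h u)) +
  (p (u + n)%N - p (u + n).+1) * (h (u + n).+1 - h u)); last by ring.
apply: le_trans (ler_normD _ _) _.
have pn : 0 <= p (u + n)%N - p (u + n).+1 by rewrite subr_ge0.
have : `|(p (u + n)%N - p (u + n).+1) * (h (u + n).+1 - h u)| <= (p (u + n)%N - p (u + n).+1) * B.
  by rewrite normrM (ger0_norm pn) ler_wpM2l.
lra.
Qed.

Lemma block_sum p h D (eta : R) r n : (forall j, 0 <= p j) -> (forall j, p j.+1 <= p j) ->
  (forall i, p (i * r)%N <= eta / 2 ^+ i) ->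
  (forall i b, (i * r <= b <= i * r + r)%N -> `|h b - h (i * r)%N| <= D i) ->
  `|\sum_(0 <= j < n * r) p j * (h j.+1 - h j)| <= eta * \sum_(i < n) D i / 2 ^+ i.
Proof.
move=> p0 pd peta hD.
elim: n => [|n IH]; first by rewrite mul0n big_geq// big_ord0 mulr0 normr0.
rewrite mulSn addnC (@big_cat_nat _ _ _ (n * r)%N) ?leq_addr//= big_ord_recr /= mulrDr.
apply: le_trans (ler_normD _ _) _; apply: lerD => //.
apply: le_trans (abel_bound p0 pd (hD n)) _.
have D0 : 0 <= D n by apply: le_trans (normr_ge0 _) (hD n (n * r)%N _); rewrite leqnn leq_addr.
by apply: le_trans (ler_wpM2r D0 (peta n)) _; rewrite mulrAC mulrA.
Qed.

Lemma block_moment p (f : nat -> R) D (eta : R) r n : (forall j, 0 <= p j) -> (forall j, p j.+1 <= p j) ->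
  (forall i, p (i * r)%N <= eta / 2 ^+ i) -> (forall i, 0 <= D i) ->
  (forall i b, (i * r <= b < i * r + r)%N -> f b <= D i) ->
  \sum_(0 <= j < n * r) p j * f j <= r%:R * eta * \sum_(i < n) D i / 2 ^+ i.
Proof.
move=> p0 pd peta D0 fD.
have hom i j : (i <= j)%N -> p j <= p i.
  move=> /subnK <-; elim: (j - i)%N => [|k IH]; first by rewrite add0n.
  by rewrite addSn; exact: le_trans (pd _) IH.
elim: n => [|n IH]; first by rewrite mul0n big_geq// big_ord0 mulr0.
rewrite mulSn addnC (@big_cat_nat _ _ _ (n * r)%N) ?leq_addr//= big_ord_recr /= mulrDr.
apply: lerD => //.
apply: (@le_trans _ _ (\sum_(n * r <= j < n * r + r) eta / 2 ^+ n * D n)).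
  rewrite !big_nat; apply: ler_sum => j /andP[j1 j2].
  apply: (@le_trans _ _ (p j * D n)); first by apply: ler_wpM2l => //; apply: fD; rewrite j1.
  by apply: ler_wpM2r => //; exact: le_trans (hom _ _ j1) (peta n).
rewrite sumr_const_nat addKn -mulr_natl le_eqVlt; apply/orP; left; apply/eqP; ring.
Qed.

(** Since (n+1)^(s+2) <= A 2^n, the terms are at most A/(n+1)^2, and these sums stay below 2 A (1 -
    1/(n+1)). *)
Lemma geometric_moment s : exists2 C : R, 0 <= C &
  forall n, \sum_(i < n) (i.+1)%:R ^+ s / 2 ^+ i <= C.
Proof.
pose r := s.+2.
pose A : R := ((r.+1) ^ r)%:R.
have key n : (n.+1)%:R ^+ r <= A * 2 ^+ n.
  rewrite /A -!natrX -natrM ler_nat.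
  have h : (n.+1 <= r.+1 * (n %/ r).+1)%N.
    by rewrite {1}(divn_eq n r); have := ltn_pmod n (isT : 0 < r)%N; nia.
  apply: (@leq_trans ((r.+1 * (n %/ r).+1) ^ r)); first by rewrite leq_exp2r.
  rewrite expnMn leq_mul2l; apply/orP; right.
  apply: (@leq_trans ((2 ^ (n %/ r)) ^ r)); first by rewrite leq_exp2r// ltn_expl.
  by rewrite -expnM leq_exp2l// leq_trunc_div.
have A0 : 0 <= A by [].
exists (2 * A); first by rewrite mulr_ge0.
move=> n; suff : \sum_(i < n) (i.+1)%:R ^+ s / 2 ^+ i <= 2 * A * (1 - (n.+1)%:R^-1).
  move=> /le_trans; apply; rewrite ler_piMr ?mulr_ge0// lerBlDr lerDl//.
elim: n => [|n IH]; first by rewrite big_ord0 invr1 subrr mulr0.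
rewrite big_ord_recr /=; apply: le_trans (lerD IH (lexx _)) _.
set x : R := n.+1%:R.
have x1 : 1 <= x by rewrite ler1n.
have x0 : 0 < x by apply: lt_le_trans x1.
have -> : (n.+2)%:R = x + 1 :> R by rewrite -natr1.
have p0 : 0 < 2 ^+ n :> R by rewrite exprn_gt0.
have t1 : x ^+ s / 2 ^+ n <= A / x ^+ 2.
  rewrite ler_pdivrMr// mulrAC ler_pdivlMr ?exprn_gt0// -exprD addn2.
  exact: key.
apply: le_trans (lerD (lexx _) t1) _.
have t2 : A / x ^+ 2 <= A * (2 / (x * (x + 1))).
  apply: ler_wpM2l => //; rewrite ler_pdivlMr ?mulr_gt0 ?addr_gt0//.
  by rewrite mulrC ler_pdivrMr ?exprn_gt0// expr2; nra.
apply: le_trans (lerD (lexx _) t2) _.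
rewrite le_eqVlt; apply/orP; left; apply/eqP; field.
by rewrite !gt_eqF// addr_gt0.
Qed.

End abel_summation.

Section polynomial_size.
Variables (R : realType) (d : nat).
Local Notation poly_size := (@poly_size R d).

Lemma poly_size_ge0 q : 0 <= poly_size q.
Proof. exact: sumr_ge0. Qed.

Let coef_XsubX (tau : R) j k : `|(('X - tau%:P) ^+ j : {poly R})`_k| <= (1 + `|tau|) ^+ j.
Proof.
elim: j k => [|j IH] k.
  by rewrite expr0 coef1; case: (k == 0%N); rewrite ?normr1 ?normr0.
rewrite exprSr mulrBr coefB coefMX coefMC exprSr mulrDr mulr1.
apply: le_trans (ler_normB _ _) _; apply: lerD; last by rewrite normrM; apply: ler_wpM2r.
by case: (k == 0%N) => //; rewrite normr0 exprn_ge0// addr_ge0.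
Qed.

(** Expand [q] in powers of X - tau; the coefficients of (X - tau)^j are at most (1 + |tau|)^j. *)
Lemma poly_size_shift (q : {poly R}) tau : (size q <= d.+1)%N ->
  poly_size q <= d%:R * (1 + `|tau|) ^+ d * poly_size (q \Po ('X + tau%:P)).
Proof.
move=> sq; set q1 := q \Po _.
have sq1 : (size q1 <= d.+1)%N by rewrite size_comp_poly2// size_XaddC.
have qE : q = q1 \Po ('X - tau%:P).
  by rewrite /q1 -comp_polyA comp_polyD comp_polyX comp_polyC subrK comp_polyXr.
have one : 1 <= 1 + `|tau| by rewrite lerDl.
have coefq k : (0 < k)%N -> `|q`_k| <= (1 + `|tau|) ^+ d * poly_size q1.
  move=> k0; rewrite qE comp_polyE coef_sum.
  rewrite (_ : \sum_(i < size q1) _ = \sum_(i < d.+1) (q1`_i *: ('X - tau%:P) ^+ i)`_k); last first.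
    rewrite (big_ord_widen _ (fun i => (q1`_i *: ('X - tau%:P) ^+ i)`_k) sq1) big_mkcond /=.
    apply: eq_bigr => i _; case: ltnP => // h.
    by rewrite coefZ (nth_default 0 h) mul0r.
  rewrite big_ord_recl expr0 coefZ coef1 (gtn_eqF k0) mulr0 add0r.
  apply: le_trans (ler_norm_sum _ _ _) _.
  rewrite /poly_size big_add1 /= big_mkord mulr_sumr; apply: ler_sum => i _.
  rewrite coefZ normrM mulrC; apply: ler_wpM2r => //.
  by apply: le_trans (coef_XsubX _ _ _) _; apply: ler_weXn2l.
apply: (@le_trans _ _ (\sum_(1 <= j < d.+1) ((1 + `|tau|) ^+ d * poly_size q1))).
  by rewrite {1}/poly_size !big_nat; apply: ler_sum => j /andP[j0 _]; exact: coefq.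
by rewrite sumr_const_nat subn1 /= -[X in X <= _]mulr_natl mulrA.
Qed.

Lemma poly_size_dist (q : {poly R}) s t : (size q <= d.+1)%N ->
  `|q.[s] - q.[t]| <= poly_size q * ((1 + `|s|) ^+ d + (1 + `|t|) ^+ d).
Proof.
move=> sq; rewrite !(horner_coef_wide _ sq) -sumrB big_ord_recl !expr0 subrr add0r.
apply: le_trans (ler_norm_sum _ _ _) _.
rewrite /poly_size big_add1 /= big_mkord mulr_suml; apply: ler_sum => i _.
rewrite -mulrBr normrM; apply: ler_wpM2l => //.
apply: le_trans (ler_normB _ _) _; rewrite !normrX.
have b (x : R) : `|x| ^+ i.+1 <= (1 + `|x|) ^+ d.
  apply: (@le_trans _ _ ((1 + `|x|) ^+ i.+1)).
    by apply: lerXn2r; rewrite ?nnegrE ?addr_ge0// lerDr.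
  by apply: ler_weXn2l; [rewrite lerDl|exact: (ltn_ord i)].
by apply: lerD; exact: b.
Qed.

End polynomial_size.

Lemma is_derive_affine (R : realType) (H : R -> R) (l c e x : R) :
  is_derive (c * x + e) 1 H l -> is_derive x 1 (fun y => H (c * y + e)) (c * l).
Proof.
move=> dH.
have dg : is_derive x 1 (fun y : R => c * y + e) c.
  have d1 : is_derive x 1 (c \*: (@id R)) (c *: 1) by exact: is_deriveZ.
  have := is_deriveD d1 (is_derive_cst e x 1).
  by rewrite addr0 /GRing.scale /= mulr1.
rewrite mulrC; exact: (@is_derive1_comp _ H (fun y : R => c * y + e) x l c).
Qed.

Section block_oscillation.
Variables (R : realType) (d : nat).
Hypothesis d0 : (0 < d)%N.

(** If [Phi] vanishes along [q] on the window, [H] is constant there. Otherwise one point [t] where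
    it does not vanish bounds the size of [q] from below; recentring at tau loses a factor of order
    (1 + |tau|)^(2 d), compensated by enlarging [th] by (1 + |tau|)^2. *)
Lemma block_oscillation (B : R) : 1 <= B -> exists2 C : R, 0 <= C &
  forall (phi Phi : R -> R) K (q : {poly R}) H (lo hi a b tau th s : R),
  antiderivative_pair phi Phi K -> (size q <= d.+1)%N -> 0 < th ->
  composite_primitive Phi q H lo hi ->
  1 <= th ^+ d * K * s ->
  (forall t, lo <= t <= hi -> Phi q.[t] != 0 -> s <= B * (1 + `|t|) ^+ d * poly_size d q) ->
  lo <= a -> a <= b -> b <= hi -> tau - 3 <= a -> b <= tau + 3 ->
  `|H b - H a| <= C * (1 + `|tau|) ^+ 2 * (K * th).
Proof.
move=> B1; have [C C0 hC] := window_estimate R d0.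
pose B' := B * 4 ^+ d * d%:R.
have dR : 1 <= d%:R :> R by rewrite ler1n.
have B'1 : 1 <= B'.
  rewrite /B' -[leLHS]mulr1; apply: ler_pM => //.
  by rewrite -[leLHS]mulr1; apply: ler_pM => //; apply: exprn_ege1; lra.
have B'0 : 0 < B' := lt_le_trans ltr01 B'1.
exists (C * B'); first by rewrite mulr_ge0// ltW.
move=> phi Phi K q H lo hi a b tau th s hphi sq th0 dH thK hs loa ab bhi ta tb.
have K0 : 0 <= K := le_trans (normr_ge0 _) (Phi_bound hphi 0).
have z0 : 0 <= C * B' * (1 + `|tau|) ^+ 2 * (K * th).
  apply: mulr_ge0; last by apply: mulr_ge0 => //; exact: ltW.
  by apply: mulr_ge0; [apply: mulr_ge0 => //; exact: ltW|exact: sqr_ge0].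
have [[t [tab Pt]]|nt] := pselect (exists t, a <= t <= b /\ Phi q.[t] != 0); last first.
  apply: le_trans z0; rewrite -(mul0r (b - a)).
  apply: (@is_derive_bound _ _ (fun x => Phi q.[x])) => // x /andP[ax xb].
    by apply: dH; rewrite (le_trans loa)//= (le_trans _ bhi).
  have [->|Px] := eqVneq (Phi q.[x]) 0; first by rewrite normr0.
  by exfalso; apply: nt; exists x; rewrite ax xb.
move/andP: tab => [at' tb'].
have lot : lo <= t <= hi by rewrite (le_trans loa)//= (le_trans _ bhi).
have st := hs t lot Pt.
pose T := 1 + `|tau|.
have T1 : 1 <= T by rewrite lerDl.
have tT : 1 + `|t| <= 4 * T.
  have := ler_normD tau (t - tau); rewrite addrC subrK.
  have : `|t - tau| <= 3 by rewrite ler_norml; apply/andP; split; lra.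
  by rewrite /T; have := normr_ge0 tau; lra.
pose q1 := q \Po ('X + tau%:P).
have sN : s <= B' * T ^+ 2 ^+ d * poly_size d q1.
  apply: le_trans st _.
  have h1 : (1 + `|t|) ^+ d <= (4 * T) ^+ d by apply: lerXn2r; rewrite ?nnegrE ?addr_ge0// mulr_ge0// (le_trans ler01).
  have h2 := poly_size_shift tau sq; rewrite -/T -/q1 in h2.
  have B0 : 0 <= B := le_trans ler01 B1.
  have N0 : 0 <= poly_size d q := poly_size_ge0 d q.
  apply: (@le_trans _ _ (B * (4 * T) ^+ d * poly_size d q)).
    by apply: ler_wpM2r => //; exact: ler_wpM2l.
  apply: (@le_trans _ _ (B * (4 * T) ^+ d * (d%:R * T ^+ d * poly_size d q1))).
    by apply: ler_wpM2l => //; rewrite mulr_ge0// exprn_ge0// mulr_ge0// (le_trans ler01).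
  have T2 : T ^+ 2 ^+ d = T ^+ d * T ^+ d by rewrite expr2 exprMn.
  by rewrite le_eqVlt; apply/orP; left; apply/eqP; rewrite /B' T2 exprMn; ring.
pose th' := B' * T ^+ 2 * th.
have T20 : 0 < T ^+ 2 by rewrite exprn_gt0// (lt_le_trans ltr01).
have th'0 : 0 < th' by apply: mulr_gt0 => //; exact: mulr_gt0.
have thK' : 1 <= th' ^+ d * K * poly_size d q1.
  apply: le_trans thK _.
  have h0 : 0 <= th ^+ d * K by rewrite mulr_ge0// exprn_ge0// ltW.
  apply: le_trans (ler_wpM2l h0 sN) _.
  rewrite (_ : th' ^+ d * K * _ = th ^+ d * K * (B' ^+ d * T ^+ 2 ^+ d * poly_size d q1)); last first.
    by rewrite /th' !exprMn; ring.
  apply: ler_wpM2l => //; apply: ler_wpM2r; first exact: poly_size_ge0.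
  apply: ler_wpM2r; first by rewrite exprn_ge0// ltW.
  by rewrite -[X in X <= _]expr1; apply: ler_weXn2l.
have sq1 : (size q1 <= d.+1)%N by rewrite size_comp_poly2// size_XaddC.
pose H1 := fun x => H (x + tau).
have dH1 : composite_primitive Phi q1 H1 (a - tau) (b - tau).
  move=> x /andP[x1 x2].
  have dx : is_derive (x + tau) 1 H (Phi q.[x + tau]).
    by apply: dH; apply/andP; split; lra.
  rewrite /q1 horner_comp hornerD hornerX hornerC.
  have := @is_derive_affine _ H (Phi q.[x + tau]) 1 tau x.
  rewrite !mul1r => /(_ dx); rewrite /H1.
  by under [X in is_derive _ _ X _]eq_fun do rewrite mul1r.
have := hC phi Phi K q1 H1 (a - tau) (b - tau) th' hphi sq1.
rewrite /H1 !subrK => h.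
apply: le_trans (h _ _ _ th'0 thK' dH1) _; [lra|lra|lra|].
by rewrite le_eqVlt; apply/orP; left; apply/eqP; rewrite /th' -/T; ring.
Qed.

End block_oscillation.

Section discrete_estimate.
Variables (R : realType) (d : nat).
Hypothesis d0 : (0 < d)%N.

(** The lower bound 2 makes the weights halve from block to block; the upper bound 3 fits a block
    into a window of the polynomial estimate. *)
Lemma exists_block_length (eta : R) : 0 < eta -> eta <= 1 ->
  exists r : nat, 2 <= r%:R * eta /\ r%:R * eta <= 3.
Proof.
move=> e0 e1; exists (Num.truncn (2 / eta)).+1.
have h0 : 0 <= 2 / eta by rewrite divr_ge0// ltW.
have /andP[h1 h2] := truncn_itv h0.
split; first by rewrite -ler_pdivrMr// ltW.
move: h1; rewrite ler_pdivlMr// -natr1 mulrDl mul1r; lra.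
Qed.

Section halves.
Variables (p : nat -> R) (N j0 : nat).
Hypotheses (lc : log_concave_seq p) (pN : forall j, (N <= j)%N -> p j = 0).
Hypotheses (psum : \sum_(j < N) p j = 1) (j0N : (j0 < N)%N) (pmax : forall j, p j <= p j0).

Definition right_half i := p (j0 + i)%N.
(** The explicit cut is needed because natural subtraction would repeat [p 0]. Both halves start at
    the peak; [sum_halves] counts the peak on the right only. *)
Definition left_half i := if (i <= j0)%N then p (j0 - i)%N else 0.

Lemma right_half_log_concave : log_concave_seq right_half.
Proof.
split=> [j|a b c h|a b c h]; first exact: (lcs_ge0 lc).
  by apply: (lcs_even lc); lia.
by rewrite /right_half addnS; apply: (lcs_odd lc); lia.
Qed.

Lemma left_half_log_concave : log_concave_seq left_half.
Proof.
have p0 j : 0 <= left_half j by rewrite /left_half; case: ifP => // _; exact: (lcs_ge0 lc).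
split=> // a b c h; rewrite {1 2}/left_half.
  case: ifP => aj; last by rewrite mul0r sqr_ge0.
  case: ifP => bj; last by rewrite mulr0 sqr_ge0.
  rewrite /left_half ifT; last by lia.
  by apply: (lcs_even lc); lia.
case: ifP => aj; last by rewrite mul0r sqr_ge0.
case: ifP => bj; last by rewrite mulr0 sqr_ge0.
rewrite /left_half !ifT; [|lia..].
rewrite addrC (_ : j0 - c = (j0 - c.+1).+1)%N; last by lia.
by apply: (lcs_odd lc); lia.
Qed.

Lemma peak_gt0 : 0 < p j0.
Proof.
rewrite lt_def (lcs_ge0 lc) andbT; apply/eqP => z.
suff : \sum_(j < N) p j = 0 by rewrite psum => /eqP; rewrite oner_eq0.
by apply: big1 => j _; apply/eqP; rewrite eq_le (lcs_ge0 lc) andbT -z.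
Qed.

Lemma sum_halves (f : nat -> R) :
  \sum_(j < N) p j * f j =
  \sum_(0 <= i < j0) left_half i.+1 * f (j0 - i.+1)%N + \sum_(0 <= i < N - j0) right_half i * f (j0 + i)%N.
Proof.
rewrite -(big_mkord xpredT (fun j => p j * f j)) (@big_cat_nat _ _ _ j0)//=; last exact: ltnW.
congr (_ + _).
  rewrite big_nat_rev /= !big_nat; apply: eq_bigr => i /andP[_ ij].
  by rewrite add0n /left_half ij.
by rewrite -{1}[j0]add0n big_addn; apply: eq_bigr => i _; rewrite /right_half addnC.
Qed.

Lemma sum_right_half n : \sum_(i < n) right_half i <= 1.
Proof.
have h : \sum_(i < n) right_half i <= \sum_(0 <= i < N - j0) right_half i.
  have [nN|nN] := leqP n (N - j0)%N.
    rewrite -(big_mkord xpredT) (@big_cat_nat _ _ _ n 0 (N - j0))//= lerDl.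
    by apply: sumr_ge0 => i _; exact: (lcs_ge0 lc).
  rewrite -(big_mkord xpredT) (@big_cat_nat _ _ _ (N - j0) 0 n)//=; last exact: ltnW.
  rewrite [X in _ + X <= _](_ : _ = 0) ?addr0// big_nat; apply: big1 => i /andP[i1 _].
  by apply: pN; lia.
apply: le_trans h _; rewrite -psum.
have := sum_halves (fun=> 1); under eq_bigr do rewrite mulr1; move=> ->.
under [X in _ <= _ + X]eq_bigr do rewrite mulr1.
rewrite lerDr; apply: sumr_ge0 => i _; rewrite mulr1; exact: (lcs_ge0 left_half_log_concave).
Qed.

Lemma sum_left_half n : \sum_(i < n) left_half i <= 1.
Proof.
have h : \sum_(i < n) left_half i <= \sum_(0 <= i < j0.+1) left_half i.
  have [nN|nN] := leqP n j0.+1.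
    rewrite -(big_mkord xpredT) (@big_cat_nat _ _ _ n 0 j0.+1)//= lerDl.
    by apply: sumr_ge0 => i _; exact: (lcs_ge0 left_half_log_concave).
  rewrite -(big_mkord xpredT) (@big_cat_nat _ _ _ j0.+1 0 n)//=; last exact: ltnW.
  rewrite [X in _ + X <= _](_ : _ = 0) ?addr0// big_nat; apply: big1 => i /andP[i1 _].
  by rewrite /left_half leqNgt i1.
apply: le_trans h _; rewrite -psum.
have := sum_halves (fun=> 1); under eq_bigr do rewrite mulr1; move=> ->.
rewrite big_nat_recl//= addrC; apply: lerD.
  by under [X in X <= _]eq_bigr do rewrite -[left_half _]mulr1.
rewrite big_ltn ?subn_gt0// /left_half /right_half subn0 addn0 mulr1 lerDl.
by apply: sumr_ge0 => i _; rewrite mulr1; exact: (lcs_ge0 lc).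
Qed.

Lemma right_half0 i : (N - j0 <= i)%N -> right_half i = 0.
Proof. by move=> h; apply: pN; lia. Qed.

Lemma left_half0 i : (j0 <= i)%N -> left_half i.+1 = 0.
Proof. by move=> h; rewrite /left_half ltnNge h. Qed.

Lemma left_half_max i : left_half i <= left_half 0.
Proof.
by rewrite {2}/left_half subn0 /=; rewrite /left_half; case: ifP => _ //; exact: ltW peak_gt0.
Qed.

End halves.

Let widen_sum (F : nat -> R) n r : (0 < r)%N -> (forall j, (n <= j)%N -> F j = 0) ->
  \sum_(0 <= j < n) F j = \sum_(0 <= j < n * r) F j.
Proof.
move=> r0 F0; rewrite (@big_cat_nat _ _ _ n 0 (n * r))//=; last by rewrite leq_pmulr.
rewrite [X in _ + X](_ : _ = 0) ?addr0// big_nat; apply: big1 => j /andP[nj _].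
exact: F0.
Qed.

(** The cost of block i grows like (1 + 3 i)^2 <= 9 (i+1)^2, against weights that decay like
    2^(-i). *)
Lemma half_increments (D0 : R) : 0 <= D0 -> exists2 C : R, 0 <= C &
  forall (v h : nat -> R) r (X eta : R) n, (forall j, 0 <= v j) -> (forall j, v j.+1 <= v j) ->
  (forall j, (n <= j)%N -> v j = 0) -> (0 < r)%N -> 0 <= eta -> 0 <= X ->
  (forall i, v (i * r)%N <= eta / 2 ^+ i) ->
  (forall i b, (i * r <= b <= i * r + r)%N ->
    `|h b - h (i * r)%N| <= D0 * (1 + 3 * i%:R) ^+ 2 * X) ->
  `|\sum_(0 <= j < n) v j * (h j.+1 - h j)| <= eta * (C * X).
Proof.
move=> D00; have [G G0 hG] := geometric_moment R 2.
exists (D0 * 9 * G); first by rewrite !mulr_ge0.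
move=> v h r X eta n v0 vd vn r0 e0 X0 vr hD.
rewrite (@widen_sum (fun j => v j * (h j.+1 - h j)) n r r0); last by move=> j /vn ->; rewrite mul0r.
apply: le_trans (@block_sum _ v h (fun i => D0 * (1 + 3 * i%:R) ^+ 2 * X) eta r n v0 vd vr hD) _.
apply: ler_wpM2l => //.
apply: (@le_trans _ _ (D0 * 9 * X * \sum_(i < n) (i.+1)%:R ^+ 2 / 2 ^+ i)).
  rewrite mulr_sumr; apply: ler_sum => i _.
  rewrite (_ : D0 * 9 * X * _ = D0 * (9 * (i.+1)%:R ^+ 2) * X / 2 ^+ i); last by ring.
  apply: ler_wpM2r; first by rewrite invr_ge0 exprn_ge0.
  apply: ler_wpM2r => //; apply: ler_wpM2l => //.
  rewrite -[i.+1%:R]natr1 (_ : 9 * (i%:R + 1) ^+ 2 = (1 + 3 * i%:R) ^+ 2 + (12 * i%:R + 8)); last by ring.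
  by rewrite lerDl addr_ge0// mulr_ge0.
rewrite (_ : D0 * 9 * G * X = D0 * 9 * X * G); last by ring.
by apply: ler_wpM2l => //; rewrite !mulr_ge0.
Qed.

(** On block i the scaled distance to the peak is at most 3 (i+1), so these moments are bounded in
    terms of [d] alone. The shift [j.+1] is the exact distance on the left half, where the peak is
    left out, and an upper bound on the right half. *)
Lemma half_moment : exists2 C : R, 0 <= C &
  forall (v : nat -> R) r (eta : R) n, (forall j, 0 <= v j) -> (forall j, v j.+1 <= v j) ->
  (forall j, (n <= j)%N -> v j = 0) -> (0 < r)%N -> 0 <= eta -> r%:R * eta <= 3 ->
  (forall i, v (i * r)%N <= eta / 2 ^+ i) ->
  \sum_(0 <= j < n) v j * (1 + j.+1%:R * eta) ^+ (2 * d) <= C.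
Proof.
have [G G0 hG] := geometric_moment R (2 * d).
exists (3 * 4 ^+ (2 * d) * G); first by rewrite !mulr_ge0// exprn_ge0.
move=> v r eta n v0 vd vn r0 e0 re vr.
rewrite (@widen_sum (fun j => v j * _) n r r0); last by move=> j /vn ->; rewrite mul0r.
apply: le_trans (@block_moment _ v (fun j => (1 + j.+1%:R * eta) ^+ (2 * d))
  (fun i => (4 * i.+1%:R) ^+ (2 * d)) eta r n v0 vd vr _ _) _.
- by move=> i; rewrite exprn_ge0// mulr_ge0.
- move=> i b /andP[_ bi]; apply: lerXn2r; rewrite ?nnegrE ?addr_ge0 ?mulr_ge0//.
  have b1 : b.+1%:R <= i.+1%:R * r%:R :> R by rewrite -natrM ler_nat; lia.
  have b2 := ler_wpM2r e0 b1.
  have b3 := ler_wpM2l (ler0n R i.+1) re.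
  have : 1 <= i.+1%:R :> R by rewrite ler1n.
  by move: b2 b3; rewrite -mulrA; lra.
apply: (@le_trans _ _ (3 * \sum_(i < n) (4 * i.+1%:R) ^+ (2 * d) / 2 ^+ i)).
  apply: ler_wpM2r => //; apply: sumr_ge0 => i _.
  by rewrite divr_ge0 ?exprn_ge0// mulr_ge0.
rewrite -mulrA; apply: ler_wpM2l => //.
under eq_bigr do rewrite exprMn -mulrA.
by rewrite -mulr_sumr; apply: ler_wpM2l => //; rewrite exprn_ge0.
Qed.

Let nat1 a b r j0 : (a <= b <= a + r)%N ->
  [/\ (j0 - b <= j0 - a)%N, (j0 - a <= j0)%N, (j0 - a <= j0 - b + r)%N & (j0 <= j0 - a + a)%N].
Proof. by split; lia. Qed.

Let nat2 a b r j0 N : (a <= b <= a + r)%N -> (j0 < N)%N ->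
  let x := minn (j0 + a) N in let y := minn (j0 + b) N in
  [/\ (x <= y)%N, (y <= N)%N, (y <= x + r)%N, (x <= j0 + a)%N & (j0 <= x)%N].
Proof. by move=> h1 h2 x y; split; rewrite /x /y; lia. Qed.

Let nat3 i j0 N : (i < N - j0)%N -> (j0 + i <= N)%N /\ (j0 + i.+1 <= N)%N.
Proof. by split; lia. Qed.

(** The coordinate [t] puts the peak at 0 and makes the spacing equal to the peak value, so the law
    has unit scale. Each half is cut into blocks of length at most 3, on which [block_oscillation]
    applies. *)
Lemma discrete_estimate_normalized : exists2 C : R, 0 <= C &
  forall (phi Phi : R -> R) K (q : {poly R}) (p : nat -> R) N j0 H (s th : R),
  let t j := (j%:R - j0%:R) * p j0 in
  antiderivative_pair phi Phi K -> (size q <= d.+1)%N -> 0 < th -> 0 <= s ->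
  1 <= th ^+ d * K * s ->
  log_concave_seq p -> (forall j, (N <= j)%N -> p j = 0) -> \sum_(j < N) p j = 1 ->
  (j0 < N)%N -> (forall j, p j <= p j0) ->
  composite_primitive Phi q H (t 0%N) (t N) ->
  (forall x, t 0%N <= x <= t N -> Phi q.[x] != 0 ->
     s ^+ 2 <= 100 * \sum_(j < N) p j * (q.[t j] - q.[x]) ^+ 2) ->
  `|\sum_(j < N) p j * (H (t j.+1) - H (t j))| <= p j0 * (C * (K * th)).
Proof.
have [M M0 hM] := half_moment.
(* 100 times the constant 4 (M + 1) of the moment bound; being at least 1, it also dominates its own
   square root. *)
pose B := 400 * (M + 1).
have B1 : 1 <= B by rewrite /B; lra.
have [C C0 hC] := block_oscillation d0 B1.
have [G G0 hG] := half_increments C0.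
exists (2 * G); first by rewrite mulr_ge0.
move=> phi Phi K q p N j0 H s th t hphi sq th0 s0 thK lc pN psum j0N pmax dH hS.
have K0 : 0 <= K := le_trans (normr_ge0 _) (Phi_bound hphi 0).
set eta := p j0 in t hphi dH hS *.
have eta0 : 0 < eta := peak_gt0 lc psum pmax.
have Kth0 : 0 <= K * th by rewrite mulr_ge0// ltW.
have lcR : log_concave_seq (right_half p j0) by exact: right_half_log_concave.
have lcL : log_concave_seq (left_half p j0) by exact: left_half_log_concave.
have vR0 : right_half p j0 0 = eta by rewrite /right_half addn0.
have vL0 : left_half p j0 0 = eta by rewrite /left_half subn0.
have sR := sum_right_half lc pN psum j0N; have sL := sum_left_half lc psum j0N.
have eta1 : eta <= 1 by have := sR 1%N; rewrite big_ord1 vR0.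
have [r [r2 r3]] := exists_block_length eta0 eta1.
have mR i : right_half p j0 i <= right_half p j0 0 by rewrite vR0; exact: pmax.
have mL i : left_half p j0 i <= left_half p j0 0 := left_half_max lc psum pmax i.
have e0R : 0 < right_half p j0 0 by rewrite vR0.
have e0L : 0 < left_half p j0 0 by rewrite vL0.
have dR := log_concave_seq_nonincreasing lcR mR e0R.
have dL := log_concave_seq_nonincreasing lcL mL e0L.
have r2R : 2 <= r%:R * right_half p j0 0 by rewrite vR0.
have r2L : 2 <= r%:R * left_half p j0 0 by rewrite vL0.
have decR := log_concave_seq_decay lcR mR e0R sR r2R; rewrite vR0 in decR.
have decL := log_concave_seq_decay lcL mL e0L sL r2L; rewrite vL0 in decL.
have r0 : (0 < r)%N by case: (r) r2 => //; rewrite mul0r => h; exfalso; lra.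
have tS j : t j.+1 = t j + eta by rewrite /t -natr1; ring.
have tmono i j : (i <= j)%N -> t i <= t j.
  by move=> ij; apply: ler_wpM2r; [exact: ltW|rewrite lerD2r ler_nat].
have tdist i j n : (j <= i + n)%N -> t j - t i <= n%:R * eta.
  move=> ij; rewrite /t -mulrBl; apply: ler_wpM2r; first exact: ltW.
  rewrite opprB addrA subrK lerBlDr -natrD ler_nat addnC//.
have tj0 : t j0 = 0 by rewrite /t subrr mul0r.
(* The spread of [q] seen from [x] is at most its size times polynomial weights that the decay makes
   summable; the spread hypothesis thus becomes a lower bound on the size. *)
have moment (x : R) : \sum_(j < N) p j * (q.[t j] - q.[x]) ^+ 2 <=
    poly_size d q ^+ 2 * (4 * (M + 1)) * ((1 + `|x|) ^+ d) ^+ 2.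
  set P := poly_size d q; set Tx := (1 + `|x|) ^+ d.
  have Tx1 : 1 <= Tx by apply: exprn_ege1; rewrite lerDl.
  apply: (@le_trans _ _ (\sum_(j < N) (2 * P ^+ 2 * (p j * (1 + `|t j|) ^+ (2 * d)) + 2 * P ^+ 2 * Tx ^+ 2 * p j))).
    apply: ler_sum => j _.
    have dj := poly_size_dist (t j) x sq; rewrite -/P -/Tx in dj.
    set Tj := (1 + `|t j|) ^+ d in dj.
    have -> : (1 + `|t j|) ^+ (2 * d) = Tj ^+ 2 by rewrite mulnC exprM.
    have h1 : (q.[t j] - q.[x]) ^+ 2 <= (P * (Tj + Tx)) ^+ 2.
      rewrite -[X in X <= _]real_normK ?num_real//; apply: lerXn2r; rewrite ?nnegrE//.
      exact: le_trans dj.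
    apply: le_trans (ler_wpM2l (lcs_ge0 lc j) h1) _.
    rewrite (_ : 2 * P ^+ 2 * (p j * Tj ^+ 2) + _ = p j * (P ^+ 2 * (2 * Tj ^+ 2 + 2 * Tx ^+ 2))); last by ring.
    apply: ler_wpM2l; first exact: (lcs_ge0 lc).
    rewrite exprMn; apply: ler_wpM2l; first exact: sqr_ge0.
    rewrite -subr_ge0 (_ : _ - _ = (Tj - Tx) ^+ 2); [exact: sqr_ge0|ring].
  rewrite big_split /= -!mulr_sumr psum mulr1.
  have mom : \sum_(j < N) p j * (1 + `|t j|) ^+ (2 * d) <= 2 * M.
    rewrite (sum_halves p j0N (fun j => (1 + `|t j|) ^+ (2 * d))).
    have -> : 2 * M = M + M by ring.
    have tR i : t (j0 + i)%N = i%:R * eta by rewrite /t natrD addrAC subrr add0r.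
    have tL i : (i < j0)%N -> t (j0 - i.+1)%N = - (i.+1%:R * eta).
      by move=> ij; rewrite /t natrB// addrAC subrr add0r mulNr.
    apply: lerD.
      apply: le_trans (hM (fun i => left_half p j0 i.+1) r eta j0 _ _ _ r0 (ltW eta0) r3 _).
      - rewrite !big_nat; apply: ler_sum => i /andP[_ ij].
        rewrite tL// normrN ger0_norm// mulr_ge0// ltW//.
      - by move=> j; exact: (lcs_ge0 lcL).
      - by move=> j; exact: dL.
      - exact: left_half0.
      - by move=> i; exact: le_trans (dL _) (decL _).
    apply: le_trans (hM (right_half p j0) r eta (N - j0)%N (lcs_ge0 lcR) dR _ r0 (ltW eta0) r3 decR).
      apply: ler_sum => i _; apply: ler_wpM2l; first exact: (lcs_ge0 lcR).
      apply: lerXn2r; rewrite ?nnegrE ?addr_ge0 ?mulr_ge0 ?(ltW eta0)//.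
      rewrite tR ger0_norm ?mulr_ge0 ?(ltW eta0)// lerD2l.
      by apply: ler_wpM2r; [exact: ltW|rewrite ler_nat].
    exact: right_half0.
  have P0 : 0 <= 2 * P ^+ 2 by apply: mulr_ge0 => //; exact: sqr_ge0.
  apply: le_trans (lerD (ler_wpM2l P0 mom) (lexx _)) _.
  have Tx2 : 1 <= Tx ^+ 2 by exact: exprn_ege1.
  rewrite (_ : P ^+ 2 * (4 * (M + 1)) * Tx ^+ 2 =
    2 * P ^+ 2 * (2 * M) * Tx ^+ 2 + (2 * P ^+ 2 * Tx ^+ 2 + 2 * P ^+ 2 * Tx ^+ 2)); last by ring.
  apply: lerD; first by rewrite ler_peMr//; apply: mulr_ge0 => //; exact: mulr_ge0.
  by rewrite lerDl; apply: mulr_ge0 => //; exact: sqr_ge0.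
have hB x : t 0%N <= x <= t N -> Phi q.[x] != 0 -> s <= B * (1 + `|x|) ^+ d * poly_size d q.
  move=> xt Px.
  have P0 := poly_size_ge0 d q.
  have B0 : 0 <= B := le_trans ler01 B1.
  have T0 : 0 <= (1 + `|x|) ^+ d by rewrite exprn_ge0// addr_ge0.
  have sn : s \in Num.nneg by rewrite nnegrE.
  have Rn : B * (1 + `|x|) ^+ d * poly_size d q \in Num.nneg.
    by rewrite nnegrE; apply: mulr_ge0 => //; exact: mulr_ge0.
  rewrite -(ler_sqr sn Rn).
  apply: le_trans (hS x xt Px) _.
  apply: le_trans (ler_wpM2l (ler0n R 100) (moment x)) _.
  rewrite (_ : 100 * _ = B * (((1 + `|x|) ^+ d) ^+ 2 * poly_size d q ^+ 2)); last by rewrite /B; ring.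
  rewrite -mulrA exprMn [_ ^+ 2 in X in _ <= _ * X]exprMn; apply: ler_wpM2r.
    by apply: mulr_ge0 => //; exact: sqr_ge0.
  by rewrite expr2 ler_peMl.
have osc i b tau : (i <= b)%N -> (b <= N)%N -> t b - t i <= 3 -> t i <= tau <= t b ->
    `|H (t b) - H (t i)| <= C * (1 + `|tau|) ^+ 2 * (K * th).
  move=> ib bN d3 /andP[h1 h2].
  have a1 := tmono 0%N i (leq0n i); have a2 := tmono i b ib; have a3 := tmono b N bN.
  have a4 : tau - 3 <= t i by rewrite lerBlDl -lerBlDr; apply: le_trans d3; exact: lerB.
  have a5 : t b <= tau + 3 by rewrite -lerBlDl; apply: le_trans d3; exact: lerB.
  exact: (hC phi Phi K q H (t 0%N) (t N) (t i) (t b) tau th s).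
have r3' n : (n <= r)%N -> n%:R * eta <= 3.
  by move=> nr; apply: le_trans r3; apply: ler_wpM2r; [exact: ltW|rewrite ler_nat].
have bnd x i : `|x| <= 3 * i%:R -> C * (1 + `|x|) ^+ 2 * (K * th) <= C * (1 + 3 * i%:R) ^+ 2 * (K * th).
  move=> xi; apply: ler_wpM2r => //; apply: ler_wpM2l => //.
  by apply: lerXn2r; rewrite ?nnegrE ?addr_ge0 ?mulr_ge0// lerD2l.
have ir (i : nat) : (i * r)%N%:R * eta <= 3 * i%:R.
  by rewrite natrM -mulrA mulrC; apply: ler_wpM2r.
rewrite (sum_halves p j0N (fun j => H (t j.+1) - H (t j))).
apply: le_trans (ler_normD _ _) _.
rewrite (_ : eta * (2 * G * (K * th)) = eta * (G * (K * th)) + eta * (G * (K * th))); last by ring.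
apply: lerD.
  (* The index runs backwards on the left half, so increments change sign; natural subtraction keeps
     it inside the domain of [H]. *)
  pose h i := H (t (j0 - i)%N).
  have -> : \sum_(0 <= i < j0) left_half p j0 i.+1 * (H (t (j0 - i.+1).+1) - H (t (j0 - i.+1)%N)) =
      - \sum_(0 <= i < j0) left_half p j0 i.+1 * (h i.+1 - h i).
    rewrite -sumrN !big_nat; apply: eq_bigr => i /andP[_ ij].
    by rewrite -mulrN opprB /h subnSK.
  rewrite normrN.
  apply: (hG (fun i => left_half p j0 i.+1) h r (K * th) eta j0) => //.
  - by move=> j; exact: (lcs_ge0 lcL).
  - exact: left_half0.
  - exact: ltW.
  - by move=> i; exact: le_trans (dL _) (decL _).
  move=> i b /(nat1 j0)[n1 n2 n3 n4]; rewrite /h distrC.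
  have h1 : t (j0 - i * r)%N - t (j0 - b)%N <= 3 := le_trans (tdist _ _ r n3) r3.
  apply: le_trans (osc (j0 - b)%N (j0 - i * r)%N (t (j0 - i * r)%N) n1 (leq_trans n2 (ltnW j0N)) h1 _) _.
    by rewrite lexx andbT tmono.
  apply: bnd.
  have h2 : t j0 - t (j0 - i * r)%N <= 3 * i%:R := le_trans (tdist _ _ (i * r)%N n4) (ir i).
  have h3 : t (j0 - i * r)%N <= t j0 by exact: tmono.
  rewrite tj0 in h2 h3.
  by rewrite ler0_norm// -[X in X <= _]add0r.
(* Capping at [N] keeps the last block inside the interval on which [H] is a primitive. *)
pose h i := H (t (minn (j0 + i) N)).
have -> : \sum_(0 <= i < N - j0) right_half p j0 i * (H (t (j0 + i).+1) - H (t (j0 + i)%N)) =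
    \sum_(0 <= i < N - j0) right_half p j0 i * (h i.+1 - h i).
  rewrite !big_nat; apply: eq_bigr => i /andP[_ ij].
  by have [n1 n2] := nat3 ij; rewrite /h (minn_idPl n1) (minn_idPl n2) addnS.
apply: (hG (right_half p j0) h r (K * th) eta (N - j0)%N) => //.
- exact: (lcs_ge0 lcR).
- exact: right_half0.
- exact: ltW.
move=> i b ib; have [xy yN yx xi jx] := nat2 ib j0N; rewrite /h.
move: xy yN yx xi jx; set x := minn (j0 + i * r) N; set y := minn (j0 + b) N => xy yN yx xi jx.
have h1 : t y - t x <= 3 := le_trans (tdist _ _ r yx) r3.
apply: le_trans (osc x y (t x) xy yN h1 _) _; first by rewrite lexx tmono.
apply: bnd.
have h2 : t x - t j0 <= 3 * i%:R := le_trans (tdist _ _ (i * r)%N xi) (ir i).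
have h3 : t j0 <= t x by exact: tmono.
rewrite tj0 in h2 h3.
by rewrite ger0_norm// -[X in X <= _]subr0.
Qed.

Lemma discrete_estimate : exists2 C : R, 0 <= C &
  forall (phi Phi : R -> R) K (q : {poly R}) (p : nat -> R) N H (x0 step s th : R),
  let x j := x0 + j%:R * step in
  antiderivative_pair phi Phi K -> (size q <= d.+1)%N -> 0 < th -> 0 <= s -> 0 < step ->
  1 <= th ^+ d * K * s ->
  log_concave_seq p -> (forall j, (N <= j)%N -> p j = 0) -> \sum_(j < N) p j = 1 ->
  composite_primitive Phi q H (x 0%N) (x N) ->
  (forall y, x 0%N <= y <= x N -> Phi q.[y] != 0 ->
     s ^+ 2 <= 100 * \sum_(j < N) p j * (q.[x j] - q.[y]) ^+ 2) ->
  `|\sum_(j < N) p j * (H (x j.+1) - H (x j))| <= step * (C * (K * th)).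
Proof.
have [C C0 hC] := discrete_estimate_normalized.
exists C => // phi Phi K q p N H x0 step s th x hphi sq th0 s0 st0 thK lc pN psum dH hS.
have N0 : (0 < N)%N by case: (N) psum => //; rewrite big_ord0 => /eqP; rewrite eq_sym oner_eq0.
have [j0 j0N pmax] : exists2 j0, (j0 < N)%N & forall j, p j <= p j0.
  have [k _ hk] := @Order.TotalTheory.arg_maxP _ R 'I_N (Ordinal N0) predT (fun i => p i) isT.
  exists k => // j; have [jN|jN] := ltnP j N; first exact: (hk (Ordinal jN)).
  by rewrite pN//; exact: (lcs_ge0 lc).
have eta0 : 0 < p j0 := peak_gt0 lc psum pmax.
pose c := step / p j0.
have c0 : 0 < c by rewrite divr_gt0.
pose e := x j0.
pose t j := (j%:R - j0%:R) * p j0.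
have xt j : c * t j + e = x j.
  by rewrite /c /t /e /x; field; rewrite gt_eqF.
pose q1 := q \Po (c *: 'X + e%:P).
have q1E y : q1.[y] = q.[c * y + e].
  by rewrite /q1 horner_comp hornerD hornerZ hornerX hornerC.
have sq1 : (size q1 <= d.+1)%N.
  rewrite size_comp_poly2// size_polyDl size_scale ?gt_eqF// ?size_polyX//.
  by rewrite (leq_ltn_trans (size_polyC_leq1 _)).
pose H1 := c^-1 \*: (fun y => H (c * y + e)).
have dH1 : composite_primitive Phi q1 H1 (t 0%N) (t N).
  move=> y /andP[y1 y2].
  have h : is_derive (c * y + e) 1 H (Phi q.[c * y + e]).
    by apply: dH; rewrite -!xt !lerD2r !ler_pM2l// y1.
  have h2 := is_derive_affine h.
  have := @is_deriveZ _ _ _ _ c^-1 _ _ _ h2.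
  by rewrite q1E /GRing.scale /= mulKf// gt_eqF.
have := hC phi Phi K q1 p N j0 H1 s th hphi sq1 th0 s0 thK lc pN psum j0N pmax dH1.
have -> : \sum_(j < N) p j * (H1 (t j.+1) - H1 (t j)) =
    c^-1 * \sum_(j < N) p j * (H (x j.+1) - H (x j)).
  rewrite mulr_sumr; apply: eq_bigr => j _.
  have H1E y : H1 y = c^-1 * H (c * y + e) by [].
  by rewrite !H1E !xt; ring.
move=> h; have {}h : `|c^-1 * \sum_(j < N) p j * (H (x j.+1) - H (x j))| <= p j0 * (C * (K * th)).
  apply: h => y /andP[y1 y2]; rewrite q1E => Py.
  rewrite (_ : \sum_(j < N) _ = \sum_(j < N) p j * (q.[x j] - q.[c * y + e]) ^+ 2).
    by apply: hS => //; rewrite -!xt !lerD2r !ler_pM2l// y1.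
  by apply: eq_bigr => j _; rewrite !q1E xt.
move: h; rewrite normrM gtr0_norm ?invr_gt0// mulrC ler_pdivrMr//.
move=> /le_trans; apply; rewrite le_eqVlt; apply/orP; left; apply/eqP; rewrite /c; field.
by rewrite gt_eqF.
Qed.

End discrete_estimate.

(** * Needles as discrete log-concave laws *)

Section near_line.
Context d (T : measurableType d) (R : realType) (m : probability T R) (Q0 Q : set T).
Local Notation J Q g := (\int[m]_(x in Q) g x)%R.
Variables (k : nat) (c : 'I_k.+1 -> T -> R) (eps : R).
Hypotheses (mQ : measurable Q) (QQ0 : Q `<=` Q0) (e0 : 0 <= eps).
Hypothesis bc : forall i, bounded_measurable Q0 (c i).
Hypothesis degenerate : forall i j, i != j -> exists2 s, -1 <= s <= 1 &
  J Q (fun x => pencil (c i) (c j) s x ^+ 2) <= eps.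

(** The coordinate of largest second moment serves as parameter; each other one is compared with it
    through their degenerate combination. *)
Lemma near_line : exists i0 (a : 'I_k.+1 -> R), [/\ a i0 = 1, forall j, `|a j| <= 2 &
  forall j, J Q (fun x => (c j x - a j * c i0 x) ^+ 2) <= 9 * eps].
Proof.
pose V i := J Q (fun x => c i x ^+ 2).
have [i0 _ hV] := @Order.TotalTheory.arg_maxP _ R 'I_k.+1 ord0 predT V isT.
have bl u w i : bounded_measurable Q0 (fun x => u * c i x + w).
  by apply: bounded_measurableD; [apply: bounded_measurableM => //|]; exact: bounded_measurable_cst.
suff H j : exists a : R, [/\ (j == i0 -> a = 1), `|a| <= 2 &
    J Q (fun x => (c j x - a * c i0 x) ^+ 2) <= 9 * eps].
  have /choice[a ha] := H; exists i0, a; split => [|j|j]; last 2 first.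
  - by have [] := ha j.
  - by have [] := ha j.
  by have [h _ _] := ha i0; exact: h.
have [->|ji] := eqVneq j i0.
  exists 1; split => //; first by rewrite normr1; lra.
  rewrite (_ : Rintegral m Q _ = J Q (cst 0)); first by rewrite (Jcst mQ) mul0r mulr_ge0.
  by apply: eq_Rintegral => x _; rewrite mul1r subrr expr0n.
have ij : i0 != j by rewrite eq_sym.
have [s s1 hs] := degenerate ij.
pose r := 1 - `|s|.
have bL : bounded_measurable Q0 (pencil (c i0) (c j) s) by exact: bounded_pencil.
have bL2 := bounded_measurableX 2 bL.
have bc2 i := bounded_measurableX 2 (bc i).
have s1' : `|s| <= 1 by rewrite ler_norml.
(* Here the coefficient [r] of [c j] is at least 1/3, so [c j] can be solved for, with slope at most
   2 and a loss of at most 9. *)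
have [sl|sl] := leP `|s| (2 / 3).
  have r3 : 1 / 3 <= r by rewrite /r; lra.
  have r0 : 0 < r by lra.
  exists (- s / r); split => //.
    rewrite normrM normrN normfV (gtr0_norm r0) ler_pdivrMr//; lra.
  rewrite (_ : Rintegral m Q _ = (r^-1) ^+ 2 * J Q (fun x => pencil (c i0) (c j) s x ^+ 2)); last first.
    rewrite -(JZ mQ QQ0)//; apply: eq_Rintegral => x _.
    by rewrite /pencil -/r; field; rewrite gt_eqF.
  apply: ler_pM => //; first by rewrite exprn_ge0// invr_ge0 ltW.
    by apply: Rintegral_ge0 => x _; exact: sqr_ge0.
  have : r^-1 <= 3 by rewrite -[3]invrK lef_pV2 ?posrE//; lra.
  have : 0 <= r^-1 by rewrite invr_ge0 ltW.
  by move: r^-1 => y y0 y3; rewrite expr2; nra.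
(* Here [c i0] is nearly a small multiple of [c j]. Since its second moment V is maximal, 4/9 V <= 2
   eps + 2/9 V, so V <= 9 eps and slope 0 will do. *)
exists 0; split => //; first by rewrite normr0.
have Vle : V j <= V i0 by exact: hV.
have -> : J Q (fun x => (c j x - 0 * c i0 x) ^+ 2) = V j.
  by apply: eq_Rintegral => x _; rewrite mul0r subr0.
have bI : bounded_measurable Q0 (fun x => 2 * (pencil (c i0) (c j) s x) ^+ 2).
  by apply: bounded_measurableM => //; exact: bounded_measurable_cst.
have bII : bounded_measurable Q0 (fun x => 2 * r ^+ 2 * (c j x) ^+ 2).
  by apply: bounded_measurableM => //; exact: bounded_measurable_cst.
have key : s ^+ 2 * V i0 <= 2 * eps + 2 * r ^+ 2 * V j.
  apply: (@le_trans _ _ (2 * J Q (fun x => pencil (c i0) (c j) s x ^+ 2) + 2 * r ^+ 2 * V j)); last first.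
    by rewrite lerD2r; apply: ler_wpM2l.
  rewrite /V -!(JZ mQ QQ0)// -(JD mQ QQ0)//; apply: (J_le mQ QQ0).
  - by apply: bounded_measurableM => //; exact: bounded_measurable_cst.
  - exact: bounded_measurableD.
  move=> x _; rewrite /pencil -/r -subr_ge0.
  rewrite (_ : _ - _ = (s * c i0 x + 2 * r * c j x) ^+ 2); first exact: sqr_ge0.
  by ring.
have V0 : 0 <= V i0 by apply: Rintegral_ge0 => x _; exact: sqr_ge0.
have s2 : 4 / 9 <= s ^+ 2.
  rewrite -[s ^+ 2]real_normK ?num_real//; move: sl; move: `|s| => u u1; rewrite expr2; nra.
have r2 : r ^+ 2 <= 1 / 9.
  have : 0 <= r by rewrite subr_ge0.
  have : r <= 1 / 3 by rewrite /r; lra.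
  by move: (r) => y y1 y2; rewrite expr2; nra.
have r20 : 0 <= r ^+ 2 := sqr_ge0 r.
have h1 : 4 / 9 * V i0 <= s ^+ 2 * V i0 by exact: ler_wpM2r.
have h2 : r ^+ 2 * V j <= 1 / 9 * V i0.
  by apply: ler_pM => //; apply: Rintegral_ge0 => x _; exact: sqr_ge0.
by move: key h1 h2; rewrite -mulrA; lra.
Qed.
End near_line.

Section cells.
Context d (T : measurableType d) (R : realType) (m : probability T R) (Q0 Q : set T).
Local Notation J Q g := (\int[m]_(x in Q) g x)%R.
Hypotheses (mQ : measurable Q) (QQ0 : Q `<=` Q0).
Variables (X : T -> R) (x0 step : R) (N : nat).
Hypotheses (mX : measurable_fun setT X) (st0 : 0 < step).
Hypothesis XN : forall x, Q x -> x0 <= X x < x0 + N%:R * step.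

Definition grid (j : nat) : R := x0 + j%:R * step.
Definition cell (j : nat) : set T := Q `&` [set x | grid j <= X x < grid j.+1].

Lemma measurable_cell j : measurable (cell j).
Proof.
apply: measurableI => //.
rewrite (_ : [set x | _] = X @^-1` `[grid j, grid j.+1[%classic); last first.
  by apply/seteqP; split => x /=; rewrite in_itv.
by rewrite -[X in measurable X]setTI; apply: mX => //; exact: measurable_itv.
Qed.

Lemma cell_sub j : cell j `<=` Q0. Proof. by move=> x [/QQ0]. Qed.

Lemma grid_homo i j : (i <= j)%N -> grid i <= grid j.
Proof. by move=> ij; rewrite lerD2l; apply: ler_wpM2r; [exact: ltW|rewrite ler_nat]. Qed.

Lemma cell_out j : (N <= j)%N -> cell j = set0.
Proof.
move=> Nj; rewrite -subset0 => x [Qx /andP[gx _]].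
by have /andP[_] := XN Qx; rewrite ltNge => /negP; apply; apply: le_trans (grid_homo Nj) gx.
Qed.

Lemma cell_indic x : Q x -> \sum_(j < N) (\1_(cell j) x : R) = 1.
Proof.
move=> Qx; have /andP[xa xb] := XN Qx.
pose j := Num.truncn ((X x - x0) / step).
have h0 : 0 <= (X x - x0) / step by rewrite divr_ge0 ?subr_ge0// ltW.
have /andP[j1 j2] := truncn_itv h0; rewrite -/j in j1 j2.
have jN : (j < N)%N.
  rewrite -(ltr_nat R); apply: le_lt_trans j1 _.
  by rewrite ltr_pdivrMr// ltrBlDl.
have xj : cell j x.
  split => //=; rewrite /grid; apply/andP; split.
    by rewrite -lerBrDl -ler_pdivlMr.
  by rewrite -ltrBlDl -ltr_pdivrMr.
rewrite (bigD1 (Ordinal jN))//= big1 ?addr0; first by rewrite indicE mem_set.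
move=> i ij; rewrite indicE memNset// => -[_ /andP[i1 i2]].
move: xj => [_ /andP[k1 k2]].
have [h|h|h] := ltngtP i j.
- by have := le_lt_trans (le_trans (grid_homo h) k1) i2; rewrite ltxx.
- by have := le_lt_trans (le_trans (grid_homo h) i1) k2; rewrite ltxx.
- by move/eqP: ij; apply; apply: val_inj.
Qed.

Lemma J_cells f : bounded_measurable Q0 f -> J Q f = \sum_(j < N) J (cell j) f.
Proof.
move=> bf.
have bi j : bounded_measurable Q0 (fun x => f x * \1_(cell j) x).
  by apply: bounded_measurableM => //; apply: bounded_measurable_indic; exact: measurable_cell.
rewrite (_ : J Q f = J Q (fun x => \sum_(j <- index_enum 'I_N) f x * \1_(cell j) x)); last first.
  apply: eq_Rintegral => x /set_mem Qx.
  by rewrite -mulr_sumr cell_indic ?mulr1.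
rewrite (J_sum mQ QQ0 _ (fun j : 'I_N => bi j)); apply: eq_bigr => j _.
by rewrite J_restrict; congr (J _ f); rewrite /cell setIA setIid.
Qed.

Lemma mass_cells : mass m Q = \sum_(j < N) mass m (cell j).
Proof.
have := J_cells (bounded_measurable_cst Q0 1); rewrite (Jcst mQ) mul1r => ->.
by apply: eq_bigr => j _; rewrite (Jcst (measurable_cell j)) mul1r.
Qed.

Lemma J_cells_approx f (w : nat -> R) D : bounded_measurable Q0 f -> bounded_measurable Q0 D ->
  (forall j x, cell j x -> `|f x - w j| <= D x) ->
  `|J Q f - \sum_(j < N) w j * mass m (cell j)| <= J Q D.
Proof.
move=> bf bD fw; rewrite (J_cells bf) (J_cells bD) -sumrB.
apply: le_trans (ler_norm_sum _ _ _) _; apply: ler_sum => j _.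
have mj := measurable_cell j; have jQ := @cell_sub j.
rewrite -(Jcst mj) -(JB mj jQ)//; last exact: bounded_measurable_cst.
have bfw : bounded_measurable Q0 (fun x => f x - cst (w j) x).
  by apply: bounded_measurableB => //; exact: bounded_measurable_cst.
apply: le_trans (J_norm mj jQ bfw) _; apply: (J_le mj jQ) => //.
  exact: bounded_measurable_norm.
by move=> x; exact: fw.
Qed.

End cells.

(** Integration starts at lo - 1, so that both ends of the interval are interior points and the
    derivative is two-sided there. *)
Lemma continuous_antiderivative (R : realType) (g : R -> R) (lo hi : R) : continuous g ->
  exists H : R -> R, forall x, lo <= x <= hi -> is_derive x 1 H (g x).
Proof.
move=> cg; exists (fun y => \int[lebesgue_measure]_(t in `[lo - 1, y]) g t)%R => x /andP[lx xh].
have ig : lebesgue_measure.-integrable `[lo - 1, hi + 1] (EFin \o g).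
  apply: continuous_compact_integrable; first exact: segment_compact.
  exact: continuous_subspaceT.
have h1 : x < hi + 1 by lra.
have h2 : lo - 1 < x by lra.
have [dx ex] := continuous_FTC1_closed h1 ig h2 (cg x).
by apply: DeriveDef; rewrite -?derive1E.
Qed.

(** * Convex pieces, their slices, and polynomials along lines *)

Section convex_pieces.
Variables (R : realType) (k : nat).
Implicit Types Q : set 'rV[R]_k.

Definition mid_convex Q := forall x y, Q x -> Q y -> Q (2^-1 *: (x + y)).

Definition coord (i : 'I_k) (x : 'rV[R]_k) : R := x ord0 i.

Lemma coord_mid i x y : coord i (2^-1 *: (x + y)) = (coord i x + coord i y) / 2.
Proof. by rewrite /coord !mxE mulrC. Qed.

Lemma mid_convex_cut Q i j a b s : mid_convex Q ->
  let H := half_space (fun x : borel 'rV[R]_k => coord i x - a) (fun x : borel 'rV[R]_k => coord j x - b) s in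
  mid_convex (Q `&` H) /\ mid_convex (Q `&` ~` H).
Proof.
move=> cQ H.
have E x y : pencil (fun x : borel 'rV[R]_k => coord i x - a) (fun x : borel 'rV[R]_k => coord j x - b) s (2^-1 *: (x + y)) =
    (pencil (fun x : borel 'rV[R]_k => coord i x - a) (fun x : borel 'rV[R]_k => coord j x - b) s x +
     pencil (fun x : borel 'rV[R]_k => coord i x - a) (fun x : borel 'rV[R]_k => coord j x - b) s y) / 2.
  by rewrite /pencil !coord_mid; field.
split=> x y [Qx Hx] [Qy Hy]; split; try exact: cQ.
  by rewrite /H /half_space /= E; apply: divr_gt0 => //; exact: addr_gt0.
move: Hx Hy; rewrite /H /half_space /= E => /negP hx /negP hy; apply/negP.
rewrite -!leNgt in hx hy *; rewrite pmulr_lle0 ?invr_gt0//.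
by rewrite -[leRHS]addr0; exact: lerD.
Qed.

Lemma null_pencil (m : set (borel 'rV[R]_k) -> \bar R) : null_hyperplanes m ->
  forall i j a b s, i != j ->
  m [set x | pencil (fun x : borel 'rV[R]_k => coord i x - a) (fun x : borel 'rV[R]_k => coord j x - b) s x = 0] = 0%E.
Proof.
move=> nm i j a b s ij.
pose v : 'rV[R]_k := \row_l (s * (l == i)%:R + (1 - `|s|) * (l == j)%:R).
rewrite (_ : [set x | _] = hyperplane v (s * a + (1 - `|s|) * b)).
  apply: nm; apply/eqP => /rowP v0.
  have := v0 i; have := v0 j; rewrite !mxE !eqxx (eq_sym j i) (negbTE ij) !mulr0 !mulr1 addr0 add0r.
  by move=> h1 h2; move: h1; rewrite h2 normr0 subr0 => /eqP; rewrite oner_eq0.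
apply/seteqP; split => x; rewrite /hyperplane /=.
  rewrite /pencil /coord => h.
  rewrite (eq_bigr (fun l => s * ((l == i)%:R * x ord0 l) + (1 - `|s|) * ((l == j)%:R * x ord0 l))); last first.
    by move=> l _; rewrite mxE; ring.
  rewrite big_split /= -!mulr_sumr (bigD1 i)//= eqxx mul1r big1 ?addr0; last first.
    by move=> l /negbTE ->; rewrite mul0r.
  rewrite (bigD1 j)//= eqxx mul1r big1 ?addr0; last by move=> l /negbTE ->; rewrite mul0r.
  by move: h; lra.
rewrite (eq_bigr (fun l => s * ((l == i)%:R * x ord0 l) + (1 - `|s|) * ((l == j)%:R * x ord0 l))); last first.
  by move=> l _; rewrite mxE; ring.
rewrite big_split /= -!mulr_sumr (bigD1 i)//= eqxx mul1r big1 ?addr0; last first.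
  by move=> l /negbTE ->; rewrite mul0r.
rewrite (bigD1 j)//= eqxx mul1r big1 ?addr0; last by move=> l /negbTE ->; rewrite mul0r.
by rewrite /pencil /coord => h; lra.
Qed.

Local Notation ccell Q i := (@cell _ (borel 'rV[R]_k) R Q (coord i)).

(** If a + b = 2 c, midpoints between cells a and b fall into cell c; if a + b = 2 c + 1, they fall
    into cell c or c + 1, whence the sum in the odd condition. *)
Lemma cells_log_concave (m : probability (borel 'rV[R]_k) R) Q i (x0 step : R) :
  borell m -> @measurable _ (borel 'rV[R]_k) Q -> mid_convex Q -> 0 < step ->
  log_concave_seq (fun j => mass m (ccell Q i x0 step j)).
Proof.
move=> bm mQ cQ st0.
have mX : measurable_fun [set: borel 'rV[R]_k] (coord i) by exact: measurable_coord.
have mC j := measurable_cell mQ x0 step mX j.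
have borell_mass A B C : @measurable _ (borel 'rV[R]_k) A -> @measurable _ (borel 'rV[R]_k) B ->
    @measurable _ (borel 'rV[R]_k) C ->
    (forall x y, A x -> B y -> C (2^-1 *: (x + y))%R) -> mass m A * mass m B <= mass m C ^+ 2.
  move=> mA mB mCC h; have := bm A B C mA mB mCC h.
  by rewrite (massE mA) (massE mB) (massE mCC) -!EFinM lee_fin expr2.
have gridE j : grid x0 step j = x0 + j%:R * step by [].
split => [j|a b c abc|a b c abc]; first exact: mass_ge0.
  apply: borell_mass => // x y [Qx /andP[x1 x2]] [Qy /andP[y1 y2]].
  split; first exact: cQ.
  rewrite /= coord_mid; move: x1 x2 y1 y2; rewrite !gridE -!natr1.
  have : a%:R + b%:R = c%:R + c%:R :> R by rewrite -!natrD abc.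
  move: (a%:R : R) (b%:R : R) (c%:R : R) => u v w uvw x1 x2 y1 y2.
  have E : (u + v) * step = (w + w) * step by rewrite uvw.
  by apply/andP; split; rewrite ?ler_pdivlMr ?ltr_pdivrMr//; lra.
rewrite (_ : mass m _ + mass m _ = mass m (ccell Q i x0 step c `|` ccell Q i x0 step c.+1)).
  apply: borell_mass => //; first exact: measurableU.
  move=> x y [Qx /andP[x1 x2]] [Qy /andP[y1 y2]].
  have : a%:R + b%:R = c%:R + c%:R + 1 :> R by rewrite -!natrD natr1 abc addnS.
  rewrite !gridE -!natr1 in x1 x2 y1 y2.
  move: x1 x2 y1 y2; move: (a%:R : R) (b%:R : R) => u v x1 x2 y1 y2 uvw.
  have E : (u + v) * step = (c%:R + c%:R + 1) * step by rewrite uvw.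
  have [h|h] := ltP (coord i (2^-1 *: (x + y))) (grid x0 step c.+1).
    left; split; first exact: cQ.
    rewrite /= h andbT; rewrite coord_mid gridE ler_pdivlMr//; lra.
  right; split; first exact: cQ.
  rewrite /= h /=; rewrite coord_mid gridE -!natr1 ltr_pdivrMr//; lra.
rewrite /mass measureU//; first by rewrite fineD ?fin_num_measure.
rewrite -subset0 => x [[_ /andP[_ x1]] [_ /andP[x2 _]]].
by have := le_lt_trans x2 x1; rewrite ltxx.
Qed.

End convex_pieces.

(** A polynomial in several variables is recorded through what the needle argument uses:
    measurability, Lipschitz bounds on cubes, and a univariate polynomial of degree at most [d]
    along each line. *)
Definition poly_like (R : realType) k (d : nat) (f : 'rV[R]_k -> R) :=
  [/\ measurable_fun [set: borel 'rV[R]_k] f,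
    forall B : R, exists2 L, 0 <= L & forall y z : 'rV[R]_k,
      (forall i, `|y ord0 i| <= B) -> (forall i, `|z ord0 i| <= B) ->
      `|f y - f z| <= L * \sum_i `|y ord0 i - z ord0 i| &
    forall u v, exists2 q : {poly R}, (size q <= d.+1)%N & forall t, f (u + t *: v) = q.[t]].

Definition locally_lipschitz (R : realType) (g : R -> R) :=
  forall B : R, exists2 L, 0 <= L & forall s t, `|s| <= B -> `|t| <= B -> `|g s - g t| <= L * `|s - t|.

Lemma lipschitz_continuous (R : realType) (g : R -> R) L :
  (forall s t, `|g s - g t| <= L * `|s - t|) -> continuous g.
Proof.
move=> gL x; apply/cvgrPdist_lt => e e0.
have L0 : 0 < `|L| + 1 by rewrite ltr_wpDl.
near=> t.
apply: le_lt_trans (gL _ _) _.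
apply: (@le_lt_trans _ _ ((`|L| + 1) * `|x - t|)).
  by apply: ler_wpM2r => //; have := ler_norm L; lra.
rewrite mulrC -ltr_pdivlMr//.
near: t; apply: (@cvgr_dist_lt _ R _ _ _ id); [exact: cvg_id|exact: divr_gt0].
Unshelve. all: by end_near. Qed.

Section needle.
Variables (R : realType) (k d : nat).
Local Notation T := (borel 'rV[R]_k.+1).
Local Notation X := (fun i : 'I_k.+1 => (@coord R k.+1 i : T -> R)).
Variables (m : probability T R) (Q0 Q : set 'rV[R]_k.+1) (A : R).
Local Notation J Q g := (\int[m]_(x in Q) g x)%R.
Hypotheses (A0 : 0 < A) (QA : forall x : 'rV[R]_k.+1, Q0 x -> forall i, `|x ord0 i| <= A).
Hypotheses (bm : borell m) (mQ : @measurable _ T Q) (QQ0 : Q `<=` Q0) (cQ : mid_convex Q) (Qp : 0 < mass m Q).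

Let bX i : bounded_measurable (Q0 : set T) (X i).
Proof. by split; [exact: measurable_coord | exists A => x Qx; exact: QA]. Qed.

Let c i : T -> R := centered m X Q i.

Let bc i : bounded_measurable (Q0 : set T) (c i).
Proof. by apply: bounded_measurableB => //; exact: bounded_measurable_cst. Qed.

Let mean i : R := J Q (X i) / mass m Q.

Let meanA i : `|mean i| <= A.
Proof.
rewrite normrM normfV (ger0_norm (mass_ge0 _)) ler_pdivrMr//.
by apply: (J_bound mQ QQ0) => // x /QQ0 Qx; exact: QA.
Qed.

Let J_abs g e : bounded_measurable (Q0 : set T) g -> 0 <= e ->
  J Q (fun x => g x ^+ 2) <= e ^+ 2 * mass m Q -> J Q (fun x => `|g x|) <= e * mass m Q.
Proof.
move=> bg e0 h.
have := cauchy_schwarz (m := m) mQ QQ0 (bounded_measurable_norm bg) (bounded_measurable_cst (Q0 : set T) 1).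
rewrite (_ : Rintegral m Q (fun x => `|g x| * cst 1 x) = J Q (fun x => `|g x|)); last first.
  by apply: eq_Rintegral => x _; rewrite mulr1.
rewrite (_ : Rintegral m Q (fun x => `|g x| ^+ 2) = J Q (fun x => g x ^+ 2)); last first.
  by apply: eq_Rintegral => x _; rewrite real_normK ?num_real.
rewrite (_ : Rintegral m Q (fun x => cst 1 x ^+ 2) = J Q (cst 1)); last first.
  by apply: eq_Rintegral => x _; rewrite expr1n.
rewrite (Jcst mQ) mul1r => h2.
have n1 : J Q (fun x => `|g x|) \in Num.nneg.
  by rewrite nnegrE; apply: Rintegral_ge0 => x _.
have n2 : e * mass m Q \in Num.nneg by rewrite nnegrE mulr_ge0// ltW.
rewrite -(ler_sqr n1 n2); apply: le_trans h2 _.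
rewrite (_ : (e * mass m Q) ^+ 2 = e ^+ 2 * mass m Q * mass m Q); last by ring.
by apply: ler_wpM2r; [exact: ltW|exact: h].
Qed.

Variables (f : 'rV[R]_k.+1 -> R) (L F delta h : R).
Hypotheses (pf : poly_like d f) (L0 : 0 <= L) (d0 : 0 <= delta) (h0 : 0 < h) (hA : h <= A).
Hypothesis fL : forall y z : 'rV[R]_k.+1,
  (forall i, `|y ord0 i| <= 7 * A) -> (forall i, `|z ord0 i| <= 7 * A) ->
  `|f y - f z| <= L * \sum_i `|y ord0 i - z ord0 i|.
Hypothesis fF : forall y : 'rV[R]_k.+1, (forall i, `|y ord0 i| <= 7 * A) -> `|f y| <= F.
Hypothesis degenerate : forall i j, i != j -> exists2 s, -1 <= s <= 1 &
  J Q (fun x => pencil (c i) (c j) s x ^+ 2) <= delta ^+ 2 * mass m Q.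

(* All coordinates are within O(delta) in L^1 of affine functions of one of them, so
   the masses p j of the slices of Q of width h along that coordinate carry all
   the information; q is f along the corresponding line. *)
Lemma needle : exists (q : {poly R}) (p : nat -> R) (N : nat),
  [/\ (size q <= d.+1)%N, log_concave_seq p, (forall j, (N <= j)%N -> p j = 0), \sum_(j < N) p j = 1 &
  (forall (g : R -> R) (Lg : R), measurable_fun setT g -> 0 <= Lg ->
     (forall s t, `|s| <= F -> `|t| <= F -> `|g s - g t| <= Lg * `|s - t|) ->
     `|J Q (g \o f) / mass m Q - \sum_(j < N) p j * g q.[grid (- A) h j]| <=
       Lg * (L * (k.+1%:R * (3 * delta + 2 * h)))) /\
  (forall x y : R, grid (- A) h 0 <= x <= grid (- A) h N -> grid (- A) h 0 <= y <= grid (- A) h N ->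
     `|q.[x] - q.[y]| <= L * (k.+1%:R * 2) * `|x - y|)].
Proof.
have e0 : 0 <= delta ^+ 2 * mass m Q by rewrite mulr_ge0 ?sqr_ge0// ltW.
have [i0 [a [ai0 a2 ha]]] := near_line mQ QQ0 e0 bc degenerate.
pose u : 'rV[R]_k.+1 := \row_j (mean j - a j * mean i0).
pose v : 'rV[R]_k.+1 := \row_j a j.
have [mf _ /(_ u v)[q sq qE]] := pf.
(* The cells are half-open and must cover the closed interval [-A, A], hence the strict 2 A < N h;
   since h <= A, the grid stays within [-A, 2 A]. *)
pose N := (Num.truncn (2 * A / h)).+1.
have Ah0 : 0 <= 2 * A / h by rewrite divr_ge0 ?mulr_ge0 ?ltW.
have /andP[N1 N2] := truncn_itv Ah0.
have NA : 2 * A < N%:R * h by rewrite -ltr_pdivrMr.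
have NA' : N%:R * h <= 3 * A.
  have -> : N%:R = (Num.truncn (2 * A / h))%:R + 1 :> R by rewrite natr1.
  have H (w b e : R) : b <= e -> w * b <= 2 * e -> (w + 1) * b <= 3 * e by lra.
  by apply: H => //; rewrite -ler_pdivlMr.
have mX : measurable_fun [set: T] (X i0) by exact: measurable_coord.
pose ce := @cell _ T R Q (X i0) (- A) h.
have XN x : Q x -> - A <= X i0 x < - A + N%:R * h.
  by move=> /QQ0/QA/(_ i0); rewrite ler_norml => /andP[x1 x2]; apply/andP; split => //; move: x2; rewrite /coord; lra.
have mce j : measurable (ce j) := measurable_cell mQ _ _ mX j.
pose p j := mass m (ce j) / mass m Q.
(* A + 2 (2 A + A) = 7 A, from the bounds on the means, the slopes and [t]. *)
have line_bd t : `|t| <= 2 * A -> forall i, `|(u + t *: v) ord0 i| <= 7 * A.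
  move=> tA i; rewrite !mxE (_ : mean i - a i * mean i0 + t * a i = mean i + a i * (t - mean i0)); last by ring.
  apply: le_trans (ler_normD _ _) _; rewrite [`|a i * _|]normrM.
  have h1 := meanA i; have h2 : `|t - mean i0| <= 3 * A.
    by apply: le_trans (ler_normB _ _) _; have := meanA i0; lra.
  have : `|a i| * `|t - mean i0| <= 2 * (3 * A) by apply: ler_pM.
  lra.
have gridE j : grid (- A) h j = - A + j%:R * h by [].
have grid_bd x : grid (- A) h 0 <= x <= grid (- A) h N -> `|x| <= 2 * A.
  by rewrite !gridE mul0r addr0 ler_norml => /andP[x1 x2]; apply/andP; split; lra.
exists q, p, N; split => //.
- have lc := cells_log_concave i0 (- A) bm mQ cQ h0.
  have Qi : 0 <= (mass m Q)^-1 by rewrite invr_ge0 ltW.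
  split => [j|i j l ijl|i j l ijl]; first by rewrite mulr_ge0// mass_ge0.
    rewrite /p mulrACA -expr2 exprMn; apply: ler_wpM2r; first exact: sqr_ge0.
    exact: (lcs_even lc).
  rewrite /p mulrACA -expr2 -mulrDl exprMn; apply: ler_wpM2r; first exact: sqr_ge0.
  exact: (lcs_odd lc).
- move=> j Nj; rewrite /p /ce (@cell_out _ T R Q (X i0) _ _ _ h0 XN _ Nj) /mass measure0 mul0r//.
- by rewrite -mulr_suml -(@mass_cells _ T R m Q0 Q mQ QQ0 (X i0) (- A) h N mX h0 XN) divff// gt_eqF.
split; last first.
  move=> x y /grid_bd xA /grid_bd yA; rewrite -!qE.
  apply: le_trans (fL (line_bd _ xA) (line_bd _ yA)) _.
  rewrite -mulrA; apply: ler_wpM2l => //.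
  apply: (@le_trans _ _ (\sum_(i < k.+1) 2 * `|x - y|)).
    apply: ler_sum => i _; rewrite !mxE (_ : _ - _ = a i * (x - y)); last by ring.
    by rewrite normrM; apply: ler_wpM2r.
  by rewrite sumr_const card_ord -[X in X <= _]mulr_natl mulrA.
move=> g Lg mg Lg0 gL.
have bf : bounded_measurable (Q0 : set T) (g \o f).
  split; first exact: measurableT_comp.
  exists (`|g 0| + Lg * F) => x Qx /=.
  have xA i : `|x ord0 i| <= 7 * A by apply: le_trans (QA Qx i) _; rewrite ler_peMl ?ler1n// ltW.
  have F0 : 0 <= F := le_trans (normr_ge0 _) (fF xA).
  have := gL (f x) 0 (fF xA); rewrite normr0 subr0 => /(_ F0) h1.
  have : Lg * `|f x| <= Lg * F by apply: ler_wpM2l => //; exact: fF.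
  have := ler_normD (g (f x) - g 0) (g 0); rewrite subrK; lra.
pose e x := \sum_(i <- index_enum 'I_k.+1) `|c i x - a i * c i0 x|.
have be i : bounded_measurable (Q0 : set T) (fun x => c i x - a i * c i0 x).
  by apply: bounded_measurableB => //; apply: bounded_measurableM => //; exact: bounded_measurable_cst.
have bbe : bounded_measurable (Q0 : set T) e.
  by apply: bounded_measurable_sum => i; exact: bounded_measurable_norm.
pose D x := Lg * (L * (e x + k.+1%:R * (2 * h))).
have bD : bounded_measurable (Q0 : set T) D.
  apply: bounded_measurableM; first exact: bounded_measurable_cst.
  apply: bounded_measurableM; first exact: bounded_measurable_cst.
  by apply: bounded_measurableD => //; exact: bounded_measurable_cst.
have close j x : ce j x -> `|(g \o f) x - g q.[grid (- A) h j]| <= D x.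
  move=> [Qx /andP[x1 x2]].
  have xA i : `|x ord0 i| <= 7 * A by apply: le_trans (QA (QQ0 Qx) i) _; rewrite ler_peMl ?ler1n// ltW.
  have gA : `|grid (- A) h j| <= 2 * A.
    have jN : 0 <= j%:R * h by rewrite mulr_ge0// ltW.
    have := QA (QQ0 Qx) i0; move: x1; rewrite gridE /coord !ler_norml => x1 /andP[_ x3].
    by apply/andP; split; lra.
  rewrite -qE /=; apply: le_trans (gL _ _ (fF xA) (fF (line_bd _ gA))) _.
  apply: ler_wpM2l => //; apply: le_trans (fL xA (line_bd _ gA)) _.
  apply: ler_wpM2l => //.
  apply: (@le_trans _ _ (\sum_(i < k.+1) (`|c i x - a i * c i0 x| + 2 * h))).
    apply: ler_sum => i _; rewrite !mxE.
    rewrite (_ : _ - _ = (c i x - a i * c i0 x) + a i * (X i0 x - grid (- A) h j)); last first.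
      by rewrite /c /centered /mean /coord; ring.
    apply: le_trans (ler_normD _ _) _; rewrite lerD2l normrM; apply: ler_pM => //.
    have xx : 0 <= X i0 x - grid (- A) h j by rewrite subr_ge0.
    rewrite (ger0_norm xx); move: x2; rewrite !gridE -natr1; lra.
  by rewrite big_split /= sumr_const card_ord -[X in _ + X <= _]mulr_natl.
have := @J_cells_approx _ T R m Q0 Q mQ QQ0 (X i0) (- A) h N mX h0 XN (g \o f) (fun j => g q.[grid (- A) h j]) D bf bD close.
rewrite -/ce.
have -> : \sum_(j < N) g q.[grid (- A) h j] * mass m (ce j) =
    (\sum_(j < N) p j * g q.[grid (- A) h j]) * mass m Q.
  rewrite mulr_suml; apply: eq_bigr => j _; rewrite /p; field.
  by rewrite gt_eqF.
set S := \sum_(_ < N) _.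
have -> : J Q (g \o f) - S * mass m Q = (J Q (g \o f) / mass m Q - S) * mass m Q.
  by field; rewrite gt_eqF.
rewrite normrM (ger0_norm (mass_ge0 _)) => H1.
rewrite -(ler_pM2r Qp); apply: le_trans H1 _.
have b1 : bounded_measurable (Q0 : set T) (fun x => e x + cst (k.+1%:R * (2 * h)) x).
  by apply: bounded_measurableD => //; exact: bounded_measurable_cst.
rewrite /D (JZ mQ QQ0); last by apply: bounded_measurableM => //; exact: bounded_measurable_cst.
rewrite (JZ mQ QQ0)// -mulrA; apply: ler_wpM2l => //; rewrite -mulrA; apply: ler_wpM2l => //.
rewrite (JD mQ QQ0)//; last exact: bounded_measurable_cst.
rewrite (Jcst mQ) mulrDr [leRHS]mulrDl; apply: lerD => //.
rewrite /e (J_sum mQ QQ0); last by move=> i; exact: bounded_measurable_norm.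
apply: (@le_trans _ _ (\sum_(i < k.+1) (3 * delta * mass m Q))).
  apply: ler_sum => i _; apply: J_abs => //; first by rewrite mulr_ge0.
  apply: le_trans (ha i) _; rewrite exprMn mulrA; apply: ler_wpM2r; first exact: ltW.
  by apply: ler_wpM2r; [exact: sqr_ge0|lra].
by rewrite sumr_const card_ord -[X in X <= _]mulr_natl mulrA.
Qed.

End needle.

(* What lets a needle inherit the spread s of f from the single average of gam
   that localization preserves. *)
Definition variance_separated (R : realType) (Phi gam : R -> R) (g0 eta s : R) :=
  forall (N : nat) (p t : nat -> R), (forall j, 0 <= p j) -> \sum_(j < N) p j = 1 ->
  `|\sum_(j < N) p j * gam (t j) - g0| <= eta ->
  forall x, Phi x != 0 -> s ^+ 2 <= 100 * \sum_(j < N) p j * (t j - x) ^+ 2.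

Lemma riemann_step (R : realType) (Phi H : R -> R) (q : {poly R}) (Lam c a h : R) : 0 <= h ->
  0 <= Lam -> (forall s t, `|Phi s - Phi t| <= Lam * `|s - t|) ->
  (forall x : R, a <= x <= a + h -> `|q.[x] - q.[a]| <= c * `|x - a|) -> 0 <= c ->
  (forall x, a <= x <= a + h -> is_derive x 1 H (Phi q.[x])) ->
  `|H (a + h) - H a - h * Phi q.[a]| <= h * (Lam * (c * h)).
Proof.
move=> h0 Lam0 PL qc c0 dH.
have ah : a <= a + h by rewrite lerDl.
have [x xah ->] := mean_value ah dH.
rewrite (_ : _ - _ = h * (Phi q.[x] - Phi q.[a])); last by ring.
rewrite normrM (ger0_norm h0); apply: ler_wpM2l => //.
apply: le_trans (PL _ _) _; apply: ler_wpM2l => //.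
apply: le_trans (qc _ xah) _; apply: ler_wpM2l => //.
by move: xah => /andP[x1 x2]; rewrite ger0_norm ?subr_ge0// lerBlDl.
Qed.

Section core.
Variables (R : realType) (d : nat).
Hypothesis d0 : (0 < d)%N.

(** Half of the average of [Phi] along [f] survives the localization and at most a quarter is lost
    in replacing the needle by its line, whence the factor 4. The bounds [B], [Lam], [eta] and the
    dimension influence only the choice of [h]. *)
Lemma localized_estimate : exists2 C : R, 0 <= C & forall k (m : probability (borel 'rV[R]_k.+1) R)
    (Q0 : set 'rV[R]_k.+1) (B : R) (f : 'rV[R]_k.+1 -> R) (phi Phi gam : R -> R) (K Lam th s eta : R),
  @measurable _ (borel 'rV[R]_k.+1) Q0 -> mid_convex Q0 ->
  (forall x : 'rV[R]_k.+1, Q0 x -> forall i, `|x ord0 i| <= B) -> 0 < mass m Q0 ->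
  borell m -> null_hyperplanes m -> poly_like d f ->
  antiderivative_pair phi Phi K -> 0 <= Lam -> (forall s t, `|Phi s - Phi t| <= Lam * `|s - t|) ->
  measurable_fun setT gam -> locally_lipschitz gam ->
  0 < th -> 0 <= s -> 1 <= th ^+ d * K * s -> 0 < eta ->
  variance_separated Phi gam (Rintegral m Q0 (gam \o f) / mass m Q0) eta s ->
  Rintegral m Q0 (Phi \o f) <= C * (K * th) * mass m Q0.
Proof.
have [C C0 HC] := discrete_estimate R d0.
exists (4 * C); first by rewrite mulr_ge0.
have tri (a b e : R) : `|b - a| <= e -> a <= `|b| + e.
  by move=> h; have := ler_norm (a - b); have := ler_norm b; rewrite distrC; lra.
have tri2 (a b c u v : R) : `|a - b| <= u -> b <= c + v -> a <= c + (u + v).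
  by have := ler_norm (a - b); lra.
have fin (a i u v : R) : a <= v + u -> i / 2 <= a -> u <= i / 4 -> i <= 4 * v by lra.
have five (a : R) : 0 <= a -> 3 * a + 2 * a <= 7 * a by lra.
have split_error (h u v w i e : R) : 0 < h -> 0 <= u -> 0 <= v -> 7 * h + u + v <= w ->
  w <= i / 4 -> w <= e -> u <= i / 4 /\ v <= e by lra.
move=> k m Q0 B f phi Phi gam K Lam th s eta mQ0 cQ0 QB Qp bm nm pf aP Lam0 PL mg lg th0 s0 Ks eta0 sep.
have K0 : 0 <= K := le_trans (normr_ge0 _) (Phi_bound aP 0).
have [I0|I0] := leP (Rintegral m Q0 (Phi \o f)) 0.
  apply: le_trans I0 _; apply: mulr_ge0; last exact: ltW.
  by apply: mulr_ge0; apply: mulr_ge0 => //; exact: ltW.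
pose A := `|B| + 1.
have A0 : 0 < A by rewrite ltr_wpDl.
have QA (x : 'rV[R]_k.+1) : Q0 x -> forall i, `|x ord0 i| <= A.
  by move=> Qx i; apply: le_trans (QB x Qx i) (le_trans (ler_norm B) _); rewrite lerDl.
have [mf /(_ (7 * A))[L L0 fL] _] := pf.
pose F := `|f 0| + L * (k.+1%:R * (7 * A)).
have A70 : 0 <= 7 * A by rewrite mulr_ge0// ltW.
have fF (y : 'rV[R]_k.+1) : (forall i, `|y ord0 i| <= 7 * A) -> `|f y| <= F.
  move=> yA; have z0 i : `|(0 : 'rV[R]_k.+1) ord0 i| <= 7 * A by rewrite mxE normr0.
  have h1 := fL y 0 yA z0.
  have h2 : L * \sum_i `|y ord0 i - (0 : 'rV[R]_k.+1) ord0 i| <= L * (k.+1%:R * (7 * A)).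
    apply: ler_wpM2l => //; apply: (@le_trans _ _ (\sum_(i < k.+1) (7 * A))).
      by apply: ler_sum => i _; rewrite mxE subr0.
    by rewrite sumr_const card_ord -[X in X <= _]mulr_natl.
  rewrite -[f y](subrK (f 0)) /F [leRHS]addrC; apply: le_trans (ler_normD _ _) _.
  by rewrite lerD2r; exact: le_trans h2.
have F0 : 0 <= F by rewrite /F addr_ge0// mulr_ge0// mulr_ge0.
have [Lg Lg0 gL] := lg F.
have fQ (x : 'rV[R]_k.+1) : Q0 x -> `|f x| <= F.
  by move=> Qx; apply: fF => i; apply: le_trans (QA _ Qx i) _; rewrite ler_peMl ?ler1n// ltW.
have mP : measurable_fun setT Phi.
  by apply: continuous_measurable_fun; exact: lipschitz_continuous PL.
have bG : bounded_measurable (Q0 : set (borel 'rV[R]_k.+1)) (gam \o f).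
  split; first exact: measurableT_comp.
  exists (`|gam 0| + Lg * F) => x Qx /=.
  have := gL (f x) 0 (fQ _ Qx); rewrite normr0 subr0 => /(_ F0) h1.
  rewrite -[gam _](subrK (gam 0)) [leRHS]addrC; apply: le_trans (ler_normD _ _) _.
  by rewrite lerD2r; apply: le_trans h1 _; apply: ler_wpM2l => //; exact: fQ.
have bP : bounded_measurable (Q0 : set (borel 'rV[R]_k.+1)) (Phi \o f).
  split; first exact: measurableT_comp.
  by exists K => x _; exact: Phi_bound aP _.
set I := Rintegral m Q0 (Phi \o f) / mass m Q0.
have Ip : 0 < I by rewrite divr_gt0.
pose M : R := k.+1%:R.
have M0 : 0 <= M by [].
(* Both errors, for [Phi] and for [gam], are bounded through 7 h * D; the summand 1 only makes [D]
   positive. *)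
pose D := 1 + Lam * (L * M) + Lg * (L * M).
have D1 : 0 <= Lam * (L * M) by rewrite mulr_ge0// mulr_ge0.
have D2 : 0 <= Lg * (L * M) by rewrite mulr_ge0// mulr_ge0.
have D0 : 0 < D by rewrite /D -addrA ltr_wpDr// addr_ge0.
pose w := Num.min (I / 4) eta.
have w0 : 0 < w by rewrite lt_min eta0 divr_gt0.
have [wI we] : w <= I / 4 /\ w <= eta by split; rewrite ge_min lexx ?orbT.
(* [h] is at once the tolerance of the localization and the slice width: 7 = 3 + 2 + 2 adds the
   deviation from the line, the slice width and the Riemann sum. *)
pose h := Num.min A (w / (7 * D)).
have h0 : 0 < h by rewrite lt_min A0 divr_gt0// mulr_gt0.
have hA : h <= A by rewrite ge_min lexx.
have hw : 7 * h * D <= w.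
  have : h <= w / (7 * D) by rewrite ge_min lexx orbT.
  by rewrite ler_pdivlMr ?mulr_gt0// mulrA [h * 7]mulrC.
have [e1 e2] : Lam * (L * (M * (7 * h))) <= I / 4 /\ Lg * (L * (M * (7 * h))) <= eta.
  have h7 : 0 <= 7 * h by rewrite mulr_ge0// ltW.
  apply: (split_error h _ _ w) => //; try by do 3 ![apply: mulr_ge0 => //].
  by rewrite (_ : _ + _ = 7 * h * D)// /D; ring.
pose X := fun i : 'I_k.+1 => (coord i : borel 'rV[R]_k.+1 -> R).
have mX i : measurable_fun setT (X i) by exact: measurable_coord.
have XA i x : Q0 x -> `|X i x| <= A by move=> Qx; exact: QA.
have h20 : 0 < h ^+ 2 by rewrite exprn_gt0.
have ccut Q i j a b s1 : i != j -> mid_convex Q -> _ := fun _ cQ => @mid_convex_cut R k.+1 Q i j a b s1 cQ.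
have cnull i j a b s1 : i != j -> _ := fun ij => @null_pencil R k.+1 m nm i j a b s1 ij.
have [Q [mQ QQ0 cQ Qp' [GQ PQ deg]]] :=
  @localization _ (borel 'rV[R]_k.+1) R m Q0 _ X A (fun Q => mid_convex Q) mQ0 cQ0 A0 mX XA ccut cnull
     _ _ _ bG bP Qp I0 h20.
have hh := ltW h0.
have [q [p [N [sq lp pN p1 [nd ql]]]]] :=
  needle A0 QA bm mQ QQ0 cQ Qp' pf L0 hh h0 hA fL fF deg.
have cPq : continuous (fun x => Phi q.[x]).
  by move=> x; apply: continuous_comp; [exact: continuous_horner|exact: (lipschitz_continuous PL)].
have [H dH] := @continuous_antiderivative R (fun x => Phi q.[x]) (grid (- A) h 0) (grid (- A) h N) cPq.
have gridS j : grid (- A) h j.+1 = grid (- A) h j + h by rewrite /grid -[j.+1%:R]natr1; ring.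
have gridN j : (j <= N)%N -> grid (- A) h 0 <= grid (- A) h j <= grid (- A) h N.
  by move=> jN; apply/andP; split; exact: grid_homo.
have small (l : R) : 0 <= l -> l * (L * (M * (3 * h + 2 * h))) <= l * (L * (M * (7 * h))).
  by move=> l0; do 3 ![apply: ler_wpM2l => //]; exact: five.
(* The average of [gam] on the discretized needle is within [eta] of the preserved one, so [sep]
   applies to the masses [p]. *)
have sep' (y : R) : Phi q.[y] != 0 ->
    s ^+ 2 <= 100 * \sum_(j < N) p j * (q.[grid (- A) h j] - q.[y]) ^+ 2.
  apply: (sep N p (fun j => q.[grid (- A) h j]) (lcs_ge0 lp) p1).
  have := nd gam Lg mg Lg0 gL.
  rewrite GQ mulfK ?gt_eqF// distrC => hn; apply: le_trans hn (le_trans _ e2); exact: small.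
have disc := HC phi Phi K q p N H (- A) h s th aP sq th0 s0 h0 Ks lp pN p1 dH (fun y _ => sep' y).
have riem : `|\sum_(j < N) p j * (H (grid (- A) h j.+1) - H (grid (- A) h j)) -
    h * \sum_(j < N) p j * Phi q.[grid (- A) h j]| <= h * (Lam * (L * (M * 2) * h)).
  rewrite mulr_sumr -sumrB; apply: le_trans (ler_norm_sum _ _ _) _.
  rewrite -[leRHS]mul1r -[X in _ <= X * _]p1 mulr_suml; apply: ler_sum => j _.
  rewrite (_ : _ - _ = p j * (H (grid (- A) h j.+1) - H (grid (- A) h j) - h * Phi q.[grid (- A) h j])); last by ring.
  rewrite normrM (ger0_norm (lcs_ge0 lp j)); apply: ler_wpM2l; first exact: lcs_ge0.
  have /andP[j0 jN] : grid (- A) h 0 <= grid (- A) h j <= grid (- A) h N by apply/gridN/ltnW.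
  have /andP[_ jN'] : grid (- A) h 0 <= grid (- A) h j.+1 <= grid (- A) h N by exact: gridN.
  rewrite gridS in jN' *; apply: (riemann_step hh Lam0 PL).
  - move=> x /andP[x1 x2]; apply: ql; apply/andP; split => //; [exact: le_trans x1|exact: le_trans jN'].
  - by rewrite mulr_ge0// mulr_ge0.
  - by move=> x /andP[x1 x2]; apply: dH; apply/andP; split; [exact: le_trans x1|exact: le_trans jN'].
have PF s1 t1 : `|s1| <= F -> `|t1| <= F -> `|Phi s1 - Phi t1| <= Lam * `|s1 - t1| by move=> _ _; exact: PL.
have near := nd Phi Lam mP Lam0 PF.
have IQ : I / 2 <= Rintegral m Q (Phi \o f) / mass m Q by rewrite ler_pdivlMr.
have main : Rintegral m Q (Phi \o f) / mass m Q <= C * (K * th) + Lam * (L * (M * (7 * h))).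
  move: near riem disc; rewrite /grid.
  set S1 := \sum_(j < N) p j * Phi _; set S2 := \sum_(j < N) p j * (_ - _).
  move: (Rintegral m Q _ / _) => a h1 h2 h3.
  have h4 : h * S1 <= h * (C * (K * th) + Lam * (L * (M * 2) * h)).
    by rewrite mulrDr; apply: le_trans (tri _ _ _ h2) _; exact: lerD.
  rewrite ler_pM2l// in h4.
  rewrite (_ : Lam * (L * (M * (7 * h))) = Lam * (L * (M * (3 * h + 2 * h))) + Lam * (L * (M * 2) * h)); last by ring.
  exact: tri2 h1 h4.
have : I <= 4 * C * (K * th).
  by rewrite -[4 * C * _]mulrA; exact: fin main IQ e1.
by rewrite /I ler_pdivrMr.
Qed.
End core.

(** * Cutoffs *)

Section cutoff.
Variable R : realType.

Lemma is_derive_quadratic (F : R -> R) (x D c : R) :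
  (forall h, `|F (x + h) - F x - h * D| <= c * h ^+ 2) -> is_derive x 1 F D.
Proof.
move=> HF.
have cv : h^-1 *: (F (h *: (1 : R^o) + x) - F x) @[h --> (0 : R)^'] --> D.
  apply/cvgrPdist_lt => e e0; near=> h.
  have h0 : h != 0 by near: h; exact: nbhs_dnbhs_neq.
  have hp : 0 < `|h| by rewrite normr_gt0.
  rewrite distrC -(ltr_pM2r hp) -normrM mulrBl.
  rewrite (_ : _ * h - D * h = F (x + h) - F x - h * D); last first.
    by rewrite /GRing.scale /= mulr1 (addrC h x) mulrAC mulVf// mul1r (mulrC D).
  apply: le_lt_trans (HF h) _.
  apply: (@le_lt_trans _ _ ((`|c| + 1) * `|h| * `|h|)).
    rewrite -mulrA -expr2 real_normK ?num_real//; apply: ler_wpM2r; first exact: sqr_ge0.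
    by have := ler_norm c; lra.
  rewrite ltr_pM2r// mulrC -ltr_pdivlMr ?ltr_wpDl//.
  near: h; apply: dnbhs0_lt; rewrite divr_gt0// ltr_wpDl//.
apply: DeriveDef; last by apply/cvg_lim => //.
by apply/cvg_ex; exists D.
Unshelve. all: by end_near. Qed.

Definition pos_part (v : R) := Num.max v 0.

Let posE v : (0 <= v /\ pos_part v = v) \/ (v <= 0 /\ pos_part v = 0).
Proof.
have [v0|v0] := leP 0 v; [left|right]; split => //.
- by rewrite /pos_part max_l.
- exact: ltW.
- by rewrite /pos_part max_r// ltW.
Qed.

Lemma is_derive_pos_part_sqr (v : R) : is_derive v 1 (fun u => pos_part u ^+ 2) (2 * pos_part v).
Proof.
apply: (@is_derive_quadratic _ _ _ 1) => h; rewrite mul1r ler_norml.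
by case: (posE v) => -[v0 ->]; case: (posE (v + h)) => -[w0 ->]; apply/andP; split; nra.
Qed.

(** A quadratic spline descending from 1 at v <= 0 to 0 at v >= 1. A Lipschitz derivative is all the
    smoothness that [localized_estimate] asks for. *)
Definition step (v : R) := 1 - 2 * pos_part v ^+ 2 + 4 * pos_part (v - 2^-1) ^+ 2 - 2 * pos_part (v - 1) ^+ 2.
Definition step_derivative (v : R) := - 4 * pos_part v + 8 * pos_part (v - 2^-1) - 4 * pos_part (v - 1).

Lemma is_derive_step (v : R) : is_derive v 1 step (step_derivative v).
Proof.
have sh c : is_derive v 1 (fun u => pos_part (u - c) ^+ 2) (2 * pos_part (v - c)).
  have := @is_derive_affine R (fun u => pos_part u ^+ 2) (2 * pos_part (v - c)) 1 (- c) v.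
  rewrite !mul1r => /(_ (is_derive_pos_part_sqr _)).
  by under [X in is_derive _ _ X _]eq_fun do rewrite mul1r.
have d1 := is_deriveB (is_derive_cst (1 : R) v 1) (is_deriveZ 2 (is_derive_pos_part_sqr v)).
have d2 := is_deriveB (is_deriveD d1 (is_deriveZ 4 (sh 2^-1))) (is_deriveZ 2 (sh 1)).
apply: (@is_derive_eq _ _ _ _ _ _ _ _ d2).
by rewrite /step_derivative /GRing.scale /=; ring.
Qed.

Lemma step_bound v : 0 <= step v <= 1.
Proof.
rewrite /step; case: (posE v) => -[v0 ->]; case: (posE (v - 2^-1)) => -[v1 ->];
  case: (posE (v - 1)) => -[v2 ->]; apply/andP; split; nra.
Qed.

Lemma step_derivative_bound v : `|step_derivative v| <= 2.
Proof.
rewrite ler_norml /step_derivative; case: (posE v) => -[v0 ->]; case: (posE (v - 2^-1)) => -[v1 ->];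
  case: (posE (v - 1)) => -[v2 ->]; apply/andP; split; lra.
Qed.

Lemma pos_part_lipschitz u v : `|pos_part u - pos_part v| <= `|u - v|.
Proof.
case: (posE v) => -[v0 ->]; case: (posE u) => -[w0 ->];
  rewrite ler_norml; apply/andP; split; have := ler_norm (u - v); have := ler_norm (v - u);
  rewrite (distrC v u); lra.
Qed.

Lemma step_derivative_lipschitz u v : `|step_derivative u - step_derivative v| <= 16 * `|u - v|.
Proof.
have := pos_part_lipschitz u v; have := pos_part_lipschitz (u - 2^-1) (v - 2^-1).
have := pos_part_lipschitz (u - 1) (v - 1).
have E c : u - c - (v - c) = u - v by lra.
rewrite !E /step_derivative.
move: (pos_part u) (pos_part v) (pos_part (u - 1)) (pos_part (v - 1)) (pos_part (u - 2^-1)) (pos_part (v - 2^-1)) `|u - v|.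
by move=> a b c e f g w; rewrite !ler_norml => /andP[? ?] /andP[? ?] /andP[? ?]; apply/andP; split; lra.
Qed.

Lemma step_left v : v <= 0 -> step v = 1 /\ step_derivative v = 0.
Proof.
move=> v0; rewrite /step /step_derivative; case: (posE v) => -[v1 ->]; case: (posE (v - 2^-1)) => -[v2 ->];
  case: (posE (v - 1)) => -[v3 ->]; split; try lra; try nra.
Qed.

Lemma step_right v : 1 <= v -> step v = 0 /\ step_derivative v = 0.
Proof.
move=> v0; rewrite /step /step_derivative; case: (posE v) => -[v1 ->]; case: (posE (v - 2^-1)) => -[v2 ->];
  case: (posE (v - 1)) => -[v3 ->]; split; try lra; try nra.
Qed.

Variables (m s : R).
Hypothesis s0 : 0 < s.
(** A plateau: 1 within s/3 of [m], 0 beyond 2 s/3. At each point one of the two steps equals 1, so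
    subtracting 1 leaves the other. *)
Definition bump t := step (3 / s * (t - m) - 1) + step (3 / s * (m - t) - 1) - 1.
Definition bump_derivative t :=
  3 / s * (step_derivative (3 / s * (t - m) - 1) - step_derivative (3 / s * (m - t) - 1)).

Lemma is_derive_bump (t : R) : is_derive t 1 bump (bump_derivative t).
Proof.
have d1 : is_derive t 1 (fun u => step (3 / s * (u - m) - 1)) (3 / s * step_derivative (3 / s * (t - m) - 1)).
  have := @is_derive_affine R step _ (3 / s) (- (3 / s * m) - 1) t (is_derive_step _).
  rewrite addrA -mulrBr => h; rewrite (_ : (fun u => _) = (fun y => step (3 / s * y + (- (3 / s * m) - 1))))//.
  by apply/funext => u; rewrite addrA -mulrBr.
have d2 : is_derive t 1 (fun u => step (3 / s * (m - u) - 1)) (- (3 / s) * step_derivative (3 / s * (m - t) - 1)).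
  have := @is_derive_affine R step _ (- (3 / s)) (3 / s * m - 1) t (is_derive_step _).
  have E u : - (3 / s) * u + (3 / s * m - 1) = 3 / s * (m - u) - 1 by ring.
  rewrite E => h; rewrite (_ : (fun u => _) = (fun y => step (- (3 / s) * y + (3 / s * m - 1))))//.
  by apply/funext => u; rewrite E.
have d3 := is_deriveB (is_deriveD d1 d2) (is_derive_cst (1 : R) t 1).
apply: (@is_derive_eq _ _ _ _ _ _ _ _ d3).
by rewrite /bump_derivative; ring.
Qed.

Lemma bump_split t :
  (bump t = step (3 / s * (t - m) - 1) /\ bump_derivative t = 3 / s * step_derivative (3 / s * (t - m) - 1) /\ m <= t) \/
  (bump t = step (3 / s * (m - t) - 1) /\ bump_derivative t = - (3 / s * step_derivative (3 / s * (m - t) - 1)) /\ t <= m).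
Proof.
have h u : u <= 0 -> 3 / s * u - 1 <= 0.
  by move=> u0; have : 3 / s * u <= 0; [by rewrite mulr_ge0_le0// divr_ge0// ltW|lra].
have [mt|tm] := leP m t; [left|right]; rewrite /bump /bump_derivative.
  have mt' : m - t <= 0 by rewrite subr_le0.
  by have [-> ->] := step_left (h _ mt'); split; [ring|split => //; ring].
have tm' : t - m <= 0 by rewrite subr_le0 ltW.
by have [-> ->] := step_left (h _ tm'); split; [ring|split; [ring|exact: ltW]].
Qed.

Lemma bump_bound t : 0 <= bump t <= 1.
Proof. by case: (bump_split t) => -[-> _]; exact: step_bound. Qed.

Lemma bump_derivative_bound t : `|bump_derivative t| <= 6 / s.
Proof.
have h v : `|3 / s * step_derivative v| <= 6 / s.
  have c0 : 0 <= 3 / s by rewrite divr_ge0// ltW.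
  rewrite normrM (ger0_norm c0) (_ : 6 / s = 3 / s * 2); last by ring.
  by apply: ler_wpM2l => //; exact: step_derivative_bound.
by case: (bump_split t) => -[_ [-> _]]; rewrite ?normrN.
Qed.

Lemma bump_in t : `|t - m| <= s / 3 -> bump t = 1 /\ bump_derivative t = 0.
Proof.
have h u : u <= s / 3 -> 3 / s * u - 1 <= 0.
  by rewrite subr_le0 mulrAC ler_pdivrMr// mul1r; lra.
rewrite ler_norml => /andP[t1 t2]; rewrite /bump /bump_derivative.
have [h1 h2] : t - m <= s / 3 /\ m - t <= s / 3 by split; lra.
have [-> ->] := step_left (h _ h1); have [-> ->] := step_left (h _ h2).
by split; ring.
Qed.

Lemma bump_out t : 2 * s / 3 <= `|t - m| -> bump t = 0 /\ bump_derivative t = 0.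
Proof.
have h u : 2 * s / 3 <= u -> 1 <= 3 / s * u - 1.
  by move=> h; rewrite lerBrDr mulrAC ler_pdivlMr//; lra.
move=> tm; case: (bump_split t) => -[-> [-> mt]].
  rewrite ger0_norm ?subr_ge0// in tm.
  by have [-> ->] := step_right (h _ tm); rewrite mulr0.
rewrite distrC ger0_norm ?subr_ge0// in tm.
by have [-> ->] := step_right (h _ tm); rewrite mulr0 oppr0.
Qed.

Lemma bump_derivative_lipschitz u v : `|bump_derivative u - bump_derivative v| <= 3 / s * (32 * (3 / s)) * `|u - v|.
Proof.
have c0 : 0 <= 3 / s by rewrite divr_ge0// ltW.
rewrite /bump_derivative -mulrBr normrM (ger0_norm c0) -[leRHS]mulrA; apply: ler_wpM2l => //.
have h1 := step_derivative_lipschitz (3 / s * (u - m) - 1) (3 / s * (v - m) - 1).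
have h2 := step_derivative_lipschitz (3 / s * (m - u) - 1) (3 / s * (m - v) - 1).
have e1 : 3 / s * (u - m) - 1 - (3 / s * (v - m) - 1) = 3 / s * (u - v) by ring.
have e2 : 3 / s * (m - u) - 1 - (3 / s * (m - v) - 1) = - (3 / s * (u - v)) by ring.
rewrite e1 normrM (ger0_norm c0) in h1; rewrite e2 normrN normrM (ger0_norm c0) in h2.
move: h1 h2; move: (step_derivative (3 / s * (u - m) - 1)) (step_derivative (3 / s * (v - m) - 1))
  (step_derivative (3 / s * (m - u) - 1)) (step_derivative (3 / s * (m - v) - 1)) => a a' b b' h1 h2.
rewrite (_ : a - b - (a' - b') = (a - a') - (b - b')); last by ring.
apply: le_trans (ler_normB _ _) _.
have -> : 32 * (3 / s) * `|u - v| = 16 * (3 / s * `|u - v|) + 16 * (3 / s * `|u - v|) by ring.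
exact: lerD.
Qed.
End cutoff.

Section truncation.
Variable R : realType.

Lemma derivative_lipschitz (F f : R -> R) L : (forall x : R, is_derive x 1 F (f x)) ->
  (forall x, `|f x| <= L) -> forall u v, `|F u - F v| <= L * `|u - v|.
Proof.
move=> dF fL.
have H u v : u <= v -> `|F u - F v| <= L * `|u - v|.
  move=> uv; rewrite distrC (distrC u) (ger0_norm (_ : 0 <= v - u)) ?subr_ge0//.
  exact: (is_derive_bound uv (fun x _ => dF x) (fun x _ => fL x)).
move=> u v; have [|/ltW] := leP u v; first exact: H.
by move=> /H; rewrite distrC (distrC v).
Qed.

Lemma product_lipschitz (f g : R -> R) a b Lf Lg :
  (forall x, `|f x| <= a) -> (forall x, `|g x| <= b) ->
  (forall u v, `|f u - f v| <= Lf * `|u - v|) -> (forall u v, `|g u - g v| <= Lg * `|u - v|) ->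
  forall u v, `|f u * g u - f v * g v| <= (a * Lg + b * Lf) * `|u - v|.
Proof.
move=> fa gb fL gL u v.
rewrite (_ : f u * g u - f v * g v = f u * (g u - g v) + g v * (f u - f v)); last by ring.
apply: le_trans (ler_normD _ _) _; rewrite mulrDl !normrM -!mulrA.
by apply: lerD; apply: ler_pM.
Qed.

Lemma jensen_sqr (N : nat) (p t : nat -> R) : (forall j, 0 <= p j) -> \sum_(j < N) p j = 1 ->
  (\sum_(j < N) p j * t j) ^+ 2 <= \sum_(j < N) p j * t j ^+ 2.
Proof.
move=> p0 p1; set a := \sum_(j < N) p j * t j.
have : 0 <= \sum_(j < N) p j * (t j - a) ^+ 2.
  by apply: sumr_ge0 => j _; rewrite mulr_ge0// sqr_ge0.
rewrite (eq_bigr (fun j : 'I_N => p j * t j ^+ 2 + (- (2 * a) * (p j * t j) + a ^+ 2 * p j))); last first.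
  by move=> j _; ring.
rewrite !big_split /= -!mulr_sumr -/a p1; lra.
Qed.

Variables (m s : R).
Hypothesis s0 : 0 < s.

(** The second moment about [m] is at least 17/18 s^2 and at most twice that about [x] plus 2 * 4/9
    s^2, so the latter is at least s^2/36. *)
Lemma separated_inside (Phi : R -> R) : (forall x, 2 * s / 3 <= `|x - m| -> Phi x = 0) ->
  variance_separated Phi (fun t => (t - m) ^+ 2) (s ^+ 2) (s ^+ 2 / 18) s.
Proof.
move=> P0 N p t p0 p1; rewrite ler_norml => /andP[h _] x Px.
have xm : (x - m) ^+ 2 <= 4 / 9 * s ^+ 2.
  have : `|x - m| <= 2 * s / 3 by rewrite leNgt; apply/negP => /ltW/P0/eqP; exact/negP.
  rewrite -(real_normK (num_real (x - m))); move: (normr_ge0 (x - m)); move: `|x - m| => y y0 ys; nra.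
have : \sum_(j < N) p j * (t j - m) ^+ 2 <= 2 * \sum_(j < N) p j * (t j - x) ^+ 2 + 2 * (x - m) ^+ 2.
  rewrite -[2 * (x - m) ^+ 2]mul1r -[X in _ <= _ + X * _]p1 mulr_sumr mulr_suml -big_split /=.
  apply: ler_sum => j _.
  rewrite (_ : 2 * _ + _ = p j * (2 * (t j - x) ^+ 2 + 2 * (x - m) ^+ 2)); last by ring.
  apply: ler_wpM2l => //.
  by have := sqr_ge0 (t j - x - (x - m)); nra.
move: h xm (sqr_ge0 s) => /=.
move: (\sum_(j < N) p j * (t j - x) ^+ 2) (\sum_(j < N) p j * (t j - m) ^+ 2) ((x - m) ^+ 2) (s ^+ 2) => u v w z; lra.
Qed.

(** The mean is within s/6 of [m] and [x] at least s/3 away, so Jensen gives s^2/36 again. *)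
Lemma separated_outside (Phi : R -> R) : (forall x, `|x - m| <= s / 3 -> Phi x = 0) ->
  variance_separated Phi id m (s / 6) s.
Proof.
move=> P0 N p t p0 p1 h x Px.
have xm : s / 3 <= `|x - m|.
  by rewrite leNgt; apply/negP => /ltW/P0/eqP; exact/negP.
have := @jensen_sqr N p (fun j => t j - x) p0 p1.
rewrite (_ : \sum_(j < N) p j * (t j - x) = \sum_(j < N) p j * t j - x); last first.
  rewrite -[X in _ = _ - X]mul1r -[X in _ = _ - X * _]p1 mulr_suml -sumrB.
  by apply: eq_bigr => j _; rewrite mulrBr.
move: h; rewrite /=; set a := \sum_(j < N) p j * t j => h.
have : s / 6 <= `|a - x|.
  have := ler_normB (a - m) (a - x); rewrite (_ : a - m - (a - x) = x - m); last by ring.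
  lra.
rewrite -(real_normK (num_real (a - x))); move: `|a - x| => y ys.
have : s ^+ 2 / 36 <= y ^+ 2.
  rewrite (_ : s ^+ 2 / 36 = (s / 6) ^+ 2); last by field.
  by rewrite !expr2; have s6 : 0 <= s / 6; [by rewrite divr_ge0// ltW|apply: ler_pM].
have := sqr_ge0 s; lra.
Qed.

Variables (phi dphi : R -> R) (K Lam : R).
Hypotheses (dP : forall x : R, is_derive x 1 phi (dphi x)) (P1 : forall x, `|phi x| <= 1).
Hypotheses (dPK : forall x, `|dphi x| <= K) (Lam0 : 0 <= Lam).
Hypothesis dPL : forall u v, `|dphi u - dphi v| <= Lam * `|u - v|.

(** The derivative of phi * bump; [outer] is that of the rest. Both primitives stay bounded by 1,
    since the cutoff takes values in [0, 1]. *)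
Definition inner t := dphi t * bump m s t + phi t * bump_derivative m s t.
Definition outer t := dphi t - inner t.

Let K0 : 0 <= K := le_trans (normr_ge0 _) (dPK 0).

Let bump1 t : `|bump m s t| <= 1.
Proof. by have /andP[b0 b1] := bump_bound m s0 t; rewrite ger0_norm. Qed.

Let is_derive_cut (t : R) : is_derive t 1 (fun t => phi t * bump m s t) (inner t).
Proof.
have d1 := is_deriveM (dP t) (is_derive_bump m s t).
apply: (@is_derive_eq _ _ _ _ _ _ _ _ d1).
by rewrite /inner /GRing.scale /=; ring.
Qed.

(** The slope of the cutoff is at most 6/s, and 1 <= K s turns this into 6 K. *)
Lemma inner_antiderivative : 1 <= K * s -> antiderivative_pair (fun t => phi t * bump m s t) inner (7 * K).
Proof.
move=> Ks; split => t; first exact: is_derive_cut.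
  by rewrite normrM -[1]mul1r; apply: ler_pM.
apply: le_trans (ler_normD _ _) _; rewrite (normrM (dphi t)) (normrM (phi t)).
have h1 : `|dphi t| * `|bump m s t| <= K * 1 by apply: ler_pM.
have h2 : `|phi t| * `|bump_derivative m s t| <= 1 * (6 / s).
  by apply: ler_pM => //; exact: bump_derivative_bound.
have h3 : 6 / s <= 6 * K by rewrite ler_pdivrMr// -mulrA; lra.
lra.
Qed.

Lemma outer_antiderivative : 1 <= K * s ->
  antiderivative_pair (fun t => phi t - phi t * bump m s t) outer (8 * K).
Proof.
move=> Ks; split => t.
- exact: is_deriveB.
- rewrite (_ : _ - _ = phi t * (1 - bump m s t)); last by ring.
  have /andP[b0 b1] := bump_bound m s0 t.
  rewrite normrM -[X in _ <= X]mul1r; apply: ler_pM => //.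
  by rewrite ger0_norm; lra.
- apply: le_trans (ler_normB _ _) _.
  by have := Phi_bound (inner_antiderivative Ks) t; have := dPK t; lra.
Qed.

Lemma inner_lipschitz : exists2 L, 0 <= L & forall u v, `|inner u - inner v| <= L * `|u - v|.
Proof.
have b6 : 0 <= 6 / s by rewrite divr_ge0// ltW.
have l1 := product_lipschitz dPK bump1 dPL (derivative_lipschitz (is_derive_bump m s) (bump_derivative_bound m s0)).
have l2 := product_lipschitz P1 (bump_derivative_bound m s0) (derivative_lipschitz dP dPK) (bump_derivative_lipschitz m s0).
eexists; last first.
  move=> u v; rewrite /inner (_ : _ - _ = (dphi u * bump m s u - dphi v * bump m s v) +
    (phi u * bump_derivative m s u - phi v * bump_derivative m s v)); last by ring.
  by apply: le_trans (ler_normD _ _) _; apply: le_trans (lerD (l1 u v) (l2 u v)) _; rewrite -mulrDl.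
have c0 : 0 <= 3 / s by rewrite divr_ge0// ltW.
have c2 : 0 <= 3 / s * (32 * (3 / s)) by apply: mulr_ge0 => //; apply: mulr_ge0.
by apply: addr_ge0; apply: addr_ge0; rewrite ?mul1r//; exact: mulr_ge0.
Qed.

Lemma outer_lipschitz : exists2 L, 0 <= L & forall u v, `|outer u - outer v| <= L * `|u - v|.
Proof.
have [L L0 hL] := inner_lipschitz; exists (Lam + L); first exact: addr_ge0.
move=> u v; rewrite (_ : _ - _ = (dphi u - dphi v) - (inner u - inner v)); last by rewrite /outer; ring.
by apply: le_trans (ler_normB _ _) _; rewrite mulrDl; exact: lerD.
Qed.

Lemma inner_out x : 2 * s / 3 <= `|x - m| -> inner x = 0.
Proof. by move=> /(bump_out s0)[h1 h2]; rewrite /inner h1 h2; ring. Qed.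

Lemma outer_in x : `|x - m| <= s / 3 -> outer x = 0.
Proof. by move=> /(bump_in s0)[h1 h2]; rewrite /outer /inner h1 h2; ring. Qed.

End truncation.

(** The inner part is localized with (t - mu)^2 and the outer one with the identity; 15 = 7 + 8 adds
    their bounds. In dimension 0 the function is constant, against s > 0. *)
Lemma convex_set_estimate (R : realType) (d : nat) : (0 < d)%N ->
  exists2 C : R, 0 <= C & forall k (m : probability (borel 'rV[R]_k) R)
    (Q0 : set 'rV[R]_k) (B : R) (f : 'rV[R]_k -> R) (phi dphi : R -> R) (K Lam th mu s : R),
  @measurable _ (borel 'rV[R]_k) Q0 -> mid_convex Q0 ->
  (forall x : 'rV[R]_k, Q0 x -> forall i, `|x ord0 i| <= B) -> 0 < mass m Q0 ->
  borell m -> null_hyperplanes m -> poly_like d f ->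
  (forall x : R, is_derive x 1 phi (dphi x)) -> (forall x, `|phi x| <= 1) ->
  (forall x, `|dphi x| <= K) -> 0 <= Lam -> (forall u v, `|dphi u - dphi v| <= Lam * `|u - v|) ->
  Rintegral m Q0 f = mu * mass m Q0 ->
  Rintegral m Q0 (fun x => (f x - mu) ^+ 2) = s ^+ 2 * mass m Q0 ->
  0 < s -> 0 < th -> 1 <= K * s -> 1 <= th ^+ d * K * s ->
  Rintegral m Q0 (dphi \o f) <= C * (K * th) * mass m Q0.
Proof.
move=> d0; have [C C0 HC] := localized_estimate R d0.
exists (15 * C); first by rewrite mulr_ge0.
move=> [|k] m Q0 B f phi dphi K Lam th mu s mQ0 cQ0 QB Qp bm nm pf dP P1 dPK Lam0 dPL Ef Vf s0 th0 Ks Kth.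
  have fE : f = cst (f 0) by apply/funext => x; rewrite (thinmx0 x).
  have : Rintegral m Q0 f = f 0 * mass m Q0 by rewrite fE; exact: Jcst.
  rewrite Ef => /mulIf; rewrite gt_eqF// => /(_ isT) muE.
  move: Vf; rewrite (_ : Rintegral _ _ _ = 0).
    by move/esym/eqP; rewrite mulf_eq0 sqrf_eq0 !gt_eqF.
  rewrite (_ : (fun x => _) = cst 0); first by rewrite (Jcst mQ0) mul0r.
  by apply/funext => x; rewrite fE muE subrr expr0n.
have aI := inner_antiderivative mu s0 dP P1 dPK Ks.
have aO := outer_antiderivative mu s0 dP P1 dPK Ks.
have [L1 L10 I1] := inner_lipschitz mu s0 dP P1 dPK Lam0 dPL.
have [L2 L20 I2] := outer_lipschitz mu s0 dP P1 dPK Lam0 dPL.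
have [mf _ _] := pf.
have mass0 : mass m Q0 != 0 by rewrite gt_eqF.
have lipm g L : (forall u v, `|g u - g v| <= L * `|u - v|) -> measurable_fun setT (g \o f : borel 'rV[R]_k.+1 -> R).
  move=> gL; apply: measurableT_comp => //.
  by apply: continuous_measurable_fun; exact: lipschitz_continuous gL.
have K0 : 0 <= K := le_trans (normr_ge0 _) (dPK 0).
have more c : 1 <= c -> 1 <= th ^+ d * (c * K) * s.
  move=> c1; rewrite (_ : _ * s = c * (th ^+ d * K * s)); last by ring.
  by rewrite -[leLHS]mulr1; apply: ler_pM.
have hI := HC k m Q0 B f _ _ (fun t => (t - mu) ^+ 2) (7 * K) L1 th s (s ^+ 2 / 18)
  mQ0 cQ0 QB Qp bm nm pf aI L10 I1.
have hO := HC k m Q0 B f _ _ id (8 * K) L2 th s (s / 6) mQ0 cQ0 QB Qp bm nm pf aO L20 I2.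
have {}hI : Rintegral m Q0 (inner mu s phi dphi \o f) <= C * (7 * K * th) * mass m Q0.
  apply: hI => //.
  - by apply: measurable_funX; apply: measurable_funB.
  - move=> A; exists (2 * `|A| + 2 * `|mu|); first by rewrite addr_ge0// mulr_ge0.
    move=> u v uA vA; rewrite (_ : _ - _ = (u + v - 2 * mu) * (u - v)); last by ring.
    rewrite normrM; apply: ler_wpM2r => //.
    apply: le_trans (ler_normB _ _) _; rewrite normrM (ger0_norm (_ : 0 <= 2 :> R))// lerD2r.
    rewrite mulr_natl mulr2n; apply: le_trans (ler_normD u v) _.
    by apply: lerD; apply: le_trans (ler_norm A).
  - exact: ltW.
  - by apply: more; rewrite ler1n.
  - by rewrite divr_gt0// exprn_gt0.
  - rewrite (_ : Rintegral _ _ _ = s ^+ 2 * mass m Q0)// mulfK//.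
    by apply: separated_inside => // x; exact: inner_out.
have {}hO : Rintegral m Q0 (outer mu s phi dphi \o f) <= C * (8 * K * th) * mass m Q0.
  apply: hO => //.
  - by move=> A; exists 1 => // u v _ _; rewrite mul1r.
  - exact: ltW.
  - by apply: more; rewrite ler1n.
  - by rewrite divr_gt0.
  - rewrite (_ : Rintegral _ _ _ = mu * mass m Q0)// mulfK//.
    by apply: separated_outside => // x; exact: outer_in.
have bI : bounded_measurable (Q0 : set (borel 'rV[R]_k.+1)) (inner mu s phi dphi \o f).
  split; first exact: lipm I1.
  by exists (7 * K) => x _; exact: (Phi_bound aI).
have bO : bounded_measurable (Q0 : set (borel 'rV[R]_k.+1)) (outer mu s phi dphi \o f).
  split; first exact: lipm I2.
  by exists (8 * K) => x _; exact: (Phi_bound aO).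
rewrite (_ : Rintegral m Q0 (dphi \o f) = Rintegral m Q0 (inner mu s phi dphi \o f) +
    Rintegral m Q0 (outer mu s phi dphi \o f)).
  apply: le_trans (lerD hI hO) _; rewrite le_eqVlt; apply/orP; left; apply/eqP; ring.
rewrite -(JD mQ0 (@subset_refl _ _))//; apply: eq_Rintegral => x _.
by rewrite /outer /= addrC subrK.
Qed.

(** * Approximation by polynomial functionals *)

Section square_integrable.
Context d (T : measurableType d) (R : realType) (m : probability T R).
Local Notation J Q g := (\int[m]_(x in Q) g x)%R.

Definition integrable_real (g : T -> R) := m.-integrable [set: T] (EFin \o g).

Definition square_integrable (g : T -> R) :=
  measurable_fun [set: T] g /\ integrable_real (fun x => g x ^+ 2).

Lemma integrable_realS Q g : measurable Q -> integrable_real g -> m.-integrable Q (EFin \o g).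
Proof. by move=> mQ; exact: integrableS. Qed.

Lemma integrable_realD f g : integrable_real f -> integrable_real g ->
  integrable_real (fun x => f x + g x).
Proof. by move=> hf hg; exact: (integrableD measurableT hf hg). Qed.

Lemma integrable_realZ c f : integrable_real f -> integrable_real (fun x => c * f x).
Proof. by move=> hf; exact: (integrableZl measurableT c hf). Qed.

Lemma integrable_real_cst c : integrable_real (cst c).
Proof. exact: (bounded_integrable measurableT (@subset_refl _ _) (bounded_measurable_cst setT c)). Qed.

Lemma integrable_real_le (f g : T -> R) : measurable_fun [set: T] f -> (forall x, `|f x| <= g x) ->
  integrable_real g -> integrable_real f.
Proof.
move=> mf fg; apply: le_integrable => //; first exact: measurableT_comp.
by move=> x _ /=; rewrite lee_fin (le_trans (fg x))// ler_norm.
Qed.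

Lemma square_integrable_cst c : square_integrable (cst c).
Proof. by split => //; exact: (integrable_real_cst (c ^+ 2)). Qed.

Lemma square_integrableM f g : square_integrable f -> square_integrable g ->
  integrable_real (fun x => f x * g x).
Proof.
move=> [mf f2] [mg g2]; apply: (@integrable_real_le _ (fun x => f x ^+ 2 + g x ^+ 2)).
- exact: measurable_funM.
- move=> x; rewrite normrM -(real_normK (num_real (f x))) -(real_normK (num_real (g x))).
  have := sqr_ge0 (`|f x| - `|g x|); have := normr_ge0 (f x); have := normr_ge0 (g x); nra.
- exact: integrable_realD.
Qed.

Lemma square_integrable_integrable f : square_integrable f -> integrable_real f.
Proof.
move=> sf; have := square_integrableM sf (square_integrable_cst 1).
by rewrite /integrable_real; under [EFin \o (fun x => f x * _)]eq_fun do rewrite /= mulr1.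
Qed.

Lemma square_integrableD f g : square_integrable f -> square_integrable g ->
  square_integrable (fun x => f x + g x).
Proof.
move=> [mf f2] [mg g2]; split; first exact: measurable_funD.
apply: (@integrable_real_le _ (fun x => 2 * f x ^+ 2 + 2 * g x ^+ 2)).
- by apply: measurable_funX; exact: measurable_funD.
- move=> x; rewrite ger0_norm ?sqr_ge0//; have := sqr_ge0 (f x - g x); nra.
- by apply: integrable_realD; exact: integrable_realZ.
Qed.

Lemma square_integrableB f g : square_integrable f -> square_integrable g ->
  square_integrable (fun x => f x - g x).
Proof.
move=> sf [mg g2]; apply: square_integrableD => //; split; first exact: measurableT_comp.
by under [fun x => _]eq_fun do rewrite sqrrN.
Qed.

Lemma variance_le (f : T -> R) a : square_integrable f ->
  J setT (fun x => (f x - J setT f) ^+ 2) <= J setT (fun x => (f x - a) ^+ 2).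
Proof.
move=> sf; set M := J setT f; have if1 := square_integrable_integrable sf.
have sM := square_integrableB sf (square_integrable_cst M).
rewrite (_ : J setT (fun x => (f x - a) ^+ 2) = J setT (fun x => (f x - M) ^+ 2) +
   J setT (fun x => 2 * (M - a) * (f x - M)) + J setT (cst ((M - a) ^+ 2))).
  have mass1 : mass m setT = 1 by rewrite /mass probability_setT.
  rewrite RintegralZl//; last exact: square_integrable_integrable sM.
  rewrite RintegralB//; last exact: integrable_real_cst.
  rewrite !(Jcst measurableT) mass1 !mulr1 subrr mulr0 addr0 lerDl; exact: sqr_ge0.
have i2 : integrable_real (fun x => 2 * (M - a) * (f x - M)).
  by apply: integrable_realZ; exact: square_integrable_integrable sM.
have [_ i1] := sM.
rewrite -RintegralD// -RintegralD//; last 2 first.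
- exact: integrable_realD.
- exact: integrable_real_cst.
by apply: eq_Rintegral => x _; rewrite /=; ring.
Qed.

(** The weight f^2 + 1 controls the discarded mass and the discarded second moment at once. *)
Lemma small_tail (f : T -> R) (D : nat -> set T) (del : R) : square_integrable f ->
  (forall n, measurable (D n)) -> (forall x, exists n0, forall n, (n0 <= n)%N -> D n x) -> 0 < del ->
  exists n, J (~` D n) (fun x => f x ^+ 2 + 1) <= del.
Proof.
move=> [mf f2] mD Dx del0.
pose w x := f x ^+ 2 + 1.
have iw : integrable_real w by apply: integrable_realD => //; exact: integrable_real_cst.
have mw : measurable_fun setT w by apply: measurable_funD => //; exact: measurable_funX.
have mC n : measurable (~` D n) by exact: measurableC.
have w0 x : 0 <= w x by rewrite addr_ge0// sqr_ge0.
pose g n x := (w x * \1_(~` D n) x)%:E.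
have [|||||_ _] // := @dominated_convergence _ T R m setT measurableT g (cst 0%E) (EFin \o w).
- move=> n; apply/measurable_EFinP; apply: measurable_funM => //; exact: measurable_indic.
- apply: aeW => x _; apply: cvg_near_cst; have [n0 hn] := Dx x.
  by exists n0 => // n /= n0n; rewrite /g indicE memNset ?mulr0// => h; apply: h; exact: hn.
- apply: aeW => x n _; rewrite /g /= lee_fin normrM indicE (ger0_norm (w0 x)).
  by case: (_ \in _); rewrite ?normr1 ?normr0 ?mulr1 ?mulr0.
rewrite integral0 => /fine_cvgP[_] /cvgrPdist_le/(_ _ del0)[n _ /(_ n (leqnn n)) h]; exists n.
move: h => /=; rewrite sub0r normrN => h; apply: le_trans h.
apply: le_trans (ler_norm _); rewrite -/(Rintegral m setT (fun x => w x * \1_(~` D n) x)).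
by rewrite J_restrict setTI.
Qed.

End square_integrable.

Section approximation.
Context d (T : measurableType d) (R : realType) (m : probability T R).
Local Notation J Q g := (\int[m]_(x in Q) g x)%R.

Lemma Rintegral_split (g : T -> R) D : integrable_real m g -> measurable D ->
  J setT g = J D g + J (~` D) g.
Proof.
move=> ig mD; rewrite -Rintegral_setU//; last 3 first.
- exact: measurableC.
- by rewrite setUv.
- by apply/disj_setPS; rewrite setICr.
by rewrite setUv.
Qed.

Lemma Rintegral_sub (g : T -> R) D : integrable_real m g -> measurable D -> (forall x, 0 <= g x) ->
  J D g <= J setT g.
Proof. by move=> ig mD g0; rewrite (Rintegral_split ig mD) lerDl Rintegral_ge0. Qed.

Variables (f p : T -> R) (D : set T) (eps del : R).
Hypotheses (sf : square_integrable m f) (mp : measurable_fun setT p) (mD : measurable D).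
Hypotheses (pD : exists B, forall x, D x -> `|p x| <= B).
Hypotheses (fp2 : integrable_real m (fun x => (f x - p x) ^+ 2)).
Hypotheses (fpe : J setT (fun x => (f x - p x) ^+ 2) <= eps).
Hypotheses (tail : J (~` D) (fun x => f x ^+ 2 + 1) <= del) (del2 : del <= 2^-1).

Let bp : bounded_measurable D p. Proof. by split. Qed.

Let mC : measurable (~` D). Proof. exact: measurableC. Qed.

Let iw : integrable_real m (fun x => f x ^+ 2 + 1).
Proof. by apply: integrable_realD; [exact: sf.2|exact: integrable_real_cst]. Qed.

Let mass_tail : mass m (~` D) <= del.
Proof.
apply: le_trans tail; rewrite -[mass m _]mul1r -(Jcst mC); apply: le_Rintegral => //.
- by apply: integrable_realS => //; exact: integrable_real_cst.
- exact: integrable_realS.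
- by move=> x _; rewrite lerDr sqr_ge0.
Qed.

Lemma mass_approximation : 2^-1 <= mass m D.
Proof.
have M1 : mass m setT = 1 by rewrite /mass probability_setT.
have := mass_cut (m := m) measurableT mD; rewrite !setTI M1.
move: mass_tail del2; move: (mass m D) (mass m (~` D)) => a b h1 h2 h3.
lra.
Qed.

Lemma bounded_approximation (dphi : R -> R) K Lam : measurable_fun setT dphi ->
  (forall x, `|dphi x| <= K) -> (forall u v, `|dphi u - dphi v| <= Lam * `|u - v|) ->
  let I := J setT (dphi \o f) in 0 < I -> 2 * Lam ^+ 2 * eps <= I ^+ 2 / 8 -> K * del <= I / 4 ->
  I / 2 <= J D (dphi \o p).
Proof.
move=> mphi bphi lphi I I0 he hd.
have bf : bounded_measurable (setT : set T) (dphi \o f).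
  by split; [apply: measurableT_comp => //; exact: sf.1|exists K => x _; exact: bphi].
have bfD : bounded_measurable D (dphi \o f).
  by split; [apply: measurableT_comp => //; exact: sf.1|exists K => x _; exact: bphi].
have bpD : bounded_measurable D (dphi \o p).
  by split; [exact: measurableT_comp|exists K => x _; exact: bphi].
have K0 : 0 <= K := le_trans (normr_ge0 _) (bphi 0).
have DD : D `<=` D by [].
have cut : I = J D (dphi \o f) + J (~` D) (dphi \o f).
  by rewrite /I (J_cut measurableT (@subset_refl _ _) mD bf) !setTI.
have h1 : J (~` D) (dphi \o f) <= I / 4.
  have := J_bound (m := m) mC (fun x _ => Logic.I : setT x) bf (fun x _ => bphi (f x)).
  have := ler_wpM2l K0 mass_tail; have := ler_norm (J (~` D) (dphi \o f)); lra.
(* Young's inequality Lam u <= I/8 + (2 Lam^2 / I) u^2 turns the L^2 distance into a loss of at most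
   I/4; the complement of [D] costs another I/4. *)
pose c := 2 * Lam ^+ 2 / I.
have h2 : J D (fun x => (dphi \o f) x - (dphi \o p) x) <= J D (fun x => I / 8 + c * (f x - p x) ^+ 2).
  apply: le_Rintegral => //.
  - by apply: (bounded_integrable mD DD); exact: bounded_measurableB.
  - apply: integrable_realS => //; apply: integrable_realD; first exact: (integrable_real_cst m (I / 8)).
    exact: integrable_realZ.
  move=> x _ /=; apply: le_trans (ler_norm _) (le_trans (lphi _ _) _).
  rewrite -(real_normK (num_real (f x - p x))); move: `|f x - p x| => u.
  rewrite -subr_ge0 (_ : _ - _ = (I / 4 - Lam * u) ^+ 2 * (2 / I)).
    by rewrite mulr_ge0 ?sqr_ge0// divr_ge0// ltW.
  by rewrite /c; field; rewrite gt_eqF.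
have h3 : J D (fun x => I / 8 + c * (f x - p x) ^+ 2) <= I / 8 + I / 8.
  have c0 : 0 <= c by apply: divr_ge0; [rewrite mulr_ge0 ?sqr_ge0|exact: ltW].
  apply: le_trans (Rintegral_sub _ mD _) _.
  - apply: integrable_realD; first exact: (integrable_real_cst m (I / 8)).
    exact: integrable_realZ.
  - by move=> x; apply: addr_ge0; [apply: divr_ge0 => //; exact: ltW|rewrite mulr_ge0 ?sqr_ge0].
  have J1 : J setT (fun=> I / 8) = I / 8.
    have M1 : mass m setT = 1 by rewrite /mass probability_setT.
    by rewrite -[RHS]mulr1 -M1; exact: Jcst.
  rewrite RintegralD//; last 2 first.
  - exact: (integrable_real_cst m (I / 8)).
  - exact: integrable_realZ.
  rewrite J1 RintegralZl// lerD2l.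
  apply: (le_trans (ler_wpM2l c0 fpe)).
  by rewrite /c mulrAC ler_pdivrMr// (_ : I / 8 * I = I ^+ 2 / 8)//; ring.
have h4 : J D (fun x => (dphi \o f) x - (dphi \o p) x) = J D (dphi \o f) - J D (dphi \o p).
  exact: (JB mD DD).
by move: h1 h2 h3; rewrite h4; lra.
Qed.

(** The variance is at most the second moment of [f] about [a], the mean of [p] on [D]. On [D] this
    compares with [p] up to eps; off [D] the tail controls it, since mass at least 1/2 gives a^2 <=
    4 S + 4 eps. *)
Lemma variance_approximation : let V := J setT (fun x => (f x - J setT f) ^+ 2) in
  2 * eps <= V / 8 -> 2 * (1 + (4 * J setT (fun x => f x ^+ 2) + 4 * eps)) * del <= V / 8 ->
  V / 4 * mass m D <= J D (fun x => (p x - J D p / mass m D) ^+ 2).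
Proof.
move=> V he hd; set M := mass m D; set a := J D p / M; set S := J setT (fun x => f x ^+ 2) in hd.
have DD : D `<=` D by [].
have M2 : 2^-1 <= M := mass_approximation.
have M1 : M <= 1.
  have MT : mass m setT = 1 by rewrite /mass probability_setT.
  have := mass_cut (m := m) measurableT mD; rewrite !setTI MT -/M.
  have := mass_ge0 (m := m) (~` D); lra.
have M0 : 0 < M by lra.
have i2 := sf.2; have ip2 := bounded_integrable (m := m) mD DD (bounded_measurableX 2 bp).
have ifD : m.-integrable D (EFin \o (fun x => 2 * f x ^+ 2 + 2 * (f x - p x) ^+ 2)).
  by apply: integrable_realS => //; apply: integrable_realD; exact: integrable_realZ.
have a2 : a ^+ 2 <= 4 * S + 4 * eps.
  have h1 : J D (fun x => p x ^+ 2) <= 2 * S + 2 * eps.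
    apply: (@le_trans _ _ (J D (fun x => 2 * f x ^+ 2 + 2 * (f x - p x) ^+ 2))).
      apply: le_Rintegral => // x _; have := sqr_ge0 (2 * f x - p x); lra.
    apply: le_trans (Rintegral_sub _ mD _) _.
    - by apply: integrable_realD; exact: integrable_realZ.
    - by move=> x; rewrite addr_ge0// mulr_ge0// sqr_ge0.
    rewrite RintegralD//; last 2 first.
    - exact: integrable_realZ.
    - exact: integrable_realZ.
    by rewrite !RintegralZl// lerD2l ler_pM2l.
  have := cauchy_schwarz (m := m) mD DD bp (bounded_measurable_cst D 1).
  rewrite (_ : Rintegral m D (fun x => p x * cst 1 x) = a * M); last first.
    by rewrite divfK ?gt_eqF//; apply: eq_Rintegral => x _; rewrite mulr1.
  rewrite (_ : Rintegral m D (fun x => cst 1 x ^+ 2) = M); last first.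
    rewrite -[RHS]mul1r -(Jcst mD); apply: eq_Rintegral => x _; exact: expr1n.
  rewrite exprMn [M ^+ 2]expr2 mulrA ler_pM2r// => h2.
  have h3 : a ^+ 2 * 2^-1 <= a ^+ 2 * M by apply: ler_wpM2l => //; exact: sqr_ge0.
  lra.
have sa := square_integrableB sf (square_integrable_cst m a).
have h1 : V <= J D (fun x => (f x - a) ^+ 2) + J (~` D) (fun x => (f x - a) ^+ 2).
  by rewrite -(Rintegral_split sa.2 mD); exact: variance_le.
have ba : bounded_measurable D (fun x => (p x - a) ^+ 2).
  by apply: bounded_measurableX; apply: bounded_measurableB => //; exact: bounded_measurable_cst.
have h2 : J D (fun x => (f x - a) ^+ 2) <= 2 * J D (fun x => (p x - a) ^+ 2) + 2 * eps.
  have ipa : m.-integrable D (EFin \o (fun x => 2 * (p x - a) ^+ 2)).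
    by apply: (bounded_integrable mD DD); apply: bounded_measurableM => //; exact: bounded_measurable_cst.
  have ifp : m.-integrable D (EFin \o (fun x => 2 * (f x - p x) ^+ 2)).
    by apply: integrable_realS => //; exact: integrable_realZ.
  apply: (@le_trans _ _ (J D (fun x => 2 * (p x - a) ^+ 2 + 2 * (f x - p x) ^+ 2))).
    apply: le_Rintegral => //.
    - by apply: integrable_realS => //; exact: sa.2.
    - exact: (integrableD mD ipa ifp).
    - by move=> x _; have := sqr_ge0 (p x - a - (f x - p x)); rewrite /=; nra.
  rewrite RintegralD// !RintegralZl//; last 2 first.
  - exact: integrable_realS.
  - exact: (bounded_integrable mD DD).
  rewrite lerD2l ler_pM2l//; apply: le_trans fpe.
  by apply: Rintegral_sub => // x; exact: sqr_ge0.
have h3 : J (~` D) (fun x => (f x - a) ^+ 2) <= V / 8.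
  apply: le_trans hd.
  apply: (@le_trans _ _ (2 * (1 + a ^+ 2) * J (~` D) (fun x => f x ^+ 2 + 1))).
    rewrite -RintegralZl//; last exact: integrable_realS.
    apply: le_Rintegral => //.
    - by apply: integrable_realS => //; exact: sa.2.
    - by apply: integrable_realS => //; exact: integrable_realZ.
    - move=> x _; have := sqr_ge0 (f x + a); have := sqr_ge0 (a * f x); rewrite /=; nra.
  apply: ler_pM => //.
  - by rewrite mulr_ge0// addr_ge0// sqr_ge0.
  - by apply: Rintegral_ge0 => x _; rewrite addr_ge0// sqr_ge0.
  - by rewrite ler_pM2l// lerD2l.
have V0 : 0 <= V by apply: Rintegral_ge0 => x _; exact: sqr_ge0.
have : V / 4 * M <= V / 4 by rewrite ler_piMr// divr_ge0.
by move: h1 h2 h3 he V0; lra.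
Qed.

End approximation.

(** Both integrals are integrals against the common image law, treated separately for positive and
    negative parts. *)
Lemma integral_transfer d1 d2 d3 (T1 : measurableType d1) (T2 : measurableType d2) (T : measurableType d3)
    (R : realType) (m1 : {measure set T1 -> \bar R}) (m2 : {measure set T2 -> \bar R})
    (F1 : T1 -> T) (F2 : T2 -> T) :
  measurable_fun setT F1 -> measurable_fun setT F2 ->
  (forall B, measurable B -> m1 (F1 @^-1` B) = m2 (F2 @^-1` B)) ->
  forall B (g : T -> R), measurable B -> measurable_fun setT g ->
  (\int[m1]_(x in F1 @^-1` B) g (F1 x) = \int[m2]_(x in F2 @^-1` B) g (F2 x))%R.
Proof.
move=> mF1 mF2 E B g mB mg; rewrite /Rintegral; congr fine.
have [m1' [E1 I1]] := pushforward_measureP m1 mF1.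
have [m2' [E2 I2]] := pushforward_measureP m2 mF2.
have same (h : T -> \bar R) : (\int[m1']_y h y = \int[m2']_y h y)%E.
  apply: eq_measure_integral => A mA _; rewrite E1 E2; exact: E.
pose H := (EFin \o g) \_ B.
have mH : measurable_fun setT H.
  apply/(measurable_restrictT _ mB); apply/measurable_EFinP; exact: measurable_funTS.
have restr d' (T' : measurableType d') (F : T' -> T) :
    (fun x => (g (F x))%:E) \_ (F @^-1` B) = H \o F.
  apply/funext => x; rewrite /H /= !patchE.
  by case: (pselect (B (F x))) => h; [rewrite !mem_set|rewrite !memNset].
rewrite integral_mkcond [RHS]integral_mkcond !restr [LHS]integralE [RHS]integralE.
have nonneg (h : T -> \bar R) : measurable_fun setT h -> (forall y, 0 <= h y)%E ->
    (\int[m1]_x h (F1 x) = \int[m2]_x h (F2 x))%E.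
  by move=> mh h0; rewrite -I1// -I2.
have hp := nonneg _ (measurable_funepos mH) (fun y => funepos_ge0 H y).
have hn := nonneg _ (measurable_funeneg mH) (fun y => funeneg_ge0 H y).
have part d' (T' : measurableType d') (F : T' -> T) :
    ((H \o F)^\+ = H^\+ \o F /\ (H \o F)^\- = H^\- \o F)%E.
  by split; apply/funext => x; rewrite ?funeposE ?funenegE /= ?funeposE ?funenegE.
have [-> ->] := part _ _ F1; have [-> ->] := part _ _ F2.
exact: (congr2 (fun a b => a - b)%E hp hn).
Qed.

Section poly_like_closure.
Variables (R : realType) (k : nat).
Implicit Types (f g : 'rV[R]_k -> R) (d : nat).

Lemma poly_like_bound d f (B : R) : poly_like d f ->
  exists2 b, 0 <= b & forall y : 'rV[R]_k, (forall i, `|y ord0 i| <= B) -> `|f y| <= b.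
Proof.
move=> [_ /(_ `|B|)[L L0 fL] _].
exists (`|f 0| + L * \sum_(i < k) `|B|); first by rewrite addr_ge0// mulr_ge0// sumr_ge0.
move=> y yB; have y1 i : `|y ord0 i| <= `|B| by apply: le_trans (yB i) (ler_norm _).
have z1 i : `|(0 : 'rV[R]_k) ord0 i| <= `|B| by rewrite mxE normr0.
have h1 := fL y 0 y1 z1.
have h2 : L * \sum_i `|y ord0 i - (0 : 'rV[R]_k) ord0 i| <= L * \sum_(i < k) `|B|.
  by apply: ler_wpM2l => //; apply: ler_sum => i _; rewrite mxE subr0.
have := ler_normD (f y - f 0) (f 0); rewrite subrK; lra.
Qed.

Lemma poly_like_leq d d' f : (d <= d')%N -> poly_like d f -> poly_like d' f.
Proof.
move=> dd' [mf lf pf]; split=> // u v; have [q sq qE] := pf u v; exists q => //.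
exact: leq_trans sq _.
Qed.

Lemma poly_like_cst d c : poly_like d (fun _ : 'rV[R]_k => c).
Proof.
split=> [|B|u v]; first exact: measurable_cst.
  by exists 0 => // y z _ _; rewrite subrr normr0 mul0r.
by exists c%:P => [|t]; rewrite ?hornerC// (leq_trans (size_polyC_leq1 _)).
Qed.

Lemma poly_likeD d f g : poly_like d f -> poly_like d g -> poly_like d (fun y => f y + g y).
Proof.
move=> [mf lf pf] [mg lg pg]; split=> [|B|u v]; first exact: measurable_funD.
  have [L L0 fL] := lf B; have [L' L'0 gL] := lg B.
  exists (L + L') => [|y z yB zB]; first exact: addr_ge0.
  rewrite (_ : _ - _ = (f y - f z) + (g y - g z)); last by ring.
  by apply: le_trans (ler_normD _ _) _; rewrite mulrDl; apply: lerD; [exact: fL|exact: gL].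
have [q sq qE] := pf u v; have [q' sq' q'E] := pg u v.
exists (q + q') => [|t]; last by rewrite hornerD qE q'E.
by apply: leq_trans (size_polyD _ _) _; rewrite geq_max sq.
Qed.

Lemma poly_likeM d d' f g : poly_like d f -> poly_like d' g -> poly_like (d + d') (fun y => f y * g y).
Proof.
move=> hf hg; have [mf lf pf] := hf; have [mg lg pg] := hg; split=> [|B|u v]; first exact: measurable_funM.
  have [L L0 fL] := lf B; have [L' L'0 gL] := lg B.
  have [b b0 fb] := poly_like_bound B hf; have [b' b'0 gb] := poly_like_bound B hg.
  exists (b * L' + b' * L) => [|y z yB zB]; first by rewrite addr_ge0// mulr_ge0.
  rewrite (_ : _ - _ = f y * (g y - g z) + g z * (f y - f z)); last by ring.
  apply: le_trans (ler_normD _ _) _; rewrite mulrDl !normrM -!mulrA.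
  by apply: lerD; apply: ler_pM => //; [exact: fb|exact: gL|exact: gb|exact: fL].
have [q sq qE] := pf u v; have [q' sq' q'E] := pg u v.
exists (q * q') => [|t]; last by rewrite hornerM qE q'E.
apply: leq_trans (size_polyMleq _ _) _; move: sq sq'; move: (size q) (size q') => a b; lia.
Qed.

Lemma poly_like_sum d (I : Type) (s : seq I) (f : I -> 'rV[R]_k -> R) (P : pred I) : all P s ->
  (forall i, P i -> poly_like d (f i)) -> poly_like d (fun y => \sum_(i <- s) f i y).
Proof.
move=> + hf; elim: s => [_|i s IHs /= /andP[Pi Ps]].
  by under eq_fun do rewrite big_nil; exact: poly_like_cst.
by under eq_fun do rewrite big_cons; apply: poly_likeD; [exact: hf|exact: IHs].
Qed.

Lemma poly_like_prod (I : Type) (s : seq I) (f : I -> 'rV[R]_k -> R) :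
  (forall i, poly_like 1 (f i)) -> poly_like (size s) (fun y => \prod_(i <- s) f i y).
Proof.
move=> hf; elim: s => [|i s IHs].
  by under eq_fun do rewrite big_nil; exact: poly_like_cst.
by under eq_fun do rewrite big_cons; rewrite -[size _]add1n; exact: poly_likeM.
Qed.

Lemma poly_like_affine n (A : 'M[R]_(k, n)) (c : 'rV[R]_n) i :
  poly_like 1 (fun y : 'rV[R]_k => (y *m A + c) ord0 i).
Proof.
have E (y : 'rV[R]_k) : (y *m A + c) ord0 i = \sum_j y ord0 j * A j i + c ord0 i by rewrite !mxE.
split=> [|B|u v].
- under eq_fun do rewrite E.
  apply: measurable_funD => //; apply: measurable_sum => j.
  by apply: measurable_funM => //; exact: measurable_coord.
- exists (\sum_j `|A j i|) => [|y z _ _]; first exact: sumr_ge0.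
  rewrite !E (_ : _ - _ = \sum_j (y ord0 j - z ord0 j) * A j i); last first.
    rewrite opprD addrACA subrr addr0 -sumrB; apply: eq_bigr => j _; ring.
  apply: le_trans (ler_norm_sum _ _ _) _; rewrite mulr_sumr; apply: ler_sum => j _.
  rewrite normrM mulrC; apply: ler_wpM2r => //.
  by rewrite (bigD1 j)//= lerDl sumr_ge0.
- exists (((v *m A) ord0 i) *: 'X + ((u *m A + c) ord0 i)%:P) => [|t].
    apply: leq_trans (size_polyD _ _) _; rewrite geq_max (leq_trans (size_polyC_leq1 _))// andbT.
    by apply: leq_trans (size_scale_leq _ _) _; rewrite size_polyX.
  by rewrite hornerD hornerZ hornerX hornerC mulmxDl -scalemxAl !mxE; ring.
Qed.

(** The polynomial as a function of the values of the functionals, so that it can be read both on E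
    and in the parameters of their joint law. *)
Definition monomial_sum n (s : seq (R * seq 'I_n)) (v : 'rV[R]_n) : R :=
  \sum_(m <- s) m.1 * \prod_(i <- m.2) v ord0 i.

Lemma poly_like_monomial_sum n d (s : seq (R * seq 'I_n)) (A : 'M[R]_(k, n)) (c : 'rV[R]_n) :
  all (fun m => size m.2 <= d)%N s -> poly_like d (fun y : 'rV[R]_k => monomial_sum s (y *m A + c)).
Proof.
move=> sd; apply: (poly_like_sum sd) => -[a l] /= ld.
apply: (poly_like_leq ld); rewrite -[size l]add0n; apply: poly_likeM; first exact: poly_like_cst.
by apply: poly_like_prod => i; exact: poly_like_affine.
Qed.

End poly_like_closure.

Lemma measurable_monomial_sum (R : realType) n (s : seq (R * seq 'I_n)) :
  measurable_fun [set: borel 'rV[R]_n] (monomial_sum s).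
Proof.
apply: measurable_sum => -[a l]; apply: measurable_funM => //.
by apply: measurable_prod => i _; exact: measurable_coord.
Qed.

Lemma continuous_row (R : realType) (T : topologicalType) n (g : T -> 'rV[R]_n) :
  (forall i, continuous (fun x => g x ord0 i)) -> continuous g.
Proof.
move=> cg x S [P MP sPS].
have : nbhs x [set y | forall i, P ord0 i (g y ord0 i)].
  by apply: filter_forall => i; exact: (cg i x _ (MP ord0 i)).
by apply: filterS => y h; apply: sPS => i j; rewrite (ord1 i); exact: h.
Qed.

Section locally_convex.
Variables (R : realType) (E : tvsType R).

Lemma measurable_continuous_functional (l : E -> R) :
  continuous l -> measurable_fun [set: borelE E] (l : borelE E -> R).
Proof.
move=> /continuousP cl; apply: (measurability _ (RGenOpens.measurableE R)).
move=> _ [_ [a [b ->]] <-]; rewrite setTI.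
by apply: sub_sigma_algebra; exact/cl/interval_open.
Qed.

Variables (n : nat) (l : 'I_n -> E -> R).
Hypotheses (ll : forall i, linear (l i : E -> R^o)) (cl : forall i, continuous (l i)).

Definition row_map (x : E) : 'rV[R]_n := \row_i l i x.

Lemma linear_row_map : linear row_map.
Proof. by move=> a x y; apply/rowP => i; rewrite !mxE (ll i). Qed.

Lemma continuous_row_map : continuous row_map.
Proof.
apply: continuous_row => i; rewrite (_ : (fun x => _) = l i)//.
by apply/funext => x; rewrite mxE.
Qed.

Lemma measurable_row_map : measurable_fun [set: borelE E] (row_map : borelE E -> borel 'rV[R]_n).
Proof.
apply: measurable_rV => i; rewrite (_ : (fun x => _) = l i); last by apply/funext => x; rewrite mxE.
exact: measurable_continuous_functional.
Qed.

End locally_convex.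

Section affine_slab.
Variables (R : realType) (k n : nat) (A : 'M[R]_(k, n)) (c : 'rV[R]_n) (M : R).
Let aff (y : 'rV[R]_k) := y *m A + c.

Definition cube (j : nat) : set 'rV[R]_j := box (const_mx (- M)) (const_mx M).

Lemma cubeE j (v : 'rV[R]_j) : cube v <-> forall i, `|v ord0 i| <= M.
Proof.
by split => h i; have := h i; rewrite /= !mxE ler_norml.
Qed.

Lemma measurable_affine : measurable_fun [set: borel 'rV[R]_k] (aff : borel 'rV[R]_k -> borel 'rV[R]_n).
Proof. by apply: measurable_rV => i; have [] := poly_like_affine A c i. Qed.

Lemma mid_convex_affine : mid_convex (aff @^-1` @cube n).
Proof.
move=> x y /= /cubeE hx /cubeE hy; apply/cubeE => i.
rewrite (_ : aff _ ord0 i = 2^-1 * (aff x ord0 i) + 2^-1 * (aff y ord0 i)); last first.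
  by rewrite /aff -scalemxAl mulmxDl !mxE; field.
apply: le_trans (ler_normD _ _) _; rewrite !normrM ger0_norm ?invr_ge0//.
by have := hx i; have := hy i; lra.
Qed.

(** A right inverse of [A] recovers [y] from its image. *)
Lemma bounded_affine : row_free A -> exists B : R, forall y, (aff @^-1` @cube n) y ->
  forall j, `|y ord0 j| <= B.
Proof.
move=> /row_freeP[B AB]; exists (\sum_j \sum_i (M + `|c ord0 i|) * `|B i j|) => y /cubeE hy j.
have yE : y = (aff y - c) *m B by rewrite /aff addrK -mulmxA AB mulmx1.
apply: (@le_trans _ _ (\sum_i (M + `|c ord0 i|) * `|B i j|)).
  rewrite [in leLHS]yE mxE; apply: le_trans (ler_norm_sum _ _ _) _; apply: ler_sum => i _.
  rewrite normrM; apply: ler_wpM2r => //.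
  rewrite (_ : (aff y - c) ord0 i = aff y ord0 i - c ord0 i); last by rewrite [LHS]mxE; congr (_ + _); rewrite mxE.
  by apply: le_trans (ler_normB _ _) _; rewrite lerD2r; exact: hy.
have MB i : 0 <= M + `|c ord0 i| by rewrite addr_ge0// (le_trans (normr_ge0 _) (hy i)).
rewrite (bigD1 j)//= lerDl; apply: sumr_ge0 => j' _; apply: sumr_ge0 => i _.
by rewrite mulr_ge0.
Qed.

End affine_slab.

(** Only the joint law of the functionals matters. In the parameters of its support the slab becomes
    a bounded convex set, because the parametrization is injective. *)
Lemma functional_estimate (R : realType) (d : nat) : (0 < d)%N ->
  exists2 C : R, 0 <= C & forall (E : tvsType R) (mu : probability (borelE E) R)
    n (l : 'I_n -> E -> R) (t : seq (R * seq 'I_n)) (M : R) (phi dphi : R -> R) (K Lam th s : R),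
  log_concave mu -> (forall i, linear (l i : E -> R^o)) -> (forall i, continuous (l i)) ->
  all (fun m => size m.2 <= d)%N t ->
  (forall x : R, is_derive x 1 phi (dphi x)) -> (forall x, `|phi x| <= 1) ->
  (forall x, `|dphi x| <= K) -> 0 <= Lam -> (forall u v, `|dphi u - dphi v| <= Lam * `|u - v|) ->
  let D : set (borelE E) := row_map l @^-1` @cube R M n in
  let p : borelE E -> R := fun x => monomial_sum t (row_map l x) in
  0 < mass mu D ->
  Rintegral mu D (fun x => (p x - Rintegral mu D p / mass mu D) ^+ 2) = s ^+ 2 * mass mu D ->
  0 < s -> 0 < th -> 1 <= K * s -> 1 <= th ^+ d * K * s ->
  Rintegral mu D (dphi \o p) <= C * (K * th) * mass mu D.
Proof.
move=> d0; have [C C0 HC] := convex_set_estimate R d0.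
exists C => // E mu n l t M phi dphi K Lam th s lc ll cl td dP P1 dPK Lam0 dPL D p Dp Vp s0 th0 Ks Kth.
have lcn := lc n _ (linear_row_map ll) (continuous_row_map cl).
have nu1 : mu (row_map l @^-1` setT) = 1%E by rewrite preimage_setT probability_setT.
have [k [A [c [m [nuE Af bm nm]]]]] := log_concave_Rn_param lcn nu1.
have mC : @measurable _ (borel 'rV[R]_n) (@cube R M n) by exact: measurable_box.
have maff := measurable_affine A c; have mrow := measurable_row_map cl.
pose Q0 : set 'rV[R]_k := (fun y => y *m A + c) @^-1` @cube R M n.
have mQ0 : @measurable _ (borel 'rV[R]_k) Q0 by rewrite -[X in measurable X]setTI; exact: maff.
have massQ : mass m Q0 = mass mu D by rewrite /mass -nuE.
pose f (y : 'rV[R]_k) := monomial_sum t (y *m A + c).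
have tr (g : R -> R) : measurable_fun setT g -> Rintegral mu D (g \o p) = Rintegral m Q0 (g \o f).
  move=> mg; apply: (integral_transfer mrow maff nuE mC (g := g \o monomial_sum t)).
  by apply: measurableT_comp => //; exact: measurable_monomial_sum.
have [B QB] := bounded_affine c M Af.
have mdphi : measurable_fun setT dphi.
  by apply: continuous_measurable_fun; exact: lipschitz_continuous dPL.
rewrite tr// -massQ; rewrite -massQ in Dp Vp.
have Ep : Rintegral m Q0 f = Rintegral mu D p / mass m Q0 * mass m Q0.
  by rewrite divfK ?gt_eqF// (tr id).
apply: (HC k m Q0 B f phi dphi K Lam th _ s mQ0 _ QB Dp bm nm _ dP P1 dPK Lam0 dPL Ep _ s0 th0 Ks Kth).
- exact: mid_convex_affine.
- exact: poly_like_monomial_sum.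
- rewrite -Vp; symmetry; apply: (tr (fun u => (u - _) ^+ 2)).
  by apply: measurable_funX; apply: measurable_funB.
Qed.

Section polynomial_functionals.
Variables (R : realType) (E : tvsType R).

Lemma poly_functional_monomial_sum d (g : E -> R) : poly_functional d g ->
  exists n (l : 'I_n -> E -> R) (t : seq (R * seq 'I_n)),
    [/\ forall i, linear (l i : E -> R^o), forall i, continuous (l i),
        all (fun m => size m.2 <= d)%N t & g = fun x => monomial_sum t (row_map l x)].
Proof.
move=> [n [l [t [ll cl td gE]]]]; exists n, l, t; split => //.
apply/funext => x; rewrite gE; apply: eq_bigr => m _; congr (_ * _).
by apply: eq_bigr => i _; rewrite mxE.
Qed.

Variables (n : nat) (l : 'I_n -> E -> R) (t : seq (R * seq 'I_n)).
Hypothesis cl : forall i, continuous (l i).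

Lemma measurable_polynomial_functional :
  measurable_fun [set: borelE E] (fun x : borelE E => monomial_sum t (row_map l x)).
Proof.
apply: (@measurableT_comp _ _ _ _ (borel 'rV[R]_n)); first exact: measurable_monomial_sum.
exact: measurable_row_map.
Qed.

Lemma measurable_slab M : @measurable _ (borelE E) (row_map l @^-1` @cube R M n).
Proof.
rewrite -[X in measurable X]setTI; apply: (measurable_row_map cl) => //.
exact: measurable_box.
Qed.

Lemma slab_exhausts (x : E) : exists j0, forall j, (j0 <= j)%N -> (row_map l @^-1` @cube R j%:R n) x.
Proof.
pose b := \sum_i `|l i x|; have b0 : 0 <= b by exact: sumr_ge0.
exists (Num.truncn b).+1 => j bj; apply/cubeE => i; rewrite mxE.
apply: (@le_trans _ _ b); first by rewrite /b (bigD1 i)//= lerDl sumr_ge0.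
have /andP[_ /ltW b1] := truncn_itv b0; apply: le_trans b1 _.
by rewrite ler_nat.
Qed.

Lemma bounded_on_slab M : exists B : R, forall x, (row_map l @^-1` @cube R M n) x ->
  `|monomial_sum t (row_map l x)| <= B.
Proof.
have td : all (fun m => size m.2 <= \max_(m <- t) size m.2)%N t.
  apply/allP => m mt; exact: (@leq_bigmax_seq _ t xpredT (fun m => size m.2)).
have [B _ hB] := poly_like_bound M (poly_like_monomial_sum (1%:M : 'M[R]_n) 0 td).
exists B => x /cubeE hx; have := hB (row_map l x); rewrite mulmx1 addr0; exact.
Qed.

End polynomial_functionals.

(** Approximation and truncation keep at least half of the average and half of the standard
    deviation. [K] is doubled to compensate for the latter, whence 4 = 2 * 2. *)
Lemma log_concave_estimate (R : realType) (d : nat) : (0 < d)%N ->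
  exists2 C : R, 0 <= C & forall (E : tvsType R) (mu : probability (borelE E) R) (f : E -> R)
    (phi dphi : R -> R) (K Lam th : R),
  log_concave mu -> in_Pd mu d f ->
  (forall x : R, is_derive x 1 phi (dphi x)) -> (forall x, `|phi x| <= 1) ->
  (forall x, `|dphi x| <= K) -> 0 <= Lam -> (forall u v, `|dphi u - dphi v| <= Lam * `|u - v|) ->
  0 < Rintegral mu setT (dphi \o f) -> 0 < sigma mu f -> 0 < th ->
  1 <= K * sigma mu f -> 1 <= th ^+ d * K * sigma mu f ->
  Rintegral mu setT (dphi \o f) <= C * (K * th).
Proof.
move=> d0; have [C C0 HC] := functional_estimate R d0.
exists (4 * C); first by rewrite mulr_ge0.
move=> E mu f phi dphi K Lam th lc [mf f2 [p [pP pf]]] dP P1 dPK Lam0 dPL I0 s0 th0 Ks Kth.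
set I := Rintegral mu setT (dphi \o f) in I0 *.
have K0 : 0 <= K := le_trans (normr_ge0 _) (dPK 0).
have sf : square_integrable mu f.
  split => //; apply/integrableP; split; first by apply/measurable_EFinP; exact: measurable_funX.
  by rewrite (eq_integral (fun x : borelE E => ((f x) ^+ 2)%:E))// => x _; rewrite /= ger0_norm// sqr_ge0.
pose V := Rintegral mu setT (fun x : borelE E => (f x - Rintegral mu setT f) ^+ 2).
have V0 : 0 <= V by apply: Rintegral_ge0 => x _; exact: sqr_ge0.
have sV : sigma mu f ^+ 2 = V by exact: sqr_sqrtr.
have Vp : 0 < V by rewrite -sV exprn_gt0.
pose S := Rintegral mu setT (fun x : borelE E => f x ^+ 2).
have S0 : 0 <= S by apply: Rintegral_ge0 => x _; exact: sqr_ge0.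
have L1 : 0 < 16 * (Lam ^+ 2 + 1) by rewrite mulr_gt0// ltr_wpDl// sqr_ge0.
pose eps := Num.min (V / 16) (I ^+ 2 / (16 * (Lam ^+ 2 + 1))).
have e0 : 0 < eps by rewrite lt_min !divr_gt0// exprn_gt0.
have e1 : 2 * eps <= V / 8.
  have : eps <= V / 16 by rewrite ge_min lexx.
  by move: (eps) => e; lra.
have e2 : 2 * Lam ^+ 2 * eps <= I ^+ 2 / 8.
  have : eps <= I ^+ 2 / (16 * (Lam ^+ 2 + 1)) by rewrite ge_min lexx orbT.
  by rewrite ler_pdivlMr//; move: e0; move: (I ^+ 2) (eps) => i e ep; lra.
pose A2 := 1 + (4 * S + 4 * eps).
have A0 : 0 < A2 by rewrite ltr_wpDr// addr_ge0// mulr_ge0// ltW.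
pose del := Num.min 2^-1 (Num.min (I / (4 * (K + 1))) (V / (16 * A2))).
have K1 : 0 < 4 * (K + 1) by rewrite mulr_gt0// ltr_wpDl.
have c16 : 0 < 16 * A2 by rewrite mulr_gt0.
have del0 : 0 < del.
  have v1 := divr_gt0 I0 K1; have v2 := divr_gt0 Vp c16.
  by rewrite !lt_min invr_gt0 v1 v2 ltr0n.
have d1 : del <= 2^-1 by rewrite ge_min lexx.
have d2 : K * del <= I / 4.
  have : del <= I / (4 * (K + 1)) by rewrite !ge_min lexx !orbT.
  by rewrite ler_pdivlMr//; move: del0; move: (del) => e ep; lra.
have d3 : 2 * A2 * del <= V / 8.
  have : del <= V / (16 * A2) by rewrite !ge_min lexx !orbT.
  by rewrite ler_pdivlMr ?mulr_gt0//; move: (del) (A2) => e a; lra.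
have mdphi : measurable_fun setT dphi.
  by apply: continuous_measurable_fun; exact: lipschitz_continuous dPL.
(* Finiteness is extracted along with smallness, because [fine] sends an infinite integral to 0. *)
have [[N1 _ fin1] /cvgrPdist_le/(_ _ e0)[N2 _ near2]] := (fine_cvgP _ _).1 pf.
have {fin1} := fin1 (maxn N1 N2) (leq_maxl _ _).
have {near2} := near2 (maxn N1 N2) (leq_maxr _ _).
have [n [l [t [ll cl td pE]]]] := poly_functional_monomial_sum (pP (maxn N1 N2)).
rewrite /= sub0r normrN pE; set q := fun x : E => monomial_sum t (row_map l x) => near fin.
have mq : measurable_fun [set: borelE E] q := measurable_polynomial_functional t cl.
have mfq : measurable_fun [set: borelE E] (fun x : borelE E => (f x - q x) ^+ 2).
  by apply: measurable_funX; exact: measurable_funB.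
have ifq : integrable_real mu (fun x : borelE E => (f x - q x) ^+ 2).
  apply/integrableP; split; first exact/measurable_EFinP.
  rewrite (eq_integral (fun x : borelE E => ((f x - q x) ^+ 2)%:E))//; first by rewrite ltey_eq fin.
  by move=> x _; rewrite /= ger0_norm// sqr_ge0.
have fqe : Rintegral mu setT (fun x : borelE E => (f x - q x) ^+ 2) <= eps := le_trans (ler_norm _) near.
have mD j := measurable_slab cl j%:R.
have [j tail] := small_tail sf mD (slab_exhausts l) del0.
pose D : set (borelE E) := row_map l @^-1` @cube R j%:R n.
have bq : exists B, forall x, D x -> `|q x| <= B := bounded_on_slab l t j%:R.
have massD := mass_approximation sf (mD j) tail d1.
have hI := bounded_approximation sf mq (mD j) ifq fqe tail mdphi dPK dPL I0 e2 d2.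
have hV := variance_approximation sf mq (mD j) bq ifq fqe tail d1 e1 d3.
rewrite -/D in massD hI hV.
have M0 : 0 < mass mu D by apply: lt_le_trans massD; rewrite invr_gt0.
have M1 : mass mu D <= 1.
  have MT : mass mu setT = 1 by rewrite /mass probability_setT.
  by rewrite -MT; apply: mass_le => //; exact: mD.
set W := Rintegral mu D _ in hV.
have W0 : 0 <= W / mass mu D.
  by apply: divr_ge0; [apply: Rintegral_ge0 => x _; exact: sqr_ge0|exact: ltW].
pose s := Num.sqrt (W / mass mu D).
have sW : W = s ^+ 2 * mass mu D by rewrite sqr_sqrtr// divfK// gt_eqF.
have ss : sigma mu f <= 2 * s.
  have s20 : 0 <= 2 * s by rewrite mulr_ge0// sqrtr_ge0.
  rewrite -(ler_pXn2r (_ : 0 < 2)%N) ?nnegrE ?(ltW s0)//.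
  move: hV; rewrite sW ler_pM2r// -/V sV (_ : (2 * s) ^+ 2 = s ^+ 2 * 4); last by ring.
  by rewrite ler_pdivrMr.
have sp : 0 < s by rewrite -(@pmulr_rgt0 _ 2)// (lt_le_trans s0).
have Ks2 : K * sigma mu f <= 2 * K * s.
  by rewrite (_ : 2 * K * s = K * (2 * s)); [exact: ler_wpM2l|ring].
have dPK2 x : `|dphi x| <= 2 * K by apply: le_trans (dPK x) _; rewrite ler_peMl// ler1n.
have h1 : 1 <= 2 * K * s by exact: le_trans Ks2.
have h2 : 1 <= th ^+ d * (2 * K) * s.
  apply: le_trans Kth _; rewrite -!mulrA; apply: ler_wpM2l; first by rewrite exprn_ge0// ltW.
  by move: Ks2; rewrite -mulrA.
have := HC E mu n l t j%:R phi dphi (2 * K) Lam th s lc ll cl td dP P1 dPK2 Lam0 dPL M0 sW sp th0 h1 h2.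
rewrite -/D -/q => h3; have : I / 2 <= C * (2 * K * th).
  apply: le_trans hI (le_trans h3 _); rewrite ler_piMr//.
  by rewrite mulr_ge0// mulr_ge0 ?(ltW th0)// mulr_ge0.
by rewrite ler_pdivrMr//; move=> h; apply: le_trans h _; rewrite le_eqVlt; apply/orP; left; apply/eqP; ring.
Qed.

Theorem theorem5p1 (R : realType) (d : nat) (hd : (1 <= d)%N) :
  exists C : R,
    forall (E : tvsType R) (mu : probability (borelE E) R) (f : E -> R),
      radon mu -> log_concave mu -> in_Pd mu d f ->
      forall phi : R -> R, Cb_infty phi -> (forall t, `|phi t| <= 1) ->
        ((powR (sigma mu f) (d%:R^-1))%:E *
           \int[mu]_x ((derive1 phi) (f x))%:E
         <= (C * powR (supnorm (derive1 phi)) (1 - d%:R^-1))%:E)%E.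
Proof.
have [C C0 HC] := log_concave_estimate R hd.
exists (C + 1) => E mu f _ lc Pf phi [smooth bounded] phi1.
have mf : measurable_fun [set: borelE E] f by have [] := Pf.
set dphi := derive1 phi; set K := supnorm dphi; set s := sigma mu f; set a : R := d%:R^-1.
have is_d (g : R -> R) (x : R) : derivable g x 1 -> is_derive x 1 g (derive1 g x).
  by move=> dg; apply: DeriveDef; rewrite // derive1E.
have dP (x : R) : is_derive x 1 phi (dphi x) := is_d _ _ (smooth 0%N x).
have dPK x : `|dphi x| <= K.
  have [M hM] := bounded 1%N.
  apply: ub_le_sup; last by exists x.
  by exists M => _ [y _ <-]; exact: hM.
have [Lam hLam] := bounded 2%N.
have Lam0 : 0 <= Lam := le_trans (normr_ge0 _) (hLam 0).
have dPL : forall u v, `|dphi u - dphi v| <= Lam * `|u - v|.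
  exact: (derivative_lipschitz (fun x => is_d _ _ (smooth 1%N x)) hLam).
have mdphi : measurable_fun setT dphi.
  by apply: continuous_measurable_fun; exact: lipschitz_continuous dPL.
have bf : bounded_measurable (setT : set (borelE E)) (dphi \o f).
  by split; [exact: measurableT_comp|exists K => x _; exact: dPK].
pose I := Rintegral mu setT (dphi \o f).
have -> : (\int[mu]_x (dphi (f x))%:E = I%:E)%E.
  rewrite /I /Rintegral fineK//; apply: integrable_fin_num => //.
  exact: (bounded_integrable measurableT (@subset_refl _ _) bf).
have IK : I <= K.
  have MT : mass mu setT = 1 by rewrite /mass probability_setT.
  have := J_bound (m := mu) measurableT (@subset_refl _ _) bf (fun x _ => dPK (f x)).
  by rewrite MT mulr1; apply: le_trans; exact: ler_norm.
have C1 : 0 <= C + 1 by rewrite addr_ge0.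
have s0 : 0 <= s by exact: sqrtr_ge0.
rewrite -EFinM lee_fin.
have [I0|I0] := leP I 0.
  apply: (@le_trans _ _ 0); first by rewrite mulr_ge0_le0// powR_ge0.
  by rewrite mulr_ge0// powR_ge0.
have K0 : 0 < K by exact: lt_le_trans I0 IK.
have a0 : 0 < a by rewrite invr_gt0 ltr0n.
have [sz|sn] := eqVneq s 0.
  by rewrite sz powR0 ?gt_eqF// mul0r mulr_ge0// powR_ge0.
have sp : 0 < s by rewrite lt_def sn.
set u := s `^ a; set w := K `^ a.
have [u0 w0] : 0 < u /\ 0 < w by split; exact: powR_gt0.
have -> : K `^ (1 - a) = K / w.
  by rewrite powRB ?powRr1 ?(ltW K0)//; apply/implyP => _; rewrite gt_eqF.
have uw : w * u = (K * s) `^ a by rewrite powRM// ltW.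
rewrite mulrA ler_pdivlMr//.
(* If K s < 1, then (K s)^(1/d) <= 1 and the trivial bound I <= K suffices; this case accounts for
   the 1 in C + 1. *)
have [Ks|Ks] := leP 1 (K * s); last first.
  have uw1 : w * u <= 1.
    have -> : 1 = 1 `^ a :> R by rewrite powR1.
    rewrite uw; apply: (ge0_ler_powR (ltW a0)) => //; last exact: ltW.
    - by rewrite nnegrE mulr_ge0// ltW.
    - by rewrite nnegrE.
  rewrite mulrC mulrA (_ : (C + 1) * K = C * K + 1 * K); last by ring.
  apply: (@le_trans _ _ (1 * K)); first by apply: ler_pM => //; rewrite ?mulr_ge0// ltW.
  by rewrite lerDr mulr_ge0// ltW.
(* This is (K s)^(-1/d), so that th^d K s = 1. *)
pose th := (w * u)^-1.
have th0 : 0 < th by rewrite invr_gt0 mulr_gt0.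
have thd : 1 <= th ^+ d * K * s.
  rewrite -mulrA /th exprVn uw -powR_mulrn ?powR_ge0// -powRrM mulVf ?pnatr_eq0 -?lt0n//.
  by rewrite powRr1 ?mulVf// ?gt_eqF ?mulr_gt0// mulr_ge0// ltW.
have main := HC E mu f phi dphi K Lam th lc Pf dP phi1 dPK Lam0 dPL I0 sp th0 Ks thd.
have : u * I * w <= u * (C * (K * th)) * w by rewrite ler_pM2r// ler_pM2l.
rewrite (_ : u * (C * (K * th)) * w = C * K).
  by move=> h; apply: le_trans h _; rewrite mulrDl lerDl mul1r ltW.
by rewrite /th; field; rewrite !gt_eqF.
Qed.
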